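(* Let $a\in\mathcal{H}_a$ be real. Then for all $f,g\in\mathcal{C}$ we have \[\mathcal{E}^a(f,g)=\mathcal{E}_c^a(f,g)+\mathcal{E}_j^a(f,g),\] where $\mathcal{E}_c^a(f,g)=\left\langle (\partial_c+ia_c)f,(\partial_c+ia_c)g\right\rangle_{\mathcal{H}_c}$ and \[\mathcal{E}_j^a(f,g)=\int_{X\times X\setminus\mathrm{diag}}\bigl(f(x)-e^{ia_j(x,y)}f(y)\bigr)\overline{\bigl(g(x)-e^{ia_j(x,y)}g(y)\bigr)}\,J(d(x,y)).\]
   Context: Setting. $(X,\varrho)$ is a locally compact separable metric space, $\mu$ a nonnegative Radon measure on $X$ with full support, and $(\mathcal{E},\mathcal{F})$ a regular symmetric Dirichlet form on $L^2(X,\mu)$ which is conservative, i.e. $P_t\mathbf{1}=\mathbf{1}$ for all $t>0$, where $(P_t)_{t>0}$ is the associated Markovian semigroup with transition kernels $P_t(x,dy)$. Function spaces and forms are complexified (conjugate linear in the second argument). Put $\Pi_t(dxdy)=\frac1t P_t(x,dy)\mu(dx)$ (a symmetric measure on $X\times X$), $\mathcal{C}=\mathcal{F}\cap C_c(X)$, $\mathrm{diag}=\{(x,x):x\in X\}$. $J$ is the jump measure of $(\mathcal{E},\mathcal{F})$: the symmetric nonnegative Radon measure on $X\times X\setminus\mathrm{diag}$ in the Beurling–Deny decomposition $\mathcal{E}(f,g)=\mathcal{E}_c(f,g)+\int_{X\times X\setminus \mathrm{diag}}(f(x)-f(y))\overline{(g(x)-g(y))}J(d(x,y))$, $f,g\in\mathcal{C}$,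 with $\mathcal{E}_c$ strongly local. $\mathcal{D}$ is the algebra of functions on $X$ spanned by $\mathcal{C}$ and the constants. 1-forms. For $f\in\mathcal{D}$ put $df(x,y)=f(x)-f(y)$. $\Omega^1(\mathcal{D})$ is the linear span of the functions $(df)g:(x,y)\mapsto g(y)(f(x)-f(y))$ on $X\times X$, $f,g\in\mathcal{D}$, and $\Omega^1_a(\mathcal{D})$ is its subspace of antisymmetric functions. $\mathcal{H}$ is the Hilbert space obtained from $\Omega^1(\mathcal{D})$ by factoring out zero seminorm elements and completing with respect to the Hilbert seminorm $\|\omega\|_{\mathcal{H}}^2=\lim_{t\to0}\frac12\int_X\int_X|\omega(x,y)|^2\Pi_t(dxdy)$. The class of $(df)g$ is denoted $f\otimes g$, and $\partial f:=f\otimes\mathbf{1}$ is the class of $df$. For $h\in\mathcal{D}$ a right action on $\mathcal{H}$ is defined by linear and continuous extension of $(f\otimes g)h:=f\otimes(gh)$ (multiplication by $h(y)$), and a left action by $h(f\otimes g):=(fh)\otimes g-h\otimes(fg)$ (multiplication by $h(x)$). $\mathcal{H}_a$ is the closure of $\Omega_a^1(\mathcal{D})$ in $\mathcal{H}$. The seminorm $\|\omega\|_{\mathcal{H}_j}^2:=\int_{X\times X\setminus\mathrm{diag}}|\omega(x,y)|^2J(d(x,y))$ on $\Omega^1(\mathcal{D})$ is dominated by $\|\cdot\|_{\mathcal{H}}$ and extends to $\mathcal{H}$; $\mathcal{H}_c$ is its kernel and $\mathcal{H}_j=\mathcal{H}_c^\bot$, so each $\omega\in\mathcal{H}$ is uniquely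 $\omega=\omega_c+\omega_j$ with $\omega_c\in\mathcal{H}_c$, $\omega_j\in\mathcal{H}_j$, and $\omega_j$ is identified with an element of $L^2(X\times X\setminus\mathrm{diag},J)$. $\langle\cdot,\cdot\rangle_{\mathcal{H}_c}$ is the scalar product of $\mathcal{H}$ restricted to $\mathcal{H}_c$; $\partial_cf:=(\partial f)_c$; $(\partial_c+ia_c)f:=\partial_cf+i\,a_cf$, where $a_cf$ denotes the action of $f$ on $a_c$ (left and right actions coincide on $\mathcal{H}_c$). An element of $\mathcal{H}$ is called real if it is a limit in $\mathcal{H}$ of real valued functions from $\Omega^1(\mathcal{D})$. Magnetic energy. For real valued $a\in\Omega_a^1(\mathcal{D})$ and $f\in\mathcal{C}$ put $\mathcal{E}^a(f):=\lim_{t\to0}\frac12\int_X\int_X|f(x)-e^{ia(x,y)}f(y)|^2\Pi_t(dxdy)$. For real $a\in\mathcal{H}_a$ put $\mathcal{E}^a(f):=\lim_n\mathcal{E}^{a_n}(f)$ for any sequence of real valued $a_n\in\Omega^1_a(\mathcal{D})$ with $a_n\to a$ in $\mathcal{H}$ (the limit does not depend on the sequence). $\mathcal{E}^a(f,g)$ is defined by polarization.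
   Formalization: The sign in the local part is corrected: the theorem has ∂_c − i a_c in place of the printed ∂_c + i a_c, which is false under the stated conventions (a = dl on the line gives E^a(f) = E(e^{-il}f)). *)

(* Defs.v *)
From HB Require Import structures.
From mathcomp Require Import all_boot all_order all_algebra.
From mathcomp Require Import complex sesquilinear.
From mathcomp Require Import all_classical all_reals all_analysis.

Set Implicit Arguments.
Unset Strict Implicit.
Unset Printing Implicit Defensive.

Import Order.TTheory GRing.Theory Num.Theory.
Import numFieldNormedType.Exports.

Local Open Scope classical_set_scope.
Local Open Scope ring_scope.
Local Open Scope complex_scope.

(* Measurable types are pointed in the library, so a metric space carrying a
   Borel sigma-algebra has to be nonempty. *)
#[short(type="pmetricType")]
HB.structure Definition PointedMetric (K : numDomainType) :=
  {M of Metric K M & isPointed M}.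

Notation borel X := (g_sigma_algebraType (@open X)).

Definition separable_space (T : topologicalType) : Prop :=
  exists2 A : set T, countable A & dense A.

(* Radon measure on the part U of a space whose compact sets are K. *)
Definition radon_on d (T : measurableType d) (R : realType)
    (m : {measure set T -> \bar R}) (K : set (set T)) (U : set T) : Prop :=
  (forall A, K A -> A `<=` U -> (m A < +oo)%E) /\
  (forall B, measurable B -> B `<=` U ->
     m B = ereal_sup [set m A | A in [set A | K A /\ A `<=` B]]).

Definition diag (T : Type) : set (T * T) := [set z | z.1 = z.2].

Section RealDirichletForms.
Context (R : realType) (X : pmetricType R).
Variable mu : {measure set borel X -> \bar R}.
Implicit Types f g h : X -> R.

Definition full_support : Prop :=
  forall U : set X, open U -> U !=set0 -> (0 < mu U)%E.

Definition dotL2 f g : R := \int[mu]_x (f x * g x).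

Definition sqnormL2 f : R := dotL2 f f.

(* The real L^2(X, mu) is handled through functions: the domain is a set of
   square integrable functions, stable under mu-a.e. modification. *)
Record dirichlet_form := DirichletForm {
  dom : set (X -> R);
  form : (X -> R) -> (X -> R) -> R;
  dom_L2 : forall f, dom f -> f \in Lfun mu 2%:E;
  dom_ae : forall f g, dom f -> g \in Lfun mu 2%:E ->
    {ae mu, forall x, f x = g x} ->
    dom g /\ (forall h, dom h -> form f h = form g h);
  dom_linear : forall (c : R) f g, dom f -> dom g ->
    dom (fun x => c * f x + g x);
  form_sym : forall f g, dom f -> dom g -> form f g = form g f;
  form_linear : forall (c : R) f g h, dom f -> dom g -> dom h ->
    form (fun x => c * f x + g x) h = c * form f h + form g h;
  form_ge0 : forall f, dom f -> 0 <= form f f;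
  dom_dense : forall f, f \in Lfun mu 2%:E -> forall e : R, 0 < e ->
    exists2 g, dom g & sqnormL2 (fun x => f x - g x) < e;
  form_closed : forall u : nat -> X -> R, (forall n, dom (u n)) ->
    (forall e : R, 0 < e ->
       exists N : nat, forall m n : nat, (N <= m)%N -> (N <= n)%N ->
         let v x := u m x - u n x in form v v + sqnormL2 v < e) ->
    exists2 f, dom f &
      (fun n => let v x := u n x - f x in form v v + sqnormL2 v) @ \oo
        --> (0 : R);
  form_markov : forall f, dom f ->
    let g x := Num.min (Num.max (f x) 0) 1 in
    dom g /\ form g g <= form f f }.

Definition compactly_supported f : Prop :=
  continuous f /\ compact (closure [set x | f x != 0]).

Variable E : dirichlet_form.

Definition real_core : set (X -> R) := dom E `&` compactly_supported.

Definition regular_form : Prop :=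
  (forall f, dom E f -> forall e : R, 0 < e -> exists2 g, real_core g &
     let v x := f x - g x in form E v v + sqnormL2 v < e) /\
  (forall f, compactly_supported f -> forall e : R, 0 < e ->
     exists2 g, real_core g & forall x, `|f x - g x| < e).

(* Beurling-Deny decomposition without killing part: J is the jump measure.
   It is a measure on X x X, but only its restriction to the complement of
   the diagonal is ever used.  The complex decomposition is the
   complexification of this one. *)
Definition strongly_local (Ec : (X -> R) -> (X -> R) -> R) : Prop :=
  forall f g, real_core f -> real_core g ->
    (exists U : set X, [/\ open U, closure [set x | f x != 0] `<=` U &
       exists c : R, forall x, U x -> g x = c]) ->
    Ec f g = 0.

Definition symmetric_form_on_core (Ec : (X -> R) -> (X -> R) -> R) : Prop :=
  [/\ forall f g, real_core f -> real_core g -> Ec f g = Ec g f,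
      forall (c : R) f g h, real_core f -> real_core g -> real_core h ->
        Ec (fun x => c * f x + g x) h = c * Ec f h + Ec g h &
      forall f, real_core f -> 0 <= Ec f f].

Definition is_jump_measure
    (J : {measure set (borel X * borel X) -> \bar R}) : Prop :=
  [/\ radon_on J (@compact (X * X)%type) (~` @diag X),
      forall A : set (borel X * borel X), measurable A ->
        A `<=` ~` @diag X -> J ((fun z => (z.2, z.1)) @^-1` A) = J A,
      forall f, real_core f ->
        J.-integrable (~` @diag X) (fun z => ((f z.1 - f z.2) ^+ 2)%:E) &
      exists Ec, [/\ symmetric_form_on_core Ec, strongly_local Ec &
        forall f g, real_core f -> real_core g -> form E f g = Ec f g +
          \int[J]_(z in ~` @diag X) ((f z.1 - f z.2) * (g z.1 - g z.2))]].

(* Only the kernels P t with t > 0 are relevant. *)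
Variable P : R -> R.-spker borel X ~> borel X.

Definition semigroup_op (t : R) f : X -> R := fun x => \int[P t x]_y f y.

Record symmetric_markov_semigroup : Prop := {
  semigroup_sym : forall t : R, 0 < t -> forall A B : set (borel X),
    measurable A -> measurable B ->
    (\int[mu]_(x in A) P t x B = \int[mu]_(x in B) P t x A)%E;
  semigroupD : forall s t : R, 0 < s -> 0 < t ->
    forall A : set (borel X), measurable A ->
    {ae mu, forall x, P (s + t) x A = (\int[P s x]_y P t y A)%E};
  semigroup_cont : forall f, f \in Lfun mu 2%:E ->
    sqnormL2 (fun x => semigroup_op t f x - f x) @[t --> 0^'+] --> (0 : R) }.

Definition conservative : Prop :=
  forall t : R, 0 < t -> {ae mu, forall x, P t x [set: borel X] = 1%E}.

(* (P_t) is associated with E: the generator of (P_t) on L^2(X, mu), i.e. the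
   strong derivative at 0, is the operator L defined by the form through
   E(f, g) = - <L f, g> for all g in the domain of E. *)
Definition associated : Prop :=
  forall f h, f \in Lfun mu 2%:E -> h \in Lfun mu 2%:E ->
    (sqnormL2 (fun x => t^-1 * (semigroup_op t f x - f x) - h x)
       @[t --> 0^'+] --> (0 : R)) <->
    (dom E f /\ forall g, dom E g -> form E f g = - dotL2 h g).

End RealDirichletForms.

Section OneForms.
Context (R : realType) (X : pmetricType R).
Variable mu : {measure set borel X -> \bar R}.
Variable E : dirichlet_form mu.
Variable P : R -> R.-spker borel X ~> borel X.

Notation C := R[i].
Implicit Types (f g h : X -> C) (w : X * X -> C).

(* The complexification of F /\ C_c(X). *)
Definition core : set (X -> C) :=
  [set f | real_core E (fun x => complex.Re (f x)) /\
           real_core E (fun x => complex.Im (f x))].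

Definition core_cst : set (X -> C) :=
  [set f | exists f0, core f0 /\ exists c : C, f = fun x => f0 x + c].

(* The function (df)g on X x X. *)
Definition elem_form f g : X * X -> C :=
  fun z => g z.2 * (f z.1 - f z.2).

Definition Omega1 : set (X * X -> C) :=
  [set w | exists n (c : 'I_n -> C) (f g : 'I_n -> X -> C),
     (forall k, core_cst (f k) /\ core_cst (g k)) /\
     w = fun z => \sum_(k < n) c k * elem_form (f k) (g k) z].

Definition Omega1a : set (X * X -> C) :=
  [set w | Omega1 w /\ forall x y, w (y, x) = - w (x, y)].

Definition real_valued w : Prop := forall z, complex.Im (w z) = 0.

Definition sqmod (z : C) : R := ComplexField.Normc.normc z ^+ 2.

(* (1/2) \int \int |w(x,y)|^2 Pi_t(dxdy) *)
Definition half_Pi_sqnorm (t : R) w : \bar R :=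
  ((2 * t)^-1%:E * \int[mu]_x \int[P t x]_y (sqmod (w (x, y)))%:E)%E.

(* The Hilbert space H: the completion of Omega1 modulo the null space of its
   seminorm, characterized (up to isometry) as a complete space with an
   isometric linear map of dense range; [ofclass w] is the class of w.  The
   right action is the continuous linear extension of (f (x) g) h :=
   f (x) (g h), where f (x) g is the class of (df)g. *)
Record one_form_space := OneFormSpace {
  oneform :> completeNormedModType C;
  ip : {dot oneform for (@conjc R)};
  ip_norm : forall u : oneform, `|u| ^+ 2 = ip u u;
  ofclass : (X * X -> C) -> oneform;
  ofclass_linear : forall (c : C) w1 w2, Omega1 w1 -> Omega1 w2 ->
    ofclass (fun z => c * w1 z + w2 z) = c *: ofclass w1 + ofclass w2;
  ofclass_sqnorm : forall w, Omega1 w -> half_Pi_sqnorm t w @[t --> 0^'+] -->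
    (complex.Re (ip (ofclass w) (ofclass w)))%:E;
  ofclass_dense : dense [set ofclass w | w in Omega1];
  ract : (X -> C) -> oneform -> oneform;
  ract_linear : forall h, core_cst h -> forall (c : C) (u v : oneform),
    ract h (c *: u + v) = c *: ract h u + ract h v;
  ract_continuous : forall h, core_cst h -> continuous (ract h);
  ract_elem : forall f g h, core_cst f -> core_cst g -> core_cst h ->
    ract h (ofclass (elem_form f g)) =
    ofclass (elem_form f (fun x => g x * h x)) }.

Variables (H : one_form_space).

Definition partial f : H := ofclass H (elem_form f (fun=> 1)).

Definition Ha : set H := closure [set ofclass H w | w in Omega1a].

Definition real_oneform (u : H) : Prop :=
  exists w_ : nat -> X * X -> C,
    (forall n, Omega1 (w_ n) /\ real_valued (w_ n)) /\
    (fun n => ofclass H (w_ n)) @ \oo --> u.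

(* The extension G(u) := lim_n G(w_n), for any w_n in S with w_n --> u. *)
Definition extend_along (S : set (X * X -> C)) (G : (X * X -> C) -> \bar R)
    (u : H) : \bar R :=
  get [set v | forall w_ : nat -> X * X -> C, (forall n, S (w_ n)) ->
    (fun n => ofclass H (w_ n)) @ \oo --> u ->
    (fun n => G (w_ n)) @ \oo --> v].

Variable J : {measure set (borel X * borel X) -> \bar R}.

Definition jump_sqnorm w : \bar R :=
  (\int[J]_(z in ~` @diag X) (sqmod (w z))%:E)%E.

(* H_c is the kernel of the extension to H of the seminorm of L^2(J), and H_j
   is its orthogonal complement. *)
Definition Hc : set H := [set u | extend_along Omega1 jump_sqnorm u = 0%E].

Definition Hc_part (u : H) : H :=
  xget 0 [set v | Hc v /\ forall w : H, Hc w -> ip H (u - v) w = 0].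

Definition Hj_part (u : H) : H := u - Hc_part u.

(* phi represents the element of L^2(X x X \ diag, J) identified with u. *)
Definition jump_representative (u : H) (phi : X * X -> C) : Prop :=
  [/\ measurable_fun (~` @diag X : set (borel X * borel X))
        (fun z => complex.Re (phi z)),
      measurable_fun (~` @diag X : set (borel X * borel X))
        (fun z => complex.Im (phi z)) &
      forall w_ : nat -> X * X -> C, (forall n, Omega1 (w_ n)) ->
        (fun n => ofclass H (w_ n)) @ \oo --> u ->
        (fun n => jump_sqnorm (fun z => w_ n z - phi z)) @ \oo --> 0%E].

Definition expc (z : C) : C :=
  (expR (complex.Re z))%:C * (cos (complex.Im z) +i* sin (complex.Im z)).

Definition twisted_diff (a : X * X -> C) f : X * X -> C :=
  fun z => f z.1 - expc ('i%C * a z) * f z.2.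

Definition magnetic_energy_fun (a : X * X -> C) f : \bar R :=
  lim (half_Pi_sqnorm t (twisted_diff a f) @[t --> 0^'+]).

Definition magnetic_energy (a : H) f : \bar R :=
  extend_along (Omega1a `&` real_valued)
    (fun w => magnetic_energy_fun w f) a.

(* Polarization of a quadratic form into a form which is conjugate linear in
   its second argument. *)
Definition magnetic_form (a : H) f g : C :=
  4^-1 * \sum_(k < 4)
    'i%C ^+ k * (fine (magnetic_energy a (fun x => f x + 'i%C ^+ k * g x)))%:C.

(* The action of f on a_c is the right one; both actions coincide on H_c.
   The sign is the one forced by the conventions df(x, y) = f x - f y and
   f x - exp(i a(x, y)) f y = df(x, y) - i a(x, y) f y + O(a^2): for a = dl
   with l real, the energy of a at f is the energy of 0 at exp(-i l) f, whose
   strongly local part is the squared norm of (d_c - i a_c) f. *)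
Definition magnetic_derivative_c (a : H) f : H :=
  Hc_part (partial f) - 'i%C *: ract f (Hc_part a).

Definition magnetic_form_c (a : H) f g : C :=
  ip H (magnetic_derivative_c a f) (magnetic_derivative_c a g).

Definition magnetic_form_j (aj : X * X -> C) f g : C :=
  let F z := twisted_diff aj f z * (twisted_diff aj g z)^* in
  (\int[J]_(z in ~` @diag X) complex.Re (F z))
    +i* (\int[J]_(z in ~` @diag X) complex.Im (F z)).

End OneForms.

(* Main.v *)
Require Import Defs.
From HB Require Import structures.
From mathcomp Require Import all_boot all_order all_algebra.
From mathcomp Require Import complex sesquilinear.
From mathcomp Require Import all_classical all_reals all_analysis.
From mathcomp Require Import finmap measurable_realfun measurable_fun_approximation simple_functions.
From mathcomp Require Import ring lra.

(* Let K be the closure in H of the classes of sums of functions F(x) G(y), F and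
   G having separated supports.  By strong locality the norms of H and of L^2(J)
   agree on K.  Cutting a 1-form off away from the diagonal, one sees that the
   L^2(J) norm of any w is the norm of the projection of w to K, so that H_c is
   the orthogonal complement of K; moreover K contains the class of every product
   of two 1-forms.  As (1 + i w / m)^m is 1 + i w up to such products, the 1-forms
   f(x) - (1 + i w / m)^m f(y) and df - i w f(y) have the same component in H_c.
   The error e^{i w} - (1 + i w / m)^m is at most c_m |w| with c_m -> 0, so the
   energy of f twisted by w is the squared norm of the component of df - i w f(y)
   in H_c plus the squared L^2(J) norm of f(x) - e^{i w} f(y).  Both terms are
   continuous in w, and the theorem follows by polarization.

   That (1/t) <f - P_t f, g> tends to E(f, g) is derived from the definition of
   the generator: Riesz representation for the form provides resolvents, the
   semigroup property makes (1/t) <f - P_t f, f> monotone in t, and closedness of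
   the form puts into its domain every f for which these numbers are bounded. *)

(** The energy of a twisted f is a limit of integrals against Pi_t, whose total mass explodes as t
    -> 0, so a uniformly small error controls nothing. An error has to be bounded pointwise by a
    small multiple of a 1-form, because squared norms of 1-forms have finite limits; this is why the
    factor |w| in the error of (1 + i w / m)^m matters. The Markov property is given for the unit
    contraction, while multiplying and cutting off 1-forms takes a core that is stable under
    products and Lipschitz maps. This is what the domain criterion by bounded approximating forms is
    for: a pointwise bound on increments passes to all these forms at once. For general a the jump
    part a_j is only in L^2(J) and may be unbounded. The estimate |e^{is} - e^{it}| <= |s - t| still
    makes the twisted jump energy continuous in a, whereas the component in H_c depends on a
    affinely. *)

Set Implicit Arguments.
Unset Strict Implicit.
Unset Printing Implicit Defensive.

Import Order.TTheory GRing.Theory Num.Theory.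
Import numFieldNormedType.Exports.

Local Open Scope classical_set_scope.
Local Open Scope ring_scope.
Local Open Scope complex_scope.

(** * Induction on nonnegative measurable functions *)

Section ge0_measurable_induction.
Context d (T : measurableType d) (R : realType).
Local Open Scope ereal_scope.
Import HBNNSimple.

(** Serves to prove identities between iterated integrals: they are checked on indicators, and the
    closure properties are linearity and monotone convergence. *)
Lemma ge0_measurable_ind (Q : (T -> \bar R) -> Prop) :
  (forall A, measurable A -> Q (fun x => (\1_A x)%:E)) ->
  (forall f g : T -> \bar R, (forall x, 0 <= f x) -> (forall x, 0 <= g x) ->
     measurable_fun setT f -> measurable_fun setT g -> Q f -> Q g ->
     Q (fun x => f x + g x)) ->
  (forall (c : R) (f : T -> \bar R), (0 <= c)%R -> (forall x, 0 <= f x) ->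
     measurable_fun setT f -> Q f -> Q (fun x => c%:E * f x)) ->
  (forall f_ : (T -> \bar R)^nat, (forall n x, 0 <= f_ n x) ->
     (forall n, measurable_fun setT (f_ n)) ->
     (forall x, nondecreasing_seq (f_ ^~ x)) -> (forall n, Q (f_ n)) ->
     Q (fun x => limn (f_ ^~ x))) ->
  forall f, (forall x, 0 <= f x) -> measurable_fun setT f -> Q f.
Proof.
move=> Q1 QD QZ Ql f f0 mf.
pose f_ := nnsfun_approx measurableT mf.
have -> : f = fun x => limn (fun n => (f_ n x)%:E).
  by apply/funext => x; apply/esym/cvg_lim => //; exact: cvg_nnsfun_approx.
apply: Ql => //.
- by move=> n x; rewrite lee_fin.
- by move=> n; exact/measurable_EFinP.
- by move=> x a b ab; rewrite lee_fin; exact/lefP/nd_nnsfun_approx.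
move=> n; set h := f_ n.
have hE : (fun x => (h x)%:E) = (fun x => \sum_(r <- fset_set (range h))
    ((r * \1_(h @^-1` [set r]) x)%R)%:E).
  apply/funext => x; rewrite fimfunE -fsumEFin// fsbig_finite//.
rewrite hE.
have ind1 (A : set T) (c : R) : measurable A -> (0 <= c)%R ->
   Q (fun x => ((c * \1_A x)%R)%:E).
  move=> mA c0; under eq_fun do rewrite EFinM.
  apply: QZ => //; last exact: Q1.
  exact/measurable_EFinP/measurable_indic.
have ml r : measurable_fun setT (fun x => (r * \1_(h @^-1` [set r]) x)%:E).
  exact/measurable_EFinP/measurableT_comp.
have Q0 : Q (cst 0).
  by have := ind1 set0 0%R measurable0 (lexx _); congr Q; apply/funext => x; rewrite mul0r.
(* The induction below runs over an arbitrary list of reals, so negative r must be covered: their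
   level sets are empty and the term is 0. *)
have indr r : (forall x, 0 <= (r * \1_(h @^-1` [set r]) x)%:E) /\
   Q (fun x => ((r * \1_(h @^-1` [set r]) x)%R)%:E).
  case: (leP 0%R r) => r0.
    by split => [x|]; [rewrite lee_fin mulr_ge0|exact: ind1].
  have e x : (r * \1_(h @^-1` [set r]) x = 0)%R.
    by rewrite (_ : _ @^-1` _ = set0) ?indic0 ?mulr0 ?preimage_nnfun0.
  split=> [x|]; first by rewrite e.
  by under eq_fun do rewrite e.
suff : [/\ forall x, 0 <= \sum_(r <- fset_set (range h))
    ((r * \1_(h @^-1` [set r]) x)%R)%:E,
    measurable_fun setT (fun x => \sum_(r <- fset_set (range h))
    ((r * \1_(h @^-1` [set r]) x)%R)%:E) & Q (fun x => \sum_(r <- fset_set (range h))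
    ((r * \1_(h @^-1` [set r]) x)%R)%:E)] by case.
elim: (fset_set (range h) : seq R) => [|r s [s0 ms Qs]].
  split.
  - by move=> x; rewrite big_nil.
  - by under eq_fun do rewrite big_nil; exact: measurable_cst.
  - by under eq_fun do rewrite big_nil.
have [r0 Qr] := indr r.
split.
- by move=> x; rewrite big_cons adde_ge0.
- by under eq_fun do rewrite big_cons; exact: emeasurable_funD.
- by under eq_fun do rewrite big_cons; exact: QD.
Qed.

End ge0_measurable_induction.

(** The value c = +oo is included: with 0 * +oo = 0 both sides vanish if u is identically 0;
    otherwise u is eventually positive and both sides are +oo. *)
Lemma limn_ge0_muler (R : realType) (u : (\bar R)^nat) (c : \bar R) :
  (forall n, 0 <= u n)%E -> nondecreasing_seq u -> (0 <= c)%E ->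
  limn (fun n => u n * c)%E = (limn u * c)%E.
Proof.
move=> u0 ndu c0; have cu : cvgn u by exact: ereal_nondecreasing_is_cvgn.
case: c c0 => [c| |//] c0.
  by apply/cvg_lim => //; exact: cvgeZr.
have [all0|/existsNP[n0 un0]] := pselect (forall n, u n = 0%E).
  have -> : u = cst 0%E by apply/funext.
  by rewrite (_ : (fun _ => _) = cst 0%E) ?lim_cst ?mul0e//; apply/funext => n/=; rewrite mul0e.
have up : (0 < u n0)%E by rewrite lt_neqAle u0 andbT eq_sym; apply/eqP.
have -> : (limn u * +oo = +oo)%E.
  rewrite gt0_muley// (lt_le_trans up)//; apply: lime_ge => //.
  by exists n0 => // n; exact: ndu.
apply/cvg_lim => //; apply: cvg_near_cst; exists n0 => // n /= n0n.
by rewrite gt0_muley// (lt_le_trans up)//; exact: ndu.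
Qed.

(** * The measure m(dx) k(x, dy) of a kernel *)

Section joint_measure.
Context d (T : measurableType d) (R : realType).
Variables (m : {measure set T -> \bar R}) (k : R.-spker T ~> T).
Local Open Scope ereal_scope.

(** For m = mu and k = P_t this is t Pi_t. As a single measure on the product it makes integrability
    by domination and linearity of the integral available. *)
Definition joint (A : set (T * T)) : \bar R := \int[m]_x k x (xsection A x).

Lemma inner_integral_indic A x : measurable A ->
  \int[k x]_y (\1_A (x, y))%:E = k x (xsection A x).
Proof.
move=> mA; rewrite -[xsection A x]setIT -integral_indic//; last exact: measurable_xsection.
by apply: eq_integral => y _; rewrite !indicE mem_xsection.
Qed.

Let joint0 : joint set0 = 0.
Proof. by rewrite /joint integral0_eq// => x _; rewrite xsection0 measure0. Qed.

Let joint_ge0 A : 0 <= joint A.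
Proof. exact: integral_ge0. Qed.

Let measurable_xs A : measurable A ->
  measurable_fun setT (fun x => k x (xsection A x)).
Proof.
move=> mA.
under eq_fun do rewrite -inner_integral_indic//.
apply: (measurable_fun_integral_sfinite_kernel (fun z => (\1_A z)%:E) k).
  by move=> z; rewrite lee_fin.
by apply/measurable_EFinP; exact: measurable_indic.
Qed.

Let joint_sigma_additive : semi_sigma_additive joint.
Proof.
move=> A mA tA mbigcup.
have -> : joint (\bigcup_n A n) =
    \sum_(0 <= n <oo) \int[m]_x k x (xsection (A n) x).
  rewrite -integral_nneseries//; last by move=> n; exact: measurable_xs.
  apply: eq_integral => x _; rewrite xsection_bigcup.
  rewrite measure_semi_bigcup//.
  - by move=> n; exact: measurable_xsection.
  - exact: trivIset_xsection.
  - by apply: bigcup_measurable => n _; exact: measurable_xsection.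
by apply: is_cvg_nneseries => n _ _; exact: integral_ge0.
Qed.

HB.instance Definition _ := isMeasure.Build _ _ _ joint joint0 joint_ge0
  joint_sigma_additive.

Definition joint_measure : {measure set (T * T) -> \bar R} := joint.

Lemma measurable_inner_integral (f : T * T -> \bar R) :
  (forall z, 0 <= f z) -> measurable_fun setT f ->
  measurable_fun setT (fun x => \int[k x]_y f (x, y)).
Proof. exact: measurable_fun_integral_sfinite_kernel. Qed.

Lemma measurable_kernel_integral (f : T -> \bar R) :
  (forall z, 0 <= f z) -> measurable_fun setT f ->
  measurable_fun setT (fun x => \int[k x]_y f y).
Proof.
move=> f0 mf; apply: (@measurable_inner_integral (fun z => f z.2)) => //.
exact: measurableT_comp.
Qed.

Lemma integral_joint (f : T * T -> \bar R) :
  (forall z, 0 <= f z) -> measurable_fun setT f ->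
  \int[joint_measure]_z f z = \int[m]_x \int[k x]_y f (x, y).
Proof.
have mp (g : T * T -> \bar R) x : measurable_fun setT g ->
    measurable_fun setT (fun y => g (x, y)).
  by move=> mg; exact: measurable_fun_pair2.
move: f; apply: ge0_measurable_ind.
- move=> A mA; rewrite integral_indic// setIT.
  by apply: eq_integral => x _; rewrite inner_integral_indic.
- move=> f g f0 g0 mf mg fE gE.
  rewrite (ge0_integralD _ measurableT (fun z _ => f0 z) mf (fun z _ => g0 z) mg) fE gE.
  rewrite -(ge0_integralD _ measurableT).
  + by apply: eq_integral => x _; rewrite ge0_integralD//; exact: mp.
  + by move=> x _; exact: integral_ge0.
  + exact: measurable_inner_integral.
  + by move=> x _; exact: integral_ge0.
  + exact: measurable_inner_integral.
- move=> c f c0 f0 mf fE.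
  rewrite (ge0_integralZl_EFin _ measurableT (fun z _ => f0 z) mf c0) fE.
  rewrite -(ge0_integralZl_EFin _ measurableT _ _ c0).
  + by apply: eq_integral => x _; rewrite ge0_integralZl_EFin//; exact: mp.
  + by move=> x _; exact: integral_ge0.
  + exact: measurable_inner_integral.
- move=> f_ f0 mf ndf fE.
  rewrite monotone_convergence//.
  rewrite (eq_fun fE) -monotone_convergence//.
  + apply: eq_integral => x _; rewrite -monotone_convergence//.
    by move=> n; exact: mp.
  + by move=> n; exact: measurable_inner_integral.
  + by move=> n x _; exact: integral_ge0.
  + move=> x _ a b ab; apply: ge0_le_integral => //.
    * exact: mp.
    * exact: mp.
    * by move=> y _; exact: ndf.
Qed.

Hypothesis k_sym : forall A B : set T, measurable A -> measurable B ->
  \int[m]_(x in A) k x B = \int[m]_(x in B) k x A.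

Lemma joint_sym (f g : T -> \bar R) : (forall x, 0 <= f x) ->
  (forall x, 0 <= g x) -> measurable_fun setT f -> measurable_fun setT g ->
  \int[m]_x (f x * \int[k x]_y g y) = \int[m]_x (g x * \int[k x]_y f y).
Proof.
have I0 (h : T -> \bar R) x : (forall x, 0 <= h x) -> 0 <= \int[k x]_y h y.
  by move=> h0; exact: integral_ge0.
(* [gen] extends the symmetry from indicators to nonnegative functions in one argument. It is
   applied once for each argument; the innermost case is the symmetry on pairs of sets. *)
suff gen (h : T -> \bar R) : (forall x, 0 <= h x) -> measurable_fun setT h ->
    (forall A, measurable A -> \int[m]_x ((\1_A x)%:E * \int[k x]_y h y) =
                           \int[m]_x (h x * \int[k x]_y (\1_A y)%:E)) ->
    forall f : T -> \bar R, (forall x, 0 <= f x) -> measurable_fun setT f ->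
    \int[m]_x (f x * \int[k x]_y h y) = \int[m]_x (h x * \int[k x]_y f y).
  move=> f0 g0 mf mg; apply: (gen g g0 mg _ f f0 mf) => A mA; apply/esym.
  have m1 : measurable_fun setT (fun x => (\1_A x)%:E : \bar R).
    by apply/measurable_EFinP; exact: measurable_indic.
  have i0 x : 0 <= (\1_A x)%:E :> \bar R by rewrite lee_fin.
  apply: (gen (fun x => (\1_A x)%:E) i0 m1 _ g g0 mg) => B mB.
  have e (C D : set T) : measurable C -> measurable D ->
     \int[m]_x ((\1_C x)%:E * \int[k x]_y (\1_D y)%:E) =
     \int[m]_(x in C) k x D.
    move=> mC mD; rewrite [RHS]integral_mkcond; apply: eq_integral => x _.
    rewrite integral_indic// setIT patchE indicE.
    by case: ifPn => xC; rewrite ?mul1e ?mul0e.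
  by rewrite e// e// k_sym.
move=> {}f0 {}mf hA; apply: ge0_measurable_ind.
- exact: hA.
- move=> u v u0 v0 mu mv uE vE.
  under eq_integral do rewrite ge0_muleDl//.
  rewrite (ge0_integralD _ measurableT).
  + rewrite uE vE -(ge0_integralD _ measurableT).
    * apply: eq_integral => x _; rewrite ge0_integralD// [RHS]ge0_muleDr//; exact: I0.
    * by move=> x _; rewrite mule_ge0// I0.
    * by apply: emeasurable_funM => //; exact: measurable_kernel_integral.
    * by move=> x _; rewrite mule_ge0// I0.
    * by apply: emeasurable_funM => //; exact: measurable_kernel_integral.
  + by move=> x _; rewrite mule_ge0// I0.
  + by apply: emeasurable_funM => //; exact: measurable_kernel_integral.
  + by move=> x _; rewrite mule_ge0// I0.
  + by apply: emeasurable_funM => //; exact: measurable_kernel_integral.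
- move=> c u c0 u0 mu uE.
  under eq_integral do rewrite -muleA.
  rewrite (ge0_integralZl_EFin _ measurableT _ _ c0).
  + rewrite uE -(ge0_integralZl_EFin _ measurableT _ _ c0).
    * apply: eq_integral => x _; rewrite ge0_integralZl_EFin//.
      by rewrite muleCA.
    * by move=> x _; rewrite mule_ge0// I0.
    * by apply: emeasurable_funM => //; exact: measurable_kernel_integral.
  + by move=> x _; rewrite mule_ge0// I0.
  + by apply: emeasurable_funM => //; exact: measurable_kernel_integral.
- move=> f_ f_0 mf_ ndf fE.
  have cvf x : cvgn (f_ ^~ x) by exact: ereal_nondecreasing_is_cvgn.
  have l0 x : 0 <= limn (f_ ^~ x) by apply: lime_ge => //; exact: nearW.
  have ndI x : nondecreasing_seq (fun n => \int[k x]_y f_ n y).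
    move=> a b ab; apply: ge0_le_integral => // y _; exact: ndf.
  transitivity (\int[m]_x limn (fun n => f_ n x * \int[k x]_y h y)).
    by apply: eq_integral => x _; rewrite limn_ge0_muler// I0.
  transitivity (\int[m]_x limn (fun n => h x * \int[k x]_y f_ n y)); last first.
    apply: eq_integral => x _; rewrite monotone_convergence//.
    rewrite muleC -limn_ge0_muler//; first by congr (limn _); apply/funext => n; rewrite muleC.
    by move=> n; exact: I0.
  rewrite monotone_convergence//; last 3 first.
  + by move=> n; apply: emeasurable_funM => //; exact: measurable_kernel_integral.
  + by move=> n x _; rewrite mule_ge0// I0.
  + by move=> x _ a b ab; rewrite lee_wpmul2r// ?I0//; exact: ndf.
  rewrite (eq_fun fE) -monotone_convergence//.
  + by move=> n; apply: emeasurable_funM => //; exact: measurable_kernel_integral.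
  + by move=> n x _; rewrite mule_ge0// I0.
  + by move=> x _ a b ab; rewrite lee_wpmul2l//; exact: ndI.
Qed.

End joint_measure.

Lemma normr_le_sqr (R : realDomainType) (x y : R) :
  0 <= y -> x ^+ 2 <= y ^+ 2 -> `|x| <= y.
Proof. by move=> y0; rewrite -real_normK ?num_real// ler_sqr. Qed.

(** * Semi-inner products on sets of functions, and Riesz representation *)

Section nonneg_bilinear_forms.
Context (R : realType) (X : Type).
Implicit Types (f g h u v : X -> R) (D : set (X -> R)).

Lemma discriminant_le (a b c : R) : 0 <= a ->
  (forall s : R, 0 <= a * s ^+ 2 + 2 * b * s + c) -> b ^+ 2 <= a * c.
Proof.
move=> a0 h; have [az|an0] := eqVneq a 0.
  rewrite {a}az in a0 h *; rewrite mul0r; have [->|bn0] := eqVneq b 0; first by rewrite expr0n.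
  (* At this s the affine function takes the value -1. *)
  have := h (- (c + 1) / (2 * b)); rewrite mul0r add0r.
  have -> : 2 * b * (- (c + 1) / (2 * b)) = - (c + 1) by field.
  lra.
have ap : 0 < a by rewrite lt_def an0.
have := h (- b / a).
have -> : a * (- b / a) ^+ 2 + 2 * b * (- b / a) + c = (a * c - b ^+ 2) / a by field.
by rewrite pmulr_lge0 ?invr_gt0// subr_ge0.
Qed.

(** Elements are functions, not classes, and B may be degenerate. The L^2 product, the approximating
    forms, the Dirichlet form and its sums with multiples of the L^2 product are all instances. *)
Record semi_inner D (B : (X -> R) -> (X -> R) -> R) : Prop := SemiInner {
  si_ex : exists f, D f;
  si_dom : forall (c : R) f g, D f -> D g -> D (fun x => c * f x + g x);
  si_sym : forall f g, D f -> D g -> B f g = B g f;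
  si_lin : forall (c : R) f g h, D f -> D g -> D h ->
    B (fun x => c * f x + g x) h = c * B f h + B g h;
  si_ge0 : forall f, D f -> 0 <= B f f }.

Variables (D : set (X -> R)) (B : (X -> R) -> (X -> R) -> R).
Hypothesis BD : semi_inner D B.

Lemma si_domB f g : D f -> D g -> D (fun x => f x - g x).
Proof.
move=> Df Dg; have := si_dom BD (-1) Dg Df.
by congr D; apply/funext => x; rewrite mulN1r addrC.
Qed.

Lemma si_dom0 : D (fun=> 0).
Proof.
have [f Df] := si_ex BD; have := si_domB Df Df.
by congr D; apply/funext => x; rewrite subrr.
Qed.

Lemma si_domZ c f : D f -> D (fun x => c * f x).
Proof.
move=> Df; have := si_dom BD c Df si_dom0.
by congr D; apply/funext => x; rewrite addr0.
Qed.

Lemma si_domD f g : D f -> D g -> D (fun x => f x + g x).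
Proof.
move=> Df Dg; have := si_dom BD 1 Df Dg.
by congr D; apply/funext => x; rewrite mul1r.
Qed.

Lemma si_Bl f g h : D f -> D g -> D h ->
  B (fun x => f x - g x) h = B f h - B g h.
Proof.
move=> Df Dg Dh; have := si_lin BD (-1) Dg Df Dh.
rewrite mulN1r addrC => <-; congr (B _ h).
by apply/funext => x; rewrite mulN1r addrC.
Qed.

Lemma si_Br f g h : D f -> D g -> D h ->
  B h (fun x => f x - g x) = B h f - B h g.
Proof.
move=> Df Dg Dh; rewrite (si_sym BD)//; last exact: si_domB.
by rewrite si_Bl// (si_sym BD (f := f) (g := h))// (si_sym BD (f := g) (g := h)).
Qed.

Lemma si_linr c f g h : D f -> D g -> D h ->
  B h (fun x => c * f x + g x) = c * B h f + B h g.
Proof.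
move=> Df Dg Dh; rewrite (si_sym BD)//; last exact: (si_dom BD).
by rewrite (si_lin BD)// (si_sym BD (f := f) (g := h))// (si_sym BD (f := g) (g := h)).
Qed.

Lemma si_0l h : D h -> B (fun=> 0) h = 0.
Proof.
move=> Dh; transitivity (B (fun x => h x - h x) h); last by rewrite si_Bl// subrr.
by congr (B _ h); apply/funext => x; rewrite subrr.
Qed.

Lemma si_Zl c f h : D f -> D h -> B (fun x => c * f x) h = c * B f h.
Proof.
move=> Df Dh; have := si_lin BD c Df si_dom0 Dh; rewrite si_0l// addr0 => <-.
by congr (B _ h); apply/funext => x; rewrite addr0.
Qed.

Lemma si_sqB f g : D f -> D g ->
  B (fun x => f x - g x) (fun x => f x - g x) = B f f - 2 * B f g + B g g.
Proof.
move=> Df Dg; rewrite si_Bl// ?si_Br//; last exact: si_domB.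
by rewrite (si_sym BD (f := g) (g := f))//; ring.
Qed.

Lemma si_sqlin c f g : D f -> D g ->
  B (fun x => c * f x + g x) (fun x => c * f x + g x) =
  B f f * c ^+ 2 + 2 * B f g * c + B g g.
Proof.
move=> Df Dg; rewrite (si_lin BD)// ?si_linr//; last exact: (si_dom BD).
by rewrite (si_sym BD (f := g) (g := f))//; ring.
Qed.

Lemma si_CS f g : D f -> D g -> B f g ^+ 2 <= B f f * B g g.
Proof.
move=> Df Dg; apply: discriminant_le => [|s]; first exact: (si_ge0 BD).
by rewrite -si_sqlin//; apply: (si_ge0 BD); exact: (si_dom BD).
Qed.

(** The representing element minimizes [B v v - 2 * l v] and is obtained as the limit of a
    minimizing sequence. *)
Lemma riesz_representation (l : (X -> R) -> R) (K : R) :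
  (forall u : nat -> X -> R, (forall n, D (u n)) ->
    (forall e : R, 0 < e -> exists N : nat, forall m n, (N <= m)%N -> (N <= n)%N ->
       B (fun x => u m x - u n x) (fun x => u m x - u n x) < e) ->
    exists2 f, D f & forall e : R, 0 < e -> exists N : nat, forall n, (N <= n)%N ->
       B (fun x => u n x - f x) (fun x => u n x - f x) < e) ->
  (forall c f g, D f -> D g -> l (fun x => c * f x + g x) = c * l f + l g) ->
  0 <= K ->
  (forall f, D f -> l f ^+ 2 <= K * B f f) ->
  exists2 u, D u & forall v, D v -> B u v = l v.
Proof.
move=> complete llin K0 lK.
pose J v := B v v - 2 * l v.
(* From l^2 <= K B one gets -2 l >= -2 sqrt(K B) >= -K - B. *)
have Jlb v : D v -> - K <= J v.
  move=> Dv; have B0 := si_ge0 BD Dv; have lv := lK v Dv; rewrite /J.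
  have : 0 <= (B v v - K) ^+ 2 by exact: sqr_ge0.
  have := sqr_ge0 (l v); nra.
pose m := inf [set J v | v in D].
have hasinf : has_inf [set J v | v in D].
  split; first by have [f Df] := si_ex BD; exists (J f), f.
  by exists (- K) => _ [v Dv <-]; exact: Jlb.
have mJ v : D v -> m <= J v by move=> Dv; apply: ge_inf; [exact: hasinf.2|exists v].
have adh (n : nat) : exists v, D v /\ J v < m + n.+1%:R^-1.
  have [|_ [v Dv <-] vm] := @inf_adherent _ _ n.+1%:R^-1 _ hasinf.
    by rewrite invr_gt0.
  by exists v.
have [v_ /all_and2[Dv_ Jv_]] := choice adh.
have lZ c v : D v -> l (fun x => c * v x) = c * l v.
  move=> Dv; have l0 : l (fun=> 0) = 0.
    apply/eqP; rewrite -sqrf_eq0 eq_le sqr_ge0 andbT.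
    by rewrite (le_trans (lK _ si_dom0))// si_0l ?mulr0//; exact: si_dom0.
  have := llin c _ _ Dv si_dom0; rewrite l0 addr0 => <-.
  by congr l; apply/funext => x; rewrite addr0.
have lD u v : D u -> D v -> l (fun x => u x + v x) = l u + l v.
  move=> Du Dv; have := llin 1 _ _ Du Dv; rewrite mul1r => <-.
  by congr l; apply/funext => x; rewrite mul1r.
have BDD u v : D u -> D v -> B (fun x => u x + v x) (fun x => u x + v x) =
    B u u + 2 * B u v + B v v.
  move=> Du Dv; have := si_sqlin 1 Du Dv; rewrite expr1n !mulr1 => <-.
  by congr (B _ _); apply/funext => x; rewrite mul1r.
(* Parallelogram law: the left side equals 2 J u + 2 J v - 4 J((u + v) / 2), and J >= m at the
   midpoint. *)
have par u v : D u -> D v -> B (fun x => u x - v x) (fun x => u x - v x) <=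
    2 * (J u - m) + 2 * (J v - m).
  move=> Du Dv; have Dw := si_domD Du Dv; have Dm := si_domZ 2^-1 Dw.
  have := mJ _ Dm; rewrite /J lZ// lD// (si_Zl _ Dw)// (si_sym BD)//.
  rewrite (si_Zl _ Dw)// BDD// si_sqB//; lra.
have small (e : R) : 0 < e -> exists N : nat, forall n, (N <= n)%N -> n.+1%:R^-1 < e.
  move=> e0; have [N _ HN] := near_infty_natSinv_lt (PosNum e0).
  by exists N => n /HN.
have [||u Du uv] := complete v_ => //.
  move=> e e0; have [N HN] := small (e / 4) (divr_gt0 e0 (ltr0n _ 4)).
  exists N => p q /HN hp /HN hq; apply: le_lt_trans (par _ _ (Dv_ p) (Dv_ q)) _.
  have Jlt k : k.+1%:R^-1 < e / 4 -> J (v_ k) < m + e / 4.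
    by move=> ?; rewrite (lt_trans (Jv_ k))// ltrD2l.
  by move: (Jlt _ hp) (Jlt _ hq); move: (J _) (J _) => x y; lra.
exists u => // v Dv.
(* J(v_n + s v) >= m and J(v_n) < m + 1/(n+1) make B v v s^2 + 2 (B v_n v - l v) s + 1/(n+1)
   nonnegative for all s. *)
have first_order n : (B (v_ n) v - l v) ^+ 2 <= B v v * n.+1%:R^-1.
  apply: discriminant_le => [|s]; first exact: (si_ge0 BD).
  have := mJ _ (si_dom BD s Dv (Dv_ n)); rewrite /J si_sqlin// llin//.
  have := Jv_ n; rewrite {1}/J (si_sym BD (f := v) (g := v_ n))//.
  move: n.+1%:R^-1 (B _ _) (B _ _) (B _ _) (l _) (l _) => *; lra.
have close e : 0 < e -> `|B u v - l v| <= e.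
  move=> e0; have B0 := si_ge0 BD Dv.
  (* The 1 added to [B v v] covers the degenerate case [B v v = 0]. *)
  have d0 : 0 < e ^+ 2 / (4 * (B v v + 1)).
    by rewrite divr_gt0 ?exprn_gt0// mulr_gt0// ltr_wpDl.
  have [N1 HN1] := small _ d0; have [N2 HN2] := uv _ d0.
  set n := maxn N1 N2; have h1 := HN1 n (leq_maxl _ _).
  have h2 := HN2 n (leq_maxr _ _).
  have CS := si_CS (si_domB (Dv_ n) Du) Dv; rewrite si_Bl// in CS.
  have dE : B v v * (e ^+ 2 / (4 * (B v v + 1))) <= (e / 2) ^+ 2.
    rewrite mulrA ler_pdivrMr ?mulr_gt0 ?ltr_wpDl//.
    have := sqr_ge0 e; nra.
  have a1 : `|B (v_ n) v - l v| <= e / 2.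
    apply: normr_le_sqr; first by rewrite divr_ge0 ?ltW.
    by rewrite (le_trans (first_order n))// (le_trans _ dE)// ler_wpM2l// ltW.
  have a2 : `|B (v_ n) v - B u v| <= e / 2.
    apply: normr_le_sqr; first by rewrite divr_ge0 ?ltW.
    by rewrite (le_trans CS)// (le_trans _ dE)// mulrC ler_wpM2l// ltW.
  move: a1 a2; rewrite !ler_norml; lra.
apply/eqP; rewrite -subr_eq0 -normr_le0; apply/ler_addgt0Pl => e e0.
by rewrite addr0 close.
Qed.

End nonneg_bilinear_forms.

(** * Square integrable functions on X *)

Section square_integrable_functions.
Context (R : realType) (X : pmetricType R).
Variable mu : {measure set borel X -> \bar R}.
Implicit Types f g h : X -> R.

Definition L2 : set (X -> R) := [set f | f \in Lfun mu 2%:E].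

Lemma L2_measurable f : L2 f -> measurable_fun [set: borel X] f.
Proof. move=> f2; have [mf _] := andP f2; exact: (set_mem mf). Qed.

Lemma L2_integrable f g : L2 f -> L2 g ->
  mu.-integrable setT (fun x => (f x * g x)%:E).
Proof. by move=> f2 g2; apply/Lfun1_integrable; exact: Lfun2_mul_Lfun1. Qed.

Lemma L2P f : measurable_fun [set: borel X] f ->
  (\int[mu]_x (f x ^+ 2)%:E < +oo)%E -> L2 f.
Proof.
move=> mf int; apply/andP; split; first exact: (mem_set mf).
apply: mem_set; rewrite /=.
rewrite /finite_norm unlock/=; apply: poweR_lty.
apply: le_lt_trans int; apply: ge0_le_integral => //.
- apply/measurable_EFinP; apply: (measurableT_comp (measurable_powR _)) => //.
  exact: measurableT_comp.
- by apply/measurable_EFinP; exact: measurable_funX.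
- by move=> x _; rewrite lee_fin powR_mulrn// real_normK ?num_real.
Qed.

Lemma L2_sqr f : L2 f -> (\int[mu]_x (f x ^+ 2)%:E < +oo)%E.
Proof.
by move=> /Lfun2_integrable_sqr /integral_fune_lt_pinfty; exact.
Qed.

Lemma L2_dominated (c : R) f g : measurable_fun [set: borel X] f -> L2 g ->
  (forall x, `|f x| <= c * `|g x|) -> L2 f.
Proof.
move=> mf g2 fg; apply: L2P => //.
have mg := L2_measurable g2.
apply: (@le_lt_trans _ _ (\int[mu]_x ((c ^+ 2)%:E * (g x ^+ 2)%:E))%E).
  apply: ge0_le_integral => //.
  - by move=> x _; rewrite lee_fin sqr_ge0.
  - by apply/measurable_EFinP; exact: measurable_funX.
  - by apply: emeasurable_funM => //; apply/measurable_EFinP; exact: measurable_funX.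
  move=> x _; rewrite -EFinM lee_fin -exprMn -[leLHS]real_normK ?num_real//.
  rewrite -[leRHS]real_normK ?num_real// ler_sqr ?nnegrE// normrM.
  by rewrite (le_trans (fg x))// ler_wpM2r// ler_norm.
rewrite ge0_integralZl_EFin ?sqr_ge0//.
- by rewrite lte_mul_pinfty ?lee_fin ?sqr_ge0//; exact: L2_sqr.
- by move=> x _; rewrite lee_fin sqr_ge0.
- by apply/measurable_EFinP; exact: measurable_funX.
Qed.

Lemma L2_lin c f g : L2 f -> L2 g -> L2 (fun x => c * f x + g x).
Proof.
by move=> f2 g2; have [_ h] := Lfun_submod_closed mu (lee1n 2); exact: (h c _ _ f2 g2).
Qed.

Lemma dotL2C f g : dotL2 mu f g = dotL2 mu g f.
Proof. by apply: eq_Rintegral => x _; rewrite mulrC. Qed.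

Lemma dotL2_lin c f g h : L2 f -> L2 g -> L2 h ->
  dotL2 mu (fun x => c * f x + g x) h = c * dotL2 mu f h + dotL2 mu g h.
Proof.
move=> f2 g2 h2; rewrite /dotL2 -RintegralZl//; last exact: L2_integrable.
rewrite -RintegralD//.
- by apply: eq_Rintegral => x _; rewrite mulrDl mulrA.
- by have := integrableZl measurableT c (L2_integrable f2 h2); apply: eq_integrable.
- exact: L2_integrable.
Qed.

Lemma dotL2_ge0 f : 0 <= dotL2 mu f f.
Proof. by apply: Rintegral_ge0 => x _; rewrite -expr2 sqr_ge0. Qed.

Lemma L2_semi_inner : semi_inner L2 (dotL2 mu).
Proof.
split.
- by exists (fun=> 0); apply: L2P => //; rewrite integral0_eq ?ltry// => x _; rewrite expr0n.
- exact: L2_lin.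
- by move=> *; exact: dotL2C.
- exact: dotL2_lin.
- by move=> *; exact: dotL2_ge0.
Qed.

Lemma sqnormL2_eq0 f : L2 f -> sqnormL2 mu f = 0 -> {ae mu, forall x, f x = 0}.
Proof.
move=> f2 f0; have mf := L2_measurable f2.
have : ae_eq mu setT (fun x => (f x ^+ 2)%:E) (cst 0%E).
  apply/(ae_eq_integral_abs mu measurableT) => /=.
    by apply/measurable_EFinP; exact: measurable_funX.
  under eq_integral do rewrite ger0_norm ?sqr_ge0//.
  move: f0; rewrite /sqnormL2 /dotL2 /Rintegral.
  under eq_integral do rewrite -expr2.
  have : (0 <= \int[mu]_x (f x ^+ 2)%:E)%E by apply: integral_ge0 => x _; rewrite lee_fin sqr_ge0.
  by have := L2_sqr f2; case: (\int[mu]_x _)%E => //= r _ _ ->.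
apply: filterS => x /(_ I) [] /eqP; rewrite sqrf_eq0 => /eqP ->//.
Qed.

End square_integrable_functions.

(** * Marginals and symmetry of the joint measure *)

Section integrable_joint.
Context d (T : measurableType d) (R : realType).
Variables (m : {measure set T -> \bar R}) (k : R.-spker T ~> T).
Local Open Scope ereal_scope.

Lemma integral_joint_integrable (h : T * T -> R) :
  (joint_measure m k).-integrable setT (EFin \o h) ->
  \int[joint_measure m k]_z (h z)%:E = \int[m]_x \int[k x]_y (h (x, y))%:E.
Proof.
move=> ih; have mh := measurable_int _ ih.
have mp : measurable_fun setT (EFin \o h)^\+ by exact: measurable_funepos.
have mn : measurable_fun setT (EFin \o h)^\- by exact: measurable_funeneg.
have ip := integrable_funepos measurableT ih.
have in_ := integrable_funeneg measurableT ih.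
rewrite [LHS]integralE !integral_joint// -integralB//.
- apply: eq_integral => x _; rewrite [RHS]integralE.
  by congr (_ - _); apply: eq_integral => y _; rewrite ?funeposE ?funenegE.
- apply/integrableP; split; first exact: measurable_inner_integral.
  under eq_integral do rewrite gee0_abs ?integral_ge0//.
  rewrite -integral_joint//.
  by apply: integral_fune_lt_pinfty.
- apply/integrableP; split; first exact: measurable_inner_integral.
  under eq_integral do rewrite gee0_abs ?integral_ge0//.
  rewrite -integral_joint//.
  by apply: integral_fune_lt_pinfty.
Qed.

Hypothesis k_sym : forall A B : set T, measurable A -> measurable B ->
  \int[m]_(x in A) k x B = \int[m]_(x in B) k x A.

Lemma integral_joint_tensor (f g : T -> \bar R) : (forall x, 0 <= f x) ->
  (forall x, 0 <= g x) -> measurable_fun setT f -> measurable_fun setT g ->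
  \int[joint_measure m k]_z (f z.1 * g z.2) = \int[m]_x (f x * \int[k x]_y g y).
Proof.
move=> f0 g0 mf mg; rewrite integral_joint//.
- apply: eq_integral => x _ /=.
  rewrite ge0_integralZl//.
- by move=> z; exact: mule_ge0.
- by apply: emeasurable_funM; exact: measurableT_comp.
Qed.

Lemma ge0_integral_joint_swap (f g : T -> \bar R) : (forall x, 0 <= f x) ->
  (forall x, 0 <= g x) -> measurable_fun setT f -> measurable_fun setT g ->
  \int[joint_measure m k]_z (f z.1 * g z.2) =
  \int[joint_measure m k]_z (f z.2 * g z.1).
Proof.
move=> f0 g0 mf mg; rewrite integral_joint_tensor// joint_sym//.
by under [RHS]eq_integral do rewrite muleC; rewrite integral_joint_tensor.
Qed.

Lemma integral_joint_fst (g : T -> \bar R) : (forall x, 0 <= g x) ->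
  measurable_fun setT g ->
  \int[joint_measure m k]_z g z.1 = \int[m]_x (g x * k x setT).
Proof.
move=> g0 mg; transitivity (\int[joint_measure m k]_z (g z.1 * cst 1 z.2)).
  by apply: eq_integral => z _; rewrite /= mule1.
rewrite integral_joint_tensor//.
by apply: eq_integral => x _; rewrite integral_cst// mul1e.
Qed.

Lemma integral_joint_snd (g : T -> \bar R) : (forall x, 0 <= g x) ->
  measurable_fun setT g ->
  \int[joint_measure m k]_z g z.2 = \int[m]_x (g x * k x setT).
Proof.
move=> g0 mg; rewrite -integral_joint_fst//.
transitivity (\int[joint_measure m k]_z (g z.2 * cst 1 z.1)).
  by apply: eq_integral => z _; rewrite /= mule1.
rewrite -ge0_integral_joint_swap//.
by apply: eq_integral => x _; rewrite /= mule1.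
Qed.

Lemma integral_joint_fst_le (g : T -> \bar R) : (forall x, 0 <= g x) ->
  measurable_fun setT g ->
  \int[joint_measure m k]_z g z.1 <= \int[m]_x g x.
Proof.
move=> g0 mg; rewrite integral_joint_fst//; apply: ge0_le_integral => //.
- by move=> x _; rewrite mule_ge0.
- by apply: emeasurable_funM => //; exact: measurable_kernel.
- by move=> x _; rewrite -[leRHS]mule1 lee_wpmul2l// sprob_kernel_le1.
Qed.

Lemma integral_joint_snd_le (g : T -> \bar R) : (forall x, 0 <= g x) ->
  measurable_fun setT g ->
  \int[joint_measure m k]_z g z.2 <= \int[m]_x g x.
Proof.
move=> g0 mg; rewrite integral_joint_snd// -integral_joint_fst//.
exact: integral_joint_fst_le.
Qed.

End integrable_joint.

Section joint_swap.
Context d (T : measurableType d) (R : realType).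
Variables (m : {measure set T -> \bar R}) (k : R.-spker T ~> T).
Hypothesis k_sym : forall A B : set T, measurable A -> measurable B ->
  (\int[m]_(x in A) k x B = \int[m]_(x in B) k x A)%E.
Local Notation jm := (joint_measure m k).

Lemma measurable_fst_comp (f : T -> R) : measurable_fun setT f ->
  measurable_fun setT (fun z : T * T => f z.1).
Proof. by move=> mf; exact: measurableT_comp. Qed.

Lemma measurable_snd_comp (f : T -> R) : measurable_fun setT f ->
  measurable_fun setT (fun z : T * T => f z.2).
Proof. by move=> mf; exact: measurableT_comp. Qed.

Lemma integrable_joint_swap (f g : T -> R) : measurable_fun setT f ->
  measurable_fun setT g ->
  jm.-integrable setT (fun z => (f z.2 * g z.1)%:E) ->
  jm.-integrable setT (fun z => (f z.1 * g z.2)%:E).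
Proof.
move=> mf mg /integrableP[_ ih]; apply/integrableP; split.
  by apply/measurable_EFinP/measurable_funM; [exact: measurable_fst_comp|
    exact: measurable_snd_comp].
suff -> : (\int[jm]_z `|(f z.1 * g z.2)%:E| = \int[jm]_z `|(f z.2 * g z.1)%:E|)%E by [].
transitivity (\int[jm]_z (`|f z.1|%:E * `|g z.2|%:E))%E.
  by apply: eq_integral => z _; rewrite /= -EFinM normrM.
rewrite (ge0_integral_joint_swap _ (f := fun x => `|f x|%:E)
  (g := fun x => `|g x|%:E))//.
- by apply: eq_integral => z _; rewrite /= -EFinM normrM.
- by apply/measurable_EFinP; exact: measurableT_comp.
- by apply/measurable_EFinP; exact: measurableT_comp.
Qed.

(** The symmetry is known for nonnegative factors. Splitting f and g into positive and negative
    parts leaves four products, each dominated by |f(y) g(x)|. *)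
Lemma Rintegral_joint_swap (f g : T -> R) : measurable_fun setT f ->
  measurable_fun setT g ->
  jm.-integrable setT (fun z => (f z.2 * g z.1)%:E) ->
  \int[jm]_z (f z.2 * g z.1) = \int[jm]_z (f z.1 * g z.2).
Proof.
move=> mf mg ih.
pose p (h : T -> R) x := Num.max (h x) 0.
pose n (h : T -> R) x := Num.max (- h x) 0.
have mp h : measurable_fun setT h -> measurable_fun setT (p h).
  by move=> mh; exact: measurable_maxr.
have mn h : measurable_fun setT h -> measurable_fun setT (n h).
  by move=> mh; apply: measurable_maxr => //; exact: measurableT_comp.
have p0 h x : 0 <= p h x by rewrite le_max lexx orbT.
have n0 h x : 0 <= n h x by rewrite le_max lexx orbT.
have hE h x : h x = p h x - n h x.
  by rewrite /p /n; case: (leP (h x) 0); case: (leP (- h x) 0); lra.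
have ple h x : `|p h x| <= `|h x|.
  by rewrite ger0_norm// ge_max normr_ge0 ler_norm.
have nle h x : `|n h x| <= `|h x|.
  by rewrite ger0_norm// ge_max normr_ge0 -normrN ler_norm.
have dom (u v : T -> R) : measurable_fun setT u -> measurable_fun setT v ->
    (forall x, `|u x| <= `|f x|) -> (forall x, `|v x| <= `|g x|) ->
    jm.-integrable setT (fun z => (u z.2 * v z.1)%:E).
  move=> mu mv uf vg; apply: le_integrable ih => //.
    by apply/measurable_EFinP/measurable_funM; [exact: measurable_snd_comp|
      exact: measurable_fst_comp].
  by move=> z _; rewrite lee_fin !normrM ler_pM.
have swap (u v : T -> R) : measurable_fun setT u -> measurable_fun setT v ->
    (forall x, 0 <= u x) -> (forall x, 0 <= v x) ->
    \int[jm]_z (u z.2 * v z.1) = \int[jm]_z (u z.1 * v z.2).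
  move=> mu mv u0 v0; congr fine.
  have := @ge0_integral_joint_swap _ _ _ m k k_sym (EFin \o u) (EFin \o v).
  move=> /(_ _ _ _ _)/esym; apply.
  - by move=> x; rewrite lee_fin.
  - by move=> x; rewrite lee_fin.
  - exact/measurable_EFinP.
  - exact/measurable_EFinP.
have lin (u1 u2 u3 u4 : T * T -> R) :
    jm.-integrable setT (EFin \o u1) -> jm.-integrable setT (EFin \o u2) ->
    jm.-integrable setT (EFin \o u3) -> jm.-integrable setT (EFin \o u4) ->
    \int[jm]_z ((u1 z - u2 z) - (u3 z - u4 z)) =
    (\int[jm]_z u1 z - \int[jm]_z u2 z) - (\int[jm]_z u3 z - \int[jm]_z u4 z).
  move=> i1 i2 i3 i4; rewrite RintegralB//; last 2 first.
  - by have := integrableB measurableT i1 i2; apply: eq_integrable.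
  - by have := integrableB measurableT i3 i4; apply: eq_integrable.
  by rewrite !RintegralB.
transitivity (\int[jm]_z ((p f z.2 * p g z.1 - p f z.2 * n g z.1) -
  (n f z.2 * p g z.1 - n f z.2 * n g z.1))).
  by apply: eq_Rintegral => z _; rewrite (hE f) (hE g); ring.
transitivity (\int[jm]_z ((p f z.1 * p g z.2 - p f z.1 * n g z.2) -
  (n f z.1 * p g z.2 - n f z.1 * n g z.2))); last first.
  by apply: eq_Rintegral => z _; rewrite (hE f) (hE g); ring.
have mpf := mp _ mf; have mnf := mn _ mf; have mpg := mp _ mg; have mng := mn _ mg.
have i1 := dom _ _ mpf mpg (ple f) (ple g).
have i2 := dom _ _ mpf mng (ple f) (nle g).
have i3 := dom _ _ mnf mpg (nle f) (ple g).
have i4 := dom _ _ mnf mng (nle f) (nle g).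
rewrite (lin (fun z => p f z.2 * p g z.1) (fun z => p f z.2 * n g z.1)
  (fun z => n f z.2 * p g z.1) (fun z => n f z.2 * n g z.1))//.
rewrite (lin (fun z => p f z.1 * p g z.2) (fun z => p f z.1 * n g z.2)
  (fun z => n f z.1 * p g z.2) (fun z => n f z.1 * n g z.2))//.
- by rewrite !swap.
- exact: integrable_joint_swap.
- exact: integrable_joint_swap.
- exact: integrable_joint_swap.
- exact: integrable_joint_swap.
Qed.

End joint_swap.

(** * Jensen's inequality for subprobability measures *)

Section subprobability_square.
Context d (T : measurableType d) (R : realType).
Variables (m : {measure set T -> \bar R}) (f : T -> R).
Hypotheses (m1 : (m setT <= 1)%E) (mf : measurable_fun setT f).

Let fin1 : m setT \is a fin_num.
Proof. by rewrite ge0_fin_numE// (le_lt_trans m1)// ltry. Qed.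

Let mf2 : measurable_fun setT (fun x => (f x ^+ 2)%:E).
Proof. by apply/measurable_EFinP; exact: measurable_funX. Qed.

Let int_sqr : (\int[m]_x (f x ^+ 2)%:E < +oo)%E ->
  m.-integrable setT (fun x => (f x ^+ 2)%:E).
Proof.
move=> Iy; apply/integrableP; split => //.
by under eq_integral do rewrite gee0_abs ?lee_fin ?sqr_ge0//.
Qed.

Let int_cst (c : R) : m.-integrable setT (cst c%:E).
Proof.
apply/integrableP; split => //; rewrite integral_cst//.
by rewrite lte_mul_pinfty// ltey_eq fin1.
Qed.

Lemma integrable_of_sqr : (\int[m]_x (f x ^+ 2)%:E < +oo)%E ->
  m.-integrable setT (EFin \o f).
Proof.
move=> Iy; apply: (@le_integrable _ _ _ _ _ measurableT _ (fun x => (1 + f x ^+ 2)%:E)).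
- exact/measurable_EFinP.
- move=> x _; rewrite lee_fin [leRHS]ger0_norm ?addr_ge0 ?sqr_ge0//.
  rewrite -[X in _ + X]real_normK ?num_real//.
  by have := sqr_ge0 (1 - `|f x|); have := normr_ge0 (f x); nra.
- by have := integrableD measurableT (int_cst 1) (int_sqr Iy); apply: eq_integrable.
Qed.

(** Discriminant of the nonnegative polynomial in s given by the integral of (s f + 1)^2; its
    constant term, the total mass, is at most 1. If the integral of f^2 is infinite the bound is
    trivial. *)
Lemma Rintegral_sqr_le :
  (((\int[m]_x f x) ^+ 2)%:E <= \int[m]_x (f x ^+ 2)%:E)%E.
Proof.
have [Iy|/eqP Iy] := eqVneq (\int[m]_x (f x ^+ 2)%:E)%E +oo%E; first by rewrite Iy leey.
have {}Iy : (\int[m]_x (f x ^+ 2)%:E < +oo)%E by rewrite ltey; apply/eqP.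
have i2 := int_sqr Iy; have i1 := integrable_of_sqr Iy.
have M0 : 0 <= fine (m setT) <= 1.
  by rewrite fine_ge0//= -lee_fin fineK.
have h (s : R) : 0 <= \int[m]_x (f x ^+ 2) * s ^+ 2 +
    2 * (\int[m]_x f x) * s + fine (m setT).
  suff <- : \int[m]_x ((f x * s + 1) ^+ 2) = \int[m]_x (f x ^+ 2) * s ^+ 2 +
      2 * (\int[m]_x f x) * s + fine (m setT).
    by apply: Rintegral_ge0 => x _; exact: sqr_ge0.
  transitivity (\int[m]_x ((s ^+ 2 * f x ^+ 2 + 2 * s * f x) + 1)).
    by apply: eq_Rintegral => x _; ring.
  have j2 : m.-integrable setT (EFin \o (fun x => s ^+ 2 * f x ^+ 2)).
    by have := integrableZl measurableT (s ^+ 2) i2; apply: eq_integrable.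
  have j1 : m.-integrable setT (EFin \o (fun x => 2 * s * f x)).
    by have := integrableZl measurableT (2 * s) i1; apply: eq_integrable.
  rewrite RintegralD//; last 2 first.
  - by have := integrableD measurableT j2 j1; apply: eq_integrable.
  - exact: (int_cst 1).
  by rewrite RintegralD// !RintegralZl// Rintegral_cst// mul1r; ring.
have I0 : 0 <= \int[m]_x (f x ^+ 2) by apply: Rintegral_ge0 => x _; exact: sqr_ge0.
have := discriminant_le I0 h.
have -> : (\int[m]_x (f x ^+ 2)%:E = (\int[m]_x (f x ^+ 2))%:E)%E.
  by rewrite fineK//; exact: integrable_fin_num.
rewrite lee_fin => /le_trans; apply.
by have /andP[? ?] := M0; rewrite ler_piMr.
Qed.

End subprobability_square.

Lemma measurable_inner_integral_real d (T : measurableType d) (R : realType)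
    (k : R.-spker T ~> T) (h : T * T -> R) : measurable_fun setT h ->
  measurable_fun setT (fun x => \int[k x]_y (h (x, y))%:E)%E.
Proof.
move=> mh; have mh' : measurable_fun setT (EFin \o h) by exact/measurable_EFinP.
rewrite (_ : (fun x => _) = fun x => (\int[k x]_y (EFin \o h)^\+ (x, y) -
    \int[k x]_y (EFin \o h)^\- (x, y))%E); last first.
  by apply/funext => x; rewrite integralE; congr (_ - _)%E;
    apply: eq_integral => y _; rewrite ?funeposE ?funenegE.
apply: emeasurable_funB.
- by apply: measurable_inner_integral => //; exact: measurable_funepos.
- by apply: measurable_inner_integral => //; exact: measurable_funeneg.
Qed.

(** * The kernel as an operator on L^2 *)

Section markov_operator.
Context (R : realType) (X : pmetricType R).
Variables (mu : {measure set borel X -> \bar R}).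
Variable k : R.-spker borel X ~> borel X.
Hypothesis k_sym : forall A B : set (borel X), measurable A -> measurable B ->
  (\int[mu]_(x in A) k x B = \int[mu]_(x in B) k x A)%E.
Local Notation jm := (joint_measure mu k).
Implicit Types f g h : X -> R.

Definition kernel_op f : X -> R := fun x => \int[k x]_y f y.

Lemma L2_joint_fst f : L2 mu f ->
  jm.-integrable setT (fun z => (f z.1 ^+ 2)%:E).
Proof.
move=> f2; have mf := L2_measurable f2.
have m2 : measurable_fun [set: borel X] (fun x => (f x ^+ 2)%:E).
  by apply/measurable_EFinP; exact: measurable_funX.
apply/integrableP; split; first exact: (measurableT_comp m2).
under eq_integral do rewrite gee0_abs ?lee_fin ?sqr_ge0//.
apply: le_lt_trans (L2_sqr f2).
by apply: (@integral_joint_fst_le _ _ _ mu k (fun x => (f x ^+ 2)%:E)) => // x; rewrite lee_fin sqr_ge0.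
Qed.

Lemma L2_joint_snd f : L2 mu f ->
  jm.-integrable setT (fun z => (f z.2 ^+ 2)%:E).
Proof.
move=> f2; have mf := L2_measurable f2.
have m2 : measurable_fun [set: borel X] (fun x => (f x ^+ 2)%:E).
  by apply/measurable_EFinP; exact: measurable_funX.
apply/integrableP; split; first exact: (measurableT_comp m2).
under eq_integral do rewrite gee0_abs ?lee_fin ?sqr_ge0//.
apply: le_lt_trans (L2_sqr f2).
by apply: (@integral_joint_snd_le _ _ _ mu k k_sym (fun x => (f x ^+ 2)%:E)) => // x; rewrite lee_fin sqr_ge0.
Qed.

Lemma L2_joint_integrable f g : L2 mu f -> L2 mu g ->
  jm.-integrable setT (fun z => (f z.2 * g z.1)%:E).
Proof.
move=> f2 g2; have mf := L2_measurable f2; have mg := L2_measurable g2.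
apply: (@le_integrable _ _ _ _ _ measurableT _ (fun z : borel X * borel X => (f z.2 ^+ 2 + g z.1 ^+ 2)%:E)).
- by apply/measurable_EFinP/measurable_funM; [exact: (measurable_snd_comp mf)|
    exact: (measurable_fst_comp mg)].
- move=> z _; rewrite lee_fin [leRHS]ger0_norm ?addr_ge0 ?sqr_ge0//.
  rewrite normrM -[f _ ^+ 2]real_normK ?num_real// -[g _ ^+ 2]real_normK ?num_real//.
  by have := sqr_ge0 (`|f z.2| - `|g z.1|); have := normr_ge0 (f z.2);
    have := normr_ge0 (g z.1); nra.
- by have := integrableD measurableT (L2_joint_snd f2) (L2_joint_fst g2); apply: eq_integrable.
Qed.

Lemma kernel_op_measurable f : measurable_fun [set: borel X] f ->
  measurable_fun [set: borel X] (kernel_op f).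
Proof.
move=> mf; apply: (measurableT_comp (fine_measurable measurableT)).
by apply: (@measurable_inner_integral_real _ (borel X) R k (fun z => f z.2)); exact: (measurable_snd_comp mf).
Qed.

Lemma kernel_op_L2 f : L2 mu f -> L2 mu (kernel_op f).
Proof.
move=> f2; have mf := L2_measurable f2.
have m2 : measurable_fun [set: borel X] (fun x => (f x ^+ 2)%:E).
  by apply/measurable_EFinP; exact: measurable_funX.
apply: L2P; first exact: kernel_op_measurable.
apply: (@le_lt_trans _ _ (\int[mu]_x \int[k x]_y (f y ^+ 2)%:E)%E).
  apply: ge0_le_integral => //.
  - by move=> x _; rewrite lee_fin sqr_ge0.
  - by apply/measurable_EFinP/measurable_funX; exact: kernel_op_measurable.
  - by apply: measurable_kernel_integral => // x; rewrite lee_fin sqr_ge0.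
  - by move=> x _; apply: Rintegral_sqr_le => //; exact: sprob_kernel_le1.
have := integral_fune_lt_pinfty measurableT (L2_joint_snd f2); rewrite integral_joint//.
- by move=> z; rewrite lee_fin sqr_ge0.
- exact: (measurableT_comp m2).
Qed.

(** Where f is not integrable against k x, the real valued integral in [kernel_op] carries no
    information. Such x form a null set, which is what allows pairings with [kernel_op f] to be
    computed as integrals over the product. *)
Lemma kernel_ae_integrable f : L2 mu f ->
  {ae mu, forall x, (k x).-integrable setT (EFin \o f)}.
Proof.
move=> f2; have mf := L2_measurable f2.
have m2 : measurable_fun [set: borel X] (fun x => (f x ^+ 2)%:E).
  by apply/measurable_EFinP; exact: measurable_funX.
have sq0 x : (0 <= (f x ^+ 2)%:E)%E by rewrite lee_fin sqr_ge0.
have := integral_fune_lt_pinfty measurableT (L2_joint_snd f2).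
rewrite integral_joint//; last exact: (measurableT_comp m2).
move=> /= ifin.
have : mu.-integrable setT (fun x => \int[k x]_y (f y ^+ 2)%:E)%E.
  apply/integrableP; split; first exact: measurable_kernel_integral.
  apply: le_lt_trans ifin; apply: ge0_le_integral => //.
  + by apply: measurableT_comp => //; exact: measurable_kernel_integral.
  + exact: measurable_kernel_integral.
  by move=> x _; rewrite gee0_abs//; exact: integral_ge0.
move=> /(integrable_ae measurableT); apply: filterS => x /(_ I) xf.
by apply: integrable_of_sqr => //; [exact: sprob_kernel_le1|rewrite ltey_eq xf].
Qed.

Lemma dotL2_kernel_op f g : L2 mu f -> L2 mu g ->
  dotL2 mu (kernel_op f) g = \int[jm]_z (f z.2 * g z.1).
Proof.
move=> f2 g2; have mf := L2_measurable f2; have mg := L2_measurable g2.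
congr fine; rewrite (integral_joint_integrable (L2_joint_integrable f2 g2))/=.
apply: ae_eq_integral => //.
- by apply/measurable_EFinP/measurable_funM => //; exact: kernel_op_measurable.
- apply: (@measurable_inner_integral_real _ (borel X) R k (fun z => f z.2 * g z.1)).
  by apply: measurable_funM; [exact: (measurable_snd_comp mf)|exact: (measurable_fst_comp mg)].
apply: filterS (kernel_ae_integrable f2) => x fi _ /=.
rewrite EFinM /kernel_op /Rintegral fineK; last exact: integrable_fin_num.
by rewrite -integralZr//; apply: eq_integral => y _; rewrite EFinM.
Qed.

End markov_operator.

(** * The approximating forms (1/t) (f - P_t f, g) *)

Section approximating_forms.
Context (R : realType) (X : pmetricType R).
Variables (mu : {measure set borel X -> \bar R}).
Variable P : R -> R.-spker borel X ~> borel X.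
Hypothesis P_semigroup : symmetric_markov_semigroup mu P.
Hypothesis P_conservative : conservative mu P.
Implicit Types f g h : X -> R.
Local Notation jm t := (joint_measure mu (P t)).
Local Notation op t := (semigroup_op P t).

(** Reduces identities between symmetric bilinear forms to nonnegative functions, where integrals
    may be exchanged freely. *)
Lemma L2_bilinear_eq (b1 b2 : (X -> R) -> (X -> R) -> R) :
  (forall f g, L2 mu f -> L2 mu g -> b1 f g = b1 g f) ->
  (forall f g, L2 mu f -> L2 mu g -> b2 f g = b2 g f) ->
  (forall f g h, L2 mu f -> L2 mu g -> L2 mu h ->
    b1 (fun x => f x - g x) h = b1 f h - b1 g h) ->
  (forall f g h, L2 mu f -> L2 mu g -> L2 mu h ->
    b2 (fun x => f x - g x) h = b2 f h - b2 g h) ->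
  (forall f g, L2 mu f -> L2 mu g -> (forall x, 0 <= f x) ->
    (forall x, 0 <= g x) -> b1 f g = b2 f g) ->
  forall f g, L2 mu f -> L2 mu g -> b1 f g = b2 f g.
Proof.
move=> s1 s2 l1 l2 b12.
pose p (h : X -> R) x := Num.max (h x) 0.
pose n (h : X -> R) x := Num.max (- h x) 0.
have p0 h x : 0 <= p h x by rewrite le_max lexx orbT.
have n0 h x : 0 <= n h x by rewrite le_max lexx orbT.
have hE h : h = fun x => p h x - n h x.
  by apply/funext => x; rewrite /p /n; case: (leP (h x) 0); case: (leP (- h x) 0); lra.
have p2 h : L2 mu h -> L2 mu (p h).
  move=> h2; apply: (L2_dominated (c := 1) _ h2) => [|x].
    by apply: measurable_maxr => //; exact: (L2_measurable h2).
  by rewrite mul1r ger0_norm// ge_max normr_ge0 ler_norm.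
have n2 h : L2 mu h -> L2 mu (n h).
  move=> h2; apply: (L2_dominated (c := 1) _ h2) => [|x].
    by apply: measurable_maxr => //; apply: measurableT_comp => //; exact: (L2_measurable h2).
  by rewrite mul1r ger0_norm// ge_max normr_ge0 -normrN ler_norm.
have half f g : L2 mu f -> L2 mu g -> (forall x, 0 <= g x) -> b1 f g = b2 f g.
  move=> f2 g2 g0; have pf := p2 _ f2; have nf := n2 _ f2.
  by rewrite (hE f) l1// l2// (b12 (p f))// (b12 (n f)).
move=> f g f2 g2; have pf := p2 _ f2; have nf := n2 _ f2.
rewrite (hE f) l1// l2//.
by rewrite (s1 (p f))// (s1 (n f))// (s2 (p f))// (s2 (n f))// !half.
Qed.

Section fixed_time.
Variable t : R.
Hypothesis t0 : 0 < t.
Let k_sym := semigroup_sym P_semigroup t0.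

Lemma semigroup_op_L2 f : L2 mu f -> L2 mu (op t f).
Proof. exact: (kernel_op_L2 k_sym). Qed.

Lemma dotL2_semigroup_op f g : L2 mu f -> L2 mu g ->
  dotL2 mu (op t f) g = \int[jm t]_z (f z.2 * g z.1).
Proof. exact: (dotL2_kernel_op k_sym). Qed.

Lemma semigroup_op_symmetric f g : L2 mu f -> L2 mu g ->
  dotL2 mu (op t f) g = dotL2 mu (op t g) f.
Proof.
move=> f2 g2; rewrite !dotL2_semigroup_op// (Rintegral_joint_swap k_sym).
- by apply: eq_Rintegral => z _; rewrite mulrC.
- exact: (L2_measurable f2).
- exact: (L2_measurable g2).
- exact: (L2_joint_integrable k_sym).
Qed.

Lemma semigroup_op_lin (c : R) f g h : L2 mu f -> L2 mu g -> L2 mu h ->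
  dotL2 mu (op t (fun x => c * f x + g x)) h =
  c * dotL2 mu (op t f) h + dotL2 mu (op t g) h.
Proof.
move=> f2 g2 h2; rewrite !dotL2_semigroup_op//; last exact: L2_lin.
have ifh := L2_joint_integrable k_sym f2 h2.
have igh := L2_joint_integrable k_sym g2 h2.
rewrite -RintegralZl// -RintegralD//.
- by apply: eq_Rintegral => z _; rewrite mulrDl mulrA.
- by have := integrableZl measurableT c ifh; apply: eq_integrable.
Qed.

Lemma semigroup_opB f g h : L2 mu f -> L2 mu g -> L2 mu h ->
  dotL2 mu (op t (fun x => f x - g x)) h =
  dotL2 mu (op t f) h - dotL2 mu (op t g) h.
Proof.
move=> f2 g2 h2.
have -> : (fun x => f x - g x) = (fun x => -1 * g x + f x).
  by apply/funext => x; rewrite mulN1r addrC.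
by apply: etrans (semigroup_op_lin (-1) g2 f2 h2) _; rewrite mulN1r addrC.
Qed.

Lemma Rintegral_joint_marginal1 h :
  mu.-integrable setT (EFin \o h) ->
  (jm t).-integrable setT (fun z => (h z.1)%:E) /\
  \int[jm t]_z h z.1 = \int[mu]_x h x.
Proof.
move=> ih; have mh : measurable_fun [set: borel X] h.
  by apply/measurable_EFinP; exact: (measurable_int mu).
have i1 : (jm t).-integrable setT (fun z => (h z.1)%:E).
  apply/integrableP; split; first by apply/measurable_EFinP; exact: (measurable_fst_comp mh).
  have [_] := integrableP _ _ _ ih; apply: le_lt_trans.
  by apply: (@integral_joint_fst_le _ _ _ mu (P t) (fun x => `|(h x)%:E|%E)) => //;
    apply: measurableT_comp => //; exact/measurable_EFinP.
split=> //; congr fine; rewrite integral_joint_integrable//.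
apply: ae_eq_integral => //.
- exact: (@measurable_inner_integral_real _ (borel X) R (P t) (fun z => h z.1) (measurable_fst_comp mh)).
- exact/measurable_EFinP.
apply: filterS (P_conservative t0) => x Px _ /=.
by rewrite integral_cst// Px mule1.
Qed.

Lemma Rintegral_joint_marginal2 h :
  mu.-integrable setT (EFin \o h) ->
  (jm t).-integrable setT (fun z => (h z.2)%:E) /\
  \int[jm t]_z h z.2 = \int[mu]_x h x.
Proof.
move=> ih; have mh : measurable_fun [set: borel X] h.
  by apply/measurable_EFinP; exact: (measurable_int mu).
have [i1 e1] := Rintegral_joint_marginal1 ih.
have i1' : (jm t).-integrable setT (fun z => (1 * h z.1)%:E).
  by apply: eq_integrable i1 => // z _; rewrite mul1r.
have m1 : measurable_fun [set: borel X] (fun=> 1 : R) by exact: measurable_cst.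
split.
  have := integrable_joint_swap k_sym m1 mh i1'.
  by apply: eq_integrable => // z _; rewrite mul1r.
rewrite -e1; have := Rintegral_joint_swap k_sym m1 mh i1' => e2.
by transitivity (\int[jm t]_z (1 * h z.2)); [|rewrite -e2]; apply: eq_Rintegral => z _; rewrite mul1r.
Qed.

Definition approx_form f g : R := t^-1 * (dotL2 mu f g - dotL2 mu (op t f) g).

(** Conservativeness makes mu the marginal of [jm t] on either side, so expanding the product yields
    (f, g) twice and, by symmetry, (P_t f, g) twice. *)
Lemma approx_formE f g : L2 mu f -> L2 mu g -> approx_form f g =
  (2 * t)^-1 * \int[jm t]_z ((f z.1 - f z.2) * (g z.1 - g z.2)).
Proof.
move=> f2 g2; have ifg := L2_integrable f2 g2.
have [i1 e1] := Rintegral_joint_marginal1 ifg.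
have [i2 e2] := Rintegral_joint_marginal2 ifg.
have j1 := L2_joint_integrable k_sym f2 g2.
have j2 := L2_joint_integrable k_sym g2 f2.
transitivity ((2 * t)^-1 * \int[jm t]_z ((f z.1 * g z.1 + f z.2 * g z.2) -
    (f z.2 * g z.1 + g z.2 * f z.1))); last first.
  by congr (_ * _); apply: eq_Rintegral => z _; ring.
rewrite RintegralB//; last 2 first.
- by have := integrableD measurableT i1 i2; apply: eq_integrable.
- by have := integrableD measurableT j1 j2; apply: eq_integrable.
rewrite RintegralD// RintegralD// e1 e2 -!dotL2_semigroup_op//.
rewrite (semigroup_op_symmetric g2 f2) /approx_form /dotL2; field.
by rewrite gt_eqF.
Qed.

Lemma approx_form_sqE f : L2 mu f -> approx_form f f =
  (2 * t)^-1 * \int[jm t]_z ((f z.1 - f z.2) ^+ 2).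
Proof. by move=> f2; rewrite approx_formE//; congr (_ * _); apply: eq_Rintegral => z _; rewrite expr2. Qed.

Lemma L2_joint_diff_integrable f : L2 mu f ->
  (jm t).-integrable setT (fun z => ((f z.1 - f z.2) ^+ 2)%:E).
Proof.
move=> f2; have ifg := L2_integrable f2 f2.
have [i1 _] := Rintegral_joint_marginal1 ifg.
have [i2 _] := Rintegral_joint_marginal2 ifg.
have j1 := L2_joint_integrable k_sym f2 f2.
have := integrableB measurableT (integrableD measurableT i1 i2) (integrableD measurableT j1 j1).
by apply: eq_integrable => // z _; congr (_%:E) => /=; ring.
Qed.

Lemma approx_form_semi_inner : semi_inner (L2 mu) approx_form.
Proof.
have [ex dm _ _ _] := @L2_semi_inner R X mu; split => //.
- by move=> f g f2 g2; rewrite /approx_form dotL2C semigroup_op_symmetric.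
- move=> c f g h f2 g2 h2; rewrite /approx_form semigroup_op_lin// dotL2_lin//.
  by field; rewrite gt_eqF.
- move=> f f2; rewrite approx_form_sqE// mulr_ge0//.
    by rewrite invr_ge0 mulr_ge0// ltW.
  by apply: Rintegral_ge0 => z _; exact: sqr_ge0.
Qed.

End fixed_time.
End approximating_forms.

(** * The semigroup law for pairings *)

Section kernel_square.
Context d (T : measurableType d) (R : realType).
Variables (m : {measure set T -> \bar R}) (k k2 : R.-spker T ~> T).
Hypothesis k_sym : forall A B : set T, measurable A -> measurable B ->
  (\int[m]_(x in A) k x B = \int[m]_(x in B) k x A)%E.
Hypothesis kD : forall A : set T, measurable A ->
  {ae m, forall x, k2 x A = (\int[k x]_y k y A)%E}.
Local Open Scope ereal_scope.

Lemma measurable_tensor (f g : T -> \bar R) : measurable_fun setT f ->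
  measurable_fun setT g -> measurable_fun setT (fun z : T * T => f z.1 * g z.2).
Proof. by move=> mf mg; apply: emeasurable_funM; exact: measurableT_comp. Qed.

(** Induction on g with f fixed. For an indicator g, symmetry moves the kernel from f to g and the
    composition law for sets applies. That law holds outside a null set depending on the set, which
    is why indicators come first. *)
Lemma ge0_kernel_square (f g : T -> \bar R) : (forall x, 0 <= f x) ->
  (forall x, 0 <= g x) -> measurable_fun setT f -> measurable_fun setT g ->
  \int[m]_x ((\int[k x]_y f y) * \int[k x]_y g y) =
  \int[m]_x (f x * \int[k2 x]_y g y).
Proof.
move=> f0 g0 mf mg.
have [F FE] : exists F : T -> \bar R, F = fun x => \int[k x]_y f y by eexists.
have F0 x : 0 <= F x by rewrite FE; exact: integral_ge0.
have mF : measurable_fun setT F by rewrite FE; exact: measurable_kernel_integral.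
suff : \int[m]_x (F x * \int[k x]_y g y) = \int[m]_x (f x * \int[k2 x]_y g y).
  by rewrite FE.
rewrite -(integral_joint_tensor m k F0 g0 mF mg) -integral_joint_tensor//.
move: g g0 mg; apply: (@ge0_measurable_ind _ T R (fun g : T -> \bar R =>
  \int[joint_measure m k]_z (F z.1 * g z.2) =
  \int[joint_measure m k2]_z (f z.1 * g z.2))).
- move=> A mA.
  have m1 : measurable_fun setT (fun x => (\1_A x)%:E : \bar R).
    by apply/measurable_EFinP; exact: measurable_indic.
  have i0 x : 0 <= (\1_A x)%:E :> \bar R by rewrite lee_fin.
  rewrite (integral_joint_tensor m k F0 i0 mF m1) (integral_joint_tensor m k2 f0 i0 mf m1).
  transitivity (\int[m]_x ((\int[k x]_y (\1_A y)%:E) * \int[k x]_y f y)).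
    by rewrite FE; apply: eq_integral => x _; rewrite muleC.
  rewrite (@joint_sym _ _ _ _ _ k_sym (fun x => \int[k x]_y (\1_A y)%:E))//; last 2 first.
  + by move=> x; exact: integral_ge0.
  + exact: measurable_kernel_integral.
  apply: ae_eq_integral => //.
  + apply: emeasurable_funM => //; apply: measurable_kernel_integral.
      by move=> x; exact: integral_ge0.
    exact: measurable_kernel_integral.
  + by apply: emeasurable_funM => //; exact: measurable_kernel_integral.
  apply: filterS (kD mA) => x kx _ /=.
  rewrite integral_indic// setIT kx; congr (_ * _).
  by apply: eq_integral => y _; rewrite integral_indic// setIT.
- move=> u v u0 v0 mu_ mv uE vE.
  have mFu := measurable_tensor mF mu_; have mFv := measurable_tensor mF mv.
  have mfu := measurable_tensor mf mu_; have mfv := measurable_tensor mf mv.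
  transitivity (\int[joint_measure m k]_z (F z.1 * u z.2 + F z.1 * v z.2)).
    by apply: eq_integral => z _; rewrite ge0_muleDr.
  transitivity (\int[joint_measure m k2]_z (f z.1 * u z.2 + f z.1 * v z.2)); last first.
    by apply: eq_integral => z _; rewrite ge0_muleDr.
  rewrite ge0_integralD//; last 2 first.
  + by move=> z _; exact: mule_ge0.
  + by move=> z _; exact: mule_ge0.
  rewrite uE vE ge0_integralD//.
  + by move=> z _; exact: mule_ge0.
  + by move=> z _; exact: mule_ge0.
- move=> c u c0 u0 mu_ uE.
  have mFu := measurable_tensor mF mu_; have mfu := measurable_tensor mf mu_.
  transitivity (\int[joint_measure m k]_z (c%:E * (F z.1 * u z.2))).
    by apply: eq_integral => z _; rewrite muleCA.
  rewrite ge0_integralZl_EFin//; last by move=> z _; exact: mule_ge0.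
  rewrite uE -ge0_integralZl_EFin//; last by move=> z _; exact: mule_ge0.
  by apply: eq_integral => z _; rewrite muleCA.
- move=> u u0 mu_ ndu uE.
  transitivity (\int[joint_measure m k]_z limn (fun n => F z.1 * u n z.2)).
    apply: eq_integral => z _; rewrite muleC -limn_ge0_muler//.
    by congr (limn _); apply/funext => n; rewrite muleC.
  rewrite monotone_convergence//; last 3 first.
  + by move=> n; exact: measurable_tensor.
  + by move=> n z _; exact: mule_ge0.
  + by move=> z _ a b ab; rewrite lee_wpmul2l//; exact: ndu.
  under eq_fun do rewrite uE.
  rewrite -monotone_convergence//; last 3 first.
  + by move=> n; exact: measurable_tensor.
  + by move=> n z _; exact: mule_ge0.
  + by move=> z _ a b ab; rewrite lee_wpmul2l//; exact: ndu.
  apply: eq_integral => z _; rewrite [RHS]muleC -limn_ge0_muler//.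
  by congr (limn _); apply/funext => n; rewrite muleC.
Qed.

End kernel_square.

Section semigroup_property.
Context (R : realType) (X : pmetricType R).
Variables (mu : {measure set borel X -> \bar R}).
Variable P : R -> R.-spker borel X ~> borel X.
Hypothesis P_semigroup : symmetric_markov_semigroup mu P.
Hypothesis P_conservative : conservative mu P.
Implicit Types f g h : X -> R.
Local Notation op t := (semigroup_op P t).
Variable s : R.
Hypothesis s0 : 0 < s.
Let k_sym := semigroup_sym P_semigroup s0.
Let ss0 : 0 < s + s. Proof. exact: addr_gt0. Qed.

(** With f = g = h and t = 2 s it reads (P_t h, h) = |P_{t/2} h|^2, the source of both the
    positivity of P_t and the monotonicity of the approximating forms under halving t. *)
Lemma semigroup_op_double f g : L2 mu f -> L2 mu g ->
  dotL2 mu (op s f) (op s g) = dotL2 mu (op (s + s) f) g.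
Proof.
have opL2 h : L2 mu h -> L2 mu (op s h) by exact: (semigroup_op_L2 P_semigroup s0).
move: f g; apply: (L2_bilinear_eq (b1 := fun f g => dotL2 mu (op s f) (op s g))
  (b2 := fun f g => dotL2 mu (op (s + s) f) g)).
- by move=> f g _ _; exact: dotL2C.
- by move=> f g f2 g2; exact: (semigroup_op_symmetric P_semigroup ss0).
- by move=> f g h f2 g2 h2; rewrite (semigroup_opB P_semigroup s0)//; exact: opL2.
- by move=> f g h f2 g2 h2; rewrite (semigroup_opB P_semigroup ss0).
move=> f g f2 g2 f0 g0; have mf := L2_measurable f2; have mg := L2_measurable g2.
rewrite (semigroup_op_symmetric P_semigroup ss0)// (dotL2_semigroup_op P_semigroup ss0)//.
congr fine.
have f0' x : (0 <= (f x)%:E)%E by rewrite lee_fin.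
have g0' x : (0 <= (g x)%:E)%E by rewrite lee_fin.
have mf' : measurable_fun [set: borel X] (EFin \o f) by exact/measurable_EFinP.
have mg' : measurable_fun [set: borel X] (EFin \o g) by exact/measurable_EFinP.
have mI t h : (forall x, 0 <= (h x)%:E)%E -> measurable_fun [set: borel X] (EFin \o h) ->
    measurable_fun [set: borel X] (fun x => \int[P t x]_y (h y)%:E)%E.
  by move=> h0 mh; apply: (measurable_kernel_integral (P t)) => // x; exact: h0.
transitivity (\int[mu]_x ((\int[P s x]_y (g y)%:E) * \int[P s x]_y (f y)%:E))%E.
  apply: ae_eq_integral => //.
  - by apply/measurable_EFinP/measurable_funM; apply: L2_measurable; exact: opL2.
  - by apply: emeasurable_funM; exact: mI.
  have aef := kernel_ae_integrable k_sym f2.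
  have aeg := kernel_ae_integrable k_sym g2.
  apply: filterS2 aef aeg => x fi gi _ /=.
  rewrite /semigroup_op /Rintegral EFinM muleC.
  by rewrite !fineK//; exact: integrable_fin_num.
transitivity (\int[mu]_x ((f x)%:E * \int[P (s + s) x]_y (g y)%:E))%E.
  under eq_integral do rewrite muleC.
  exact: (ge0_kernel_square k_sym (semigroupD P_semigroup s0 s0) f0' g0' mf' mg').
rewrite -(@integral_joint_tensor _ _ _ mu (P (s + s)) (EFin \o f) (EFin \o g))//.
by apply: eq_integral => z _; rewrite /= muleC.
Qed.

End semigroup_property.

(** * From the generator to the form: resolvents and monotonicity *)

Section dirichlet_form_limit.
Context (R : realType) (X : pmetricType R).
Variables (mu : {measure set borel X -> \bar R}) (E : dirichlet_form mu).
Variable P : R -> R.-spker borel X ~> borel X.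
Hypothesis P_semigroup : symmetric_markov_semigroup mu P.
Hypothesis P_conservative : conservative mu P.
Hypothesis P_associated : associated E P.
Implicit Types f g h u v : X -> R.
Local Notation op t := (semigroup_op P t).
Local Notation Et t := (approx_form mu P t).
Local Notation dot := (dotL2 mu).
Local Notation form := Defs.form.
Let L2si := L2_semi_inner mu.
Let Etsi t (t0 : 0 < t) := approx_form_semi_inner P_semigroup P_conservative t0.

Lemma form_semi_inner : semi_inner (dom E) (form E).
Proof.
split.
- have [_ [f f2]] : True /\ exists f, L2 mu f by split => //; exact: (si_ex L2si).
  by have [g] := dom_dense E f2 ltr01; exists g.
- exact: (dom_linear (d := E)).
- exact: (form_sym (d := E)).
- exact: (form_linear (d := E)).
- exact: (form_ge0 (d := E)).
Qed.
Let Esi := form_semi_inner.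

Lemma form_alpha_semi_inner (alpha : R) : 0 <= alpha ->
  semi_inner (dom E) (fun f g => form E f g + alpha * dot f g).
Proof.
move=> a0; split.
- exact: (si_ex Esi).
- exact: (si_dom Esi).
- by move=> f g fD gD; rewrite (si_sym Esi)// dotL2C.
- move=> c f g h fD gD hD; rewrite (si_lin Esi)// dotL2_lin; first by ring.
  + exact: dom_L2 fD.
  + exact: dom_L2 gD.
  + exact: dom_L2 hD.
- by move=> f fD; rewrite addr_ge0 ?(si_ge0 Esi)// mulr_ge0// dotL2_ge0.
Qed.

(** u is alpha G_alpha f for the resolvent G_alpha: it represents the functional alpha (f, v) with
    respect to E + alpha ( , ). *)
Lemma resolvent_exists (alpha : R) f : 0 < alpha -> L2 mu f ->
  exists2 u, dom E u & forall v, dom E v ->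
    form E u v = alpha * (dot f v - dot u v).
Proof.
move=> a0 f2; have domL2 v : dom E v -> L2 mu v by exact: dom_L2.
have [||||u uD uE] := riesz_representation (form_alpha_semi_inner (ltW a0))
    (l := fun v => alpha * dot f v) (K := alpha * dot f f).
- move=> u uD cau; have C0 : 0 < 1 + alpha^-1 by rewrite addr_gt0// invr_gt0.
  (* E + alpha ( , ) and E + ( , ) have equivalent norms, so closedness of the form is completeness
     for the former. This is one of the two comparisons; the other has the factor 1 + alpha. *)
  have cmp v : dom E v -> form E v v + sqnormL2 mu v <=
      (1 + alpha^-1) * (form E v v + alpha * dot v v).
    move=> vD; have := si_ge0 Esi vD; have := dotL2_ge0 mu v; rewrite /sqnormL2.
    move=> d0 e0; have : 0 <= alpha^-1 * form E v v by rewrite mulr_ge0// invr_ge0 ltW.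
    have : 0 <= alpha * dot v v by rewrite mulr_ge0// ltW.
    rewrite mulrDl mul1r mulrDr mulrA mulVf ?gt_eqF// mul1r; lra.
  have [||f0 f0D f0l] := form_closed (d := E) (u := u) => //.
    move=> e e0; have [N HN] := cau (e / (1 + alpha^-1)) (divr_gt0 e0 C0).
    exists N => m n Nm Nn /=.
    apply: le_lt_trans (cmp _ (si_domB Esi (uD m) (uD n))) _.
    by rewrite mulrC -ltr_pdivlMr//; exact: HN.
  exists f0 => // e e0.
  have C1 : 0 < 1 + alpha by rewrite addr_gt0.
  have /cvgrPdist_lt/(_ (e / (1 + alpha)) (divr_gt0 e0 C1))[N _ HN] := f0l.
  exists N => n /HN /=; rewrite sub0r normrN; set v := fun x => u n x - f0 x.
  have vD : dom E v by exact: (si_domB Esi).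
  have := si_ge0 Esi vD; have := dotL2_ge0 mu v; rewrite /sqnormL2 => d0 e1.
  rewrite ger0_norm ?addr_ge0// ltr_pdivlMr// => h.
  apply: le_lt_trans h.
  have : 0 <= alpha * form E v v by rewrite mulr_ge0// ltW.
  rewrite mulrDr mulr1 mulrDl; nra.
- move=> c g h gD hD; have f2' := f2.
  by rewrite ![dot f _]dotL2C dotL2_lin; [ring|exact: domL2|exact: domL2|].
- by rewrite mulr_ge0 ?dotL2_ge0// ltW.
- move=> v vD; have := si_CS L2si f2 (domL2 _ vD).
  have := si_ge0 Esi vD; have := dotL2_ge0 mu v; have := dotL2_ge0 mu f.
  move: (dot f f) (dot v v) (form E v v) (dot f v) => F V Ev fv F0 V0 E0 cs.
  have : 0 <= alpha * F * Ev by rewrite !mulr_ge0// ltW.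
  have : alpha ^+ 2 * fv ^+ 2 <= alpha ^+ 2 * (F * V) by rewrite ler_wpM2l// sqr_ge0.
  rewrite exprMn; nra.
exists u => // v vD; have := uE v vD; lra.
Qed.

(** The equation for u says that u is in the domain of the generator L and that L u = h. The strong
    derivative of P_t u at 0 is then paired with g. *)
Lemma generator_limit u h g : L2 mu h -> L2 mu g -> dom E u ->
  (forall v, dom E v -> form E u v = - dot h v) ->
  Et t u g @[t --> 0^'+] --> - dot h g.
Proof.
move=> h2 g2 uD uh; have u2 : L2 mu u by exact: dom_L2 uD.
have lim0 := (P_associated u2 h2).2 (conj uD uh).
apply/cvgrPdist_le => e e0.
have g1 : 0 < 1 + dot g g by rewrite ltr_pwDl// dotL2_ge0.
have /cvgrPdist_lt/(_ (e ^+ 2 / (1 + dot g g))) := lim0.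
move=> /(_ (divr_gt0 (exprn_gt0 2 e0) g1)).
apply: filterS2 (nbhs_right_gt 0) => t t0.
rewrite sub0r normrN => small.
set q := (fun x => t^-1 * (op t u x - u x) - h x) in small.
have op2 : L2 mu (op t u) by exact: (semigroup_op_L2 P_semigroup t0).
have d2 : L2 mu (fun x => op t u x - u x) by exact: (si_domB L2si).
have q2 : L2 mu q by apply: (si_domB L2si) => //; exact: (si_domZ L2si).
have qg : - dot h g - Et t u g = dot q g.
  rewrite /q (si_Bl L2si)//; last exact: (si_domZ L2si).
  by rewrite (si_Zl L2si)// (si_Bl L2si)// /approx_form; ring.
rewrite qg; apply: normr_le_sqr; first exact: ltW.
apply: le_trans (si_CS L2si q2 g2) _.
have q0 : 0 <= sqnormL2 mu q by exact: dotL2_ge0.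
rewrite (ger0_norm q0) ltr_pdivlMr// in small.
rewrite (le_trans _ (ltW small))// ler_wpM2l// lerDr//.
Qed.

(** Expansion of |P_{t/2} h - h|^2 >= 0, whose first term is (P_t h, h). *)
Lemma approx_form_half t h : 0 < t -> L2 mu h -> Et t h h <= Et (t / 2) h h.
Proof.
move=> t0 h2; have s0 : 0 < t / 2 by rewrite divr_gt0.
have op2 : L2 mu (op (t / 2) h) by exact: (semigroup_op_L2 P_semigroup s0).
have := semigroup_op_double P_semigroup s0 h2 h2; rewrite -splitr => dbl.
have := dotL2_ge0 mu (fun x => op (t / 2) h x - h x).
rewrite (si_sqB L2si op2 h2) dbl /approx_form invf_div.
move: (dot (op t h) h) (dot (op (t / 2) h) h) (dot h h) => a b c h0.
suff : 0 <= t^-1 * (a - 2 * b + c) by rewrite -mulrA; lra.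
by rewrite mulr_ge0// invr_ge0 ltW.
Qed.

(** Halving reaches only the times t / 2^n, which is enough because they tend to 0. *)
Lemma approx_form_le_lim t h l : 0 < t -> L2 mu h ->
  Et s h h @[s --> 0^'+] --> l -> Et t h h <= l.
Proof.
move=> t0 h2 /cvg_at_rightP lim.
have iter n : Et t h h <= Et (t / 2 ^+ n) h h.
  elim: n => [|n IHn]; first by rewrite expr0 divr1.
  apply: le_trans IHn _; rewrite exprSr invfM mulrA; apply: approx_form_half => //.
  by rewrite divr_gt0// exprn_gt0.
have /lim lim' : (forall n, 0 < t / 2 ^+ n) /\ (fun n => t / 2 ^+ n) @ \oo --> 0.
  split; first by move=> n; rewrite divr_gt0// exprn_gt0.
  under eq_fun do rewrite -exprVn; apply: cvg_geometric.
  by rewrite ger0_norm ?invr_ge0// invf_lt1// ltr1n.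
rewrite -(cvg_lim _ lim')//; apply: limr_ge; first exact: cvgP lim'.
exact: nearW.
Qed.
End dirichlet_form_limit.

(** y <= (a + x) / 2 by the arithmetic-geometric mean inequality, so x <= (a + x) / 2 + e / 2, which
    is solved for x. *)
Lemma le_of_quadratic_bound (R : realFieldType) (x y z a e : R) : 0 <= a -> 0 <= x ->
  x = y + z -> y ^+ 2 <= a * x -> z <= e / 2 -> x <= e + a.
Proof.
move=> a0 x0 xE yax ze.
have : y <= (a + x) / 2.
  apply: le_trans (ler_norm _) _; apply: normr_le_sqr; first by rewrite divr_ge0 ?addr_ge0.
  by have := sqr_ge0 (a - x); nra.
by lra.
Qed.

Lemma normr_dist3 (R : realFieldType) (a b c d e : R) :
  `|b - c| <= e / 3 -> `|a - b| <= e / 3 -> `|d - c| <= e / 3 -> `|a - d| <= e.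
Proof. by rewrite !ler_norml; lra. Qed.

(** * Convergence of the approximating forms to the Dirichlet form *)

Section resolvent_approximation.
Context (R : realType) (X : pmetricType R).
Variables (mu : {measure set borel X -> \bar R}) (E : dirichlet_form mu).
Variable P : R -> R.-spker borel X ~> borel X.
Hypothesis P_semigroup : symmetric_markov_semigroup mu P.
Hypothesis P_conservative : conservative mu P.
Hypothesis P_associated : associated E P.
Implicit Types f g h v : X -> R.
Local Notation op t := (semigroup_op P t).
Local Notation Et t := (approx_form mu P t).
Local Notation dot := (dotL2 mu).
Local Notation form := (Defs.form E).
Let L2si := L2_semi_inner mu.
Let Etsi t (t0 : 0 < t) := approx_form_semi_inner P_semigroup P_conservative t0.
Let Esi := form_semi_inner E.
Let domL2 v : dom E v -> L2 mu v. Proof. exact: dom_L2. Qed.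

Lemma approx_form_le_L2 t h : 0 < t -> L2 mu h -> Et t h h <= t^-1 * dot h h.
Proof.
move=> t0 h2; have s0 : 0 < t / 2 by rewrite divr_gt0.
have := semigroup_op_double P_semigroup s0 h2 h2; rewrite -splitr => dbl.
rewrite /approx_form -dbl ler_wpM2l ?invr_ge0 ?(ltW t0)// gerBl.
exact: dotL2_ge0.
Qed.

Section fixed_function.
Variables (f : X -> R) (u : nat -> X -> R).
Hypotheses (f2 : L2 mu f) (uD : forall n, dom E (u n)).
Hypothesis uE : forall n v, dom E v ->
  form (u n) v = n.+1%:R * (dot f v - dot (u n) v).
Let u2 n : L2 mu (u n). Proof. exact: domL2. Qed.
(** The Yosida approximation of E(f, f) at parameter n + 1. It is the quantity through which the
    numbers E_t(f, f) and E(f, f) are compared. *)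
Let m n : R := n.+1%:R * (dot f f - dot (u n) f).
Let a n x : R := f x - u n x.
Let a2 n : L2 mu (a n). Proof. exact: (si_domB L2si). Qed.
Let aa n : dot (a n) (a n) = dot f f - 2 * dot f (u n) + dot (u n) (u n).
Proof. exact: (si_sqB L2si). Qed.

Lemma resolvent_approx_form n g : L2 mu g ->
  Et t (u n) g @[t --> 0^'+] --> n.+1%:R * (dot f g - dot (u n) g).
Proof.
move=> g2; pose h x := n.+1%:R * (u n x - f x).
have h2 : L2 mu h by apply: (si_domZ L2si); exact: (si_domB L2si).
have hE v : L2 mu v -> - dot h v = n.+1%:R * (dot f v - dot (u n) v).
  move=> v2; rewrite (si_Zl L2si)//; last exact: (si_domB L2si).
  by rewrite (si_Bl L2si)//; ring.
rewrite -hE//; apply: (generator_limit P_semigroup P_associated) => // v vD.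
by rewrite uE// hE//; exact: domL2.
Qed.

(** u_n lies in the domain of the generator, so E_t(u_n, u_n) is known to tend to E(u_n, u_n), and
    it is bounded by this limit. *)
Lemma resolvent_approx_le n t : 0 < t -> Et t (u n) (u n) <= form (u n) (u n).
Proof.
move=> t0; apply: (approx_form_le_lim P_semigroup) => //.
by rewrite uE//; exact: resolvent_approx_form.
Qed.

Let mE n : m n = form (u n) (u n) + n.+1%:R * dot (a n) (a n).
Proof. by rewrite uE// aa /m (dotL2C mu (u n) f); ring. Qed.

Let m_ge0 n : 0 <= m n.
Proof. by rewrite mE addr_ge0 ?mulr_ge0 ?dotL2_ge0// (si_ge0 Esi). Qed.

Let form_le_m n : form (u n) (u n) <= m n.
Proof. by rewrite mE lerDl mulr_ge0 ?dotL2_ge0. Qed.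

Let aa_le n S : m n <= S -> dot (a n) (a n) <= S / n.+1%:R.
Proof.
move=> mS; rewrite ler_pdivlMr// mulrC (le_trans _ mS)// mE lerDr.
exact: (si_ge0 Esi).
Qed.

(** The right side exceeds the left by (k - n) |f - u_k|^2 + (n + 1) |u_n - u_k|^2. *)
Let formB (n k : nat) : (n <= k)%N ->
  form (fun x => u k x - u n x) (fun x => u k x - u n x) <= m k - m n.
Proof.
move=> nk; rewrite (si_sqB Esi)// (si_sym Esi (f := u k) (g := u n))//.
rewrite !uE// /m !(dotL2C mu (u _) f).
have b0 := dotL2_ge0 mu (fun x => f x - u k x); rewrite (si_sqB L2si)// in b0.
have d0 := dotL2_ge0 mu (fun x => u n x - u k x); rewrite (si_sqB L2si)// in d0.
have : n.+1%:R <= k.+1%:R :> R by rewrite ler_nat.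
have : 0 <= n.+1%:R :> R by [].
move: n.+1%:R k.+1%:R => p q p0 pq.
move: (dot f f) (dot f (u k)) (dot (u k) (u k)) (dot (u n) (u k)) (dot (u n) (u n)) (dot f (u n)) b0 d0.
move=> F fk kk nk' nn fn b0 d0.
have h1 : 0 <= (q - p) * (F - 2 * fk + kk) by rewrite mulr_ge0// subr_ge0.
have h2 : 0 <= p * (nn - 2 * nk' + kk) by rewrite mulr_ge0.
nra.
Qed.

(** m_n is the limit of E_t(u_n, f), and Cauchy-Schwarz with E_t(u_n, u_n) <= E(u_n, u_n) <= m_n
    gives m_n^2 <= m_n S. *)
Lemma resolvent_m_le_approx S : 0 <= S -> (forall t, 0 < t -> Et t f f <= S) ->
  forall n, n.+1%:R * (dot f f - dot (u n) f) <= S.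
Proof.
move=> S0 fS n; rewrite -/(m n).
have sqm : m n ^+ 2 <= m n * S.
  have lim : (Et t (u n) f) ^+ 2 @[t --> 0^'+] --> m n ^+ 2.
    under eq_fun do rewrite expr2.
    by rewrite expr2; apply: cvgM; exact: resolvent_approx_form.
  rewrite -(cvg_lim _ lim)//; apply: limr_le; first exact: cvgP lim.
  apply: filterS (nbhs_right_gt 0) => t t0.
  apply: le_trans (si_CS (Etsi t0) (u2 n) f2) _.
  apply: ler_pM; rewrite ?(si_ge0 (Etsi t0))//; last exact: fS.
  by rewrite (le_trans (resolvent_approx_le _ t0)).
have [mz|mn] := eqVneq (m n) 0; first by rewrite mz.
have mp : 0 < m n by rewrite lt_def mn m_ge0.
by rewrite expr2 ler_pM2l in sqm.
Qed.

Lemma resolvent_m_le_form : dom E f ->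
  forall n, n.+1%:R * (dot f f - dot (u n) f) <= form f f.
Proof.
move=> fD n; rewrite -/(m n).
have sqm : m n ^+ 2 <= m n * form f f.
  rewrite {1}/m -uE//; apply: le_trans (si_CS Esi (uD n) fD) _.
  by rewrite ler_wpM2r// (si_ge0 Esi).
have [mz|mn] := eqVneq (m n) 0; first by rewrite mz (si_ge0 Esi).
have mp : 0 < m n by rewrite lt_def mn m_ge0.
by rewrite expr2 ler_pM2l in sqm.
Qed.

Let small S (e : R) : 0 <= S -> 0 < e ->
  exists N : nat, forall n, (N <= n)%N -> S / n.+1%:R < e.
Proof.
move=> S0 e0; have eS : 0 < e / (S + 1) by rewrite divr_gt0// ltr_wpDl.
have [N _ HN] := near_infty_natSinv_lt (PosNum eS).
exists N => n /HN /= h; rewrite (@le_lt_trans _ _ ((S + 1) / n.+1%:R))//.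
  by rewrite ler_wpM2r ?invr_ge0// lerDl.
by rewrite mulrC -ltr_pdivlMr// ltr_wpDl.
Qed.

(** Split f = u_N + a_N in one argument of E_t(f, f). The square of the first term is at most S
    E_t(f, f); the second term is small for large N because E_t(a_N, a_N) <= |a_N|^2 / t with t
    fixed. *)
Lemma approx_form_le_bound t S : 0 < t ->
  (forall n, n.+1%:R * (dot f f - dot (u n) f) <= S) -> Et t f f <= S.
Proof.
move=> t0 mS; have S0 : 0 <= S by rewrite (le_trans (m_ge0 0%N))// mS.
apply/ler_addgt0Pl => e e0; have x0 := si_ge0 (Etsi t0) f2.
set x := Et t f f in x0 *.
have d0 : 0 < t * (e / 2) ^+ 2 / (x + 1).
  by rewrite divr_gt0 ?mulr_gt0 ?exprn_gt0 ?divr_gt0// ltr_wpDl.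
have [N /(_ N (leqnn N)) HN] := small S0 d0.
have eq1 : x = Et t (u N) f + Et t (a N) f.
  by rewrite (si_Bl (Etsi t0))// addrC subrK.
have y1 : Et t (u N) f ^+ 2 <= S * x.
  apply: le_trans (si_CS (Etsi t0) (u2 N) f2) _; rewrite ler_wpM2r//.
  by rewrite (le_trans (resolvent_approx_le N t0))// (le_trans (form_le_m N))// mS.
have y2 : Et t (a N) f <= e / 2.
  apply: le_trans (ler_norm _) _; apply: normr_le_sqr; first by rewrite divr_ge0 ?ltW.
  apply: le_trans (si_CS (Etsi t0) (a2 N) f2) _; rewrite -/x.
  apply: (@le_trans _ _ (t^-1 * (t * (e / 2) ^+ 2 / (x + 1)) * x)).
    rewrite ler_wpM2r//; apply: le_trans (approx_form_le_L2 t0 (a2 N)) _.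
    by rewrite ler_wpM2l ?invr_ge0 ?(ltW t0)// (le_trans (aa_le (mS N)))// ltW.
  have -> : t^-1 * (t * (e / 2) ^+ 2 / (x + 1)) * x = (e / 2) ^+ 2 * x / (x + 1).
    by field; rewrite !gt_eqF// ltr_wpDl.
  rewrite ler_pdivrMr ?ltr_wpDl//.
  by rewrite ler_wpM2l ?sqr_ge0// lerDl.
exact: (le_of_quadratic_bound S0 x0 eq1 y1 y2).
Qed.

(** m is nondecreasing and bounded, so u_n is Cauchy for E by [formB], and u_n tends to f in L^2.
    Closedness yields a limit g, equal to f almost everywhere, and stability under such
    modifications moves the conclusion from g to f. *)
Lemma resolvent_cvg S :
  (forall n, n.+1%:R * (dot f f - dot (u n) f) <= S) ->
  dom E f /\ forall e : R, 0 < e -> exists n,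
    form (fun x => f x - u n x) (fun x => f x - u n x) < e.
Proof.
move=> mS.
have S0 : 0 <= S by rewrite (le_trans (m_ge0 0%N))// mS.
have m_nd n k : (n <= k)%N -> m n <= m k.
  by move=> nk; rewrite -subr_ge0 (le_trans _ (formB nk))// (si_ge0 Esi)//; exact: (si_domB Esi).
have hs : has_sup (range m).
  by split; [exists (m 0%N), 0%N|exists S => _ [n _ <-]; exact: mS].
have m_lub n : m n <= sup (range m) by apply: ub_le_sup; [exact: hs.2|exists n].
have cau (e : R) : 0 < e -> exists N : nat, forall k n, (N <= k)%N -> (N <= n)%N ->
    form (fun x => u k x - u n x) (fun x => u k x - u n x) < e.
  move=> e0; have [_ [N _ <-] HN] := sup_adherent e0 hs.
  have key (k n : nat) : (n <= k)%N -> (N <= n)%N ->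
      form (fun x => u k x - u n x) (fun x => u k x - u n x) < e.
    move=> nk Nn; apply: le_lt_trans (formB nk) _.
    have := m_lub k; have := m_nd _ _ Nn; move: (sup _) HN => s; lra.
  exists N => k n Nk Nn; have [nk|/ltnW kn] := leqP n k; first exact: key.
  rewrite (si_sqB Esi)// (si_sym Esi (f := u k) (g := u n))//.
  by have := key _ _ kn Nk; rewrite (si_sqB Esi)//; lra.
have L2u n k : sqnormL2 mu (fun x => u k x - u n x) <= 2 * dot (a n) (a n) + 2 * dot (a k) (a k).
  have -> : sqnormL2 mu (fun x => u k x - u n x) = dot (fun x => a n x - a k x) (fun x => a n x - a k x).
    by rewrite /sqnormL2; congr (dot _ _); apply/funext => x; rewrite /a; ring.
  have := dotL2_ge0 mu (fun x => 1 * a n x + a k x).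
  rewrite (si_sqlin L2si)// (si_sqB L2si)//; lra.
have [||g gD gl] := form_closed (d := E) (u := u) => //.
  move=> e e0; have e2 : 0 < e / 2 by rewrite divr_gt0.
  have e8 : 0 < e / 8 by rewrite divr_gt0.
  have [N1 H1] := cau _ e2; have [N2 H2] := small S0 e8.
  exists (maxn N1 N2) => p q; rewrite !geq_max => /andP[p1 p2] /andP[q1 q2] /=.
  have := H1 _ _ p1 q1; have := L2u q p.
  have := H2 _ p2; have := H2 _ q2; have := aa_le (mS p); have := aa_le (mS q).
  move: (S / p.+1%:R) (S / q.+1%:R) => x y; lra.
have g2 : L2 mu g by exact: domL2.
have glim (e : R) : 0 < e -> exists N : nat, forall n, (N <= n)%N ->
    form (fun x => u n x - g x) (fun x => u n x - g x) < e /\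
    dot (fun x => u n x - g x) (fun x => u n x - g x) < e.
  move=> e0; have /cvgrPdist_lt/(_ _ e0)[N _ HN] := gl.
  exists N => n /HN /=; rewrite sub0r normrN.
  have f0 : 0 <= form (fun x => u n x - g x) (fun x => u n x - g x).
    by rewrite (si_ge0 Esi)//; exact: (si_domB Esi).
  have := dotL2_ge0 mu (fun x => u n x - g x); rewrite /sqnormL2 => d0.
  rewrite ger0_norm ?addr_ge0//; lra.
have gf : sqnormL2 mu (fun x => f x - g x) = 0.
  apply/eqP; rewrite eq_le dotL2_ge0 andbT; apply/ler_addgt0Pl => e e0.
  have e4 : 0 < e / 4 by rewrite divr_gt0.
  have [N1 H1] := glim _ e4; have [N2 H2] := small S0 e4.
  have [_ h1] := H1 _ (leq_maxl N1 N2); have h2 := H2 _ (leq_maxr N1 N2).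
  set n := maxn N1 N2 in h1 h2; have h3 := aa_le (mS n).
  pose b x := u n x - g x; have b2 : L2 mu b by exact: (si_domB L2si).
  have -> : sqnormL2 mu (fun x => f x - g x) = dot (fun x => 1 * a n x + b x) (fun x => 1 * a n x + b x).
    by rewrite /sqnormL2; congr (dot _ _); apply/funext => x; rewrite /a /b; ring.
  have := dotL2_ge0 mu (fun x => a n x - b x).
  rewrite (si_sqlin L2si)// (si_sqB L2si)//.
  rewrite -/(b) in h1; move: (dot b b) (dot (a n) (a n)) (dot (a n) b) (S / n.+1%:R) h1 h2 h3 => *; lra.
have ae : {ae mu, forall x, g x = f x}.
  have d2 : L2 mu (fun x => f x - g x) by exact: (si_domB L2si).
  have FF : Filter (almost_everywhere mu) by exact: ae_filter_ringOfSetsType.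
  by apply: (filterS _ (sqnormL2_eq0 d2 gf)) => x /eqP; rewrite subr_eq0 => /eqP ->.
have [fD fgE] := dom_ae gD f2 ae; split => // e /glim[N /(_ N (leqnn N))[h _]].
exists N; move: h; rewrite !(si_sqB Esi)//.
rewrite (si_sym Esi (f := u N) (g := g))// !fgE//.
rewrite (si_sym Esi (f := f) (g := g))// fgE//.
by lra.
Qed.

End fixed_function.

Lemma resolvent_sequence f : L2 mu f -> exists2 u : nat -> X -> R,
  (forall n, dom E (u n)) & forall n v, dom E v ->
    form (u n) v = n.+1%:R * (dot f v - dot (u n) v).
Proof.
move=> f2; have ex (n : nat) : exists u, dom E u /\ forall v, dom E v ->
    form u v = n.+1%:R * (dot f v - dot u v).
  by have [u uD uE] := resolvent_exists E (ltr0Sn R n) f2; exists u.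
by have [u /all_and2[uD uE]] := choice ex; exists u.
Qed.

(** The criterion that places products and Lipschitz images of core functions in the domain. *)
Lemma dom_of_bounded f S : L2 mu f -> 0 <= S ->
  (forall t, 0 < t -> Et t f f <= S) -> dom E f.
Proof.
move=> f2 S0 fS; have [u uD uE] := resolvent_sequence f2.
exact: (resolvent_cvg f2 uD uE (resolvent_m_le_approx f2 uD uE S0 fS)).1.
Qed.

Lemma approx_form_le_form f t : 0 < t -> dom E f -> Et t f f <= form f f.
Proof.
move=> t0 fD; have f2 := domL2 fD; have [u uD uE] := resolvent_sequence f2.
have mS := resolvent_m_le_form f2 uD uE fD.
exact: approx_form_le_bound.
Qed.

(** Replace f by a resolvent approximation u_n with E(f - u_n, f - u_n) small. The bound E_t <= E
    makes the replacement error uniform in t, and for u_n the limit comes from the generator. *)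
Lemma approx_form_cvg f g : dom E f -> dom E g ->
  Et t f g @[t --> 0^'+] --> form f g.
Proof.
move=> fD gD; have f2 := domL2 fD; have g2 := domL2 gD.
have [u uD uE] := resolvent_sequence f2.
have [_ ucvg] := resolvent_cvg f2 uD uE (resolvent_m_le_form f2 uD uE fD).
apply/cvgrPdist_le => e e0; have G0 := si_ge0 Esi gD.
have d0 : 0 < (e / 3) ^+ 2 / (form g g + 1) by rewrite divr_gt0 ?exprn_gt0 ?divr_gt0// ltr_wpDl.
have [n Hn] := ucvg _ d0.
have aD : dom E (fun x => f x - u n x) by exact: (si_domB Esi).
have bound : form (fun x => f x - u n x) (fun x => f x - u n x) * form g g <= (e / 3) ^+ 2.
  apply: (@le_trans _ _ ((e / 3) ^+ 2 / (form g g + 1) * form g g)).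
    by rewrite ler_wpM2r// ltW.
  rewrite mulrAC ler_pdivrMr ?ltr_wpDl//.
  by rewrite ler_wpM2l ?sqr_ge0// lerDl.
have e3 : 0 < e / 3 by rewrite divr_gt0.
have := resolvent_approx_form f2 uD uE (n := n) g2; rewrite -uE// => /cvgrPdist_le/(_ _ e3).
apply: filterS2 (nbhs_right_gt 0) => t t0 h1.
have h2 : `|form f g - form (u n) g| <= e / 3.
  rewrite -(si_Bl Esi)//; apply: normr_le_sqr; first exact: ltW.
  by apply: le_trans (si_CS Esi aD gD) _.
have h3 : `|Et t f g - Et t (u n) g| <= e / 3.
  rewrite -(si_Bl (Etsi t0))//; last exact: domL2.
  apply: normr_le_sqr; first exact: ltW.
  apply: le_trans (si_CS (Etsi t0) (domL2 aD) g2) _.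
  apply: le_trans bound; apply: ler_pM; rewrite ?(si_ge0 (Etsi t0))//.
  - exact: domL2.
  - exact: approx_form_le_form.
  - exact: approx_form_le_form.
exact: normr_dist3 h1 h2 h3.
Qed.

End resolvent_approximation.

(** * Measurability of the complement of the diagonal *)

Lemma measurable_countable_bigcup d (T : measurableType d) U (A : set U)
    (F : U -> set T) : countable A -> (forall a, A a -> measurable (F a)) ->
  measurable (\bigcup_(a in A) F a).
Proof.
move=> /countable_injP[f injf] mF.
rewrite (_ : \bigcup_(a in A) F a =
    \bigcup_n \bigcup_(a in A `&` f @^-1` [set n]) F a).
  apply: bigcup_measurable => n _.
  have [[a [Aa fa]]|nex] := pselect (exists a, A a /\ f a = n).
    rewrite (_ : \bigcup_(a in _) F a = F a); first exact: mF.
    apply/seteqP; split => [z [b [Ab /= fb] Fbz]|z Faz]; last by exists a.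
    by have <- : b = a by apply: injf; [exact: mem_set|exact: mem_set|rewrite fb].
  rewrite (_ : \bigcup_(a in _) F a = set0)//.
  by rewrite -subset0 => z [a [Aa fa] _]; apply: nex; exists a.
apply/seteqP; split => [z [a Aa Faz]|z [n _ [a [Aa _] Faz]]]; last by exists a.
by exists (f a) => //; exists a.
Qed.

Section borel_metric.
Context (R : realType) (X : pmetricType R).

Lemma continuous_borel_measurable (f : X -> R) : continuous f ->
  measurable_fun [set: borel X] f.
Proof.
move=> /continuousP cf; apply: (measurability _ (RGenOInfty.measurableE R)).
move=> _ [_ [a ->] <-]; rewrite setTI; apply: sub_sigma_algebra.
by apply: cf; exact: interval_open.
Qed.

Lemma continuous_mdist (a : X) : continuous (mdist a : X -> R).
Proof.
move=> x; apply/cvgrPdist_lt => e e0.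
have := nbhsx_ballx x e e0; apply: filterS => y; rewrite ballEmdist/= => xy.
rewrite ltr_norml; apply/andP; split.
- by have := metric_triangle a x y; lra.
- by have := metric_triangle a y x; rewrite (metric_sym y x); lra.
Qed.

(** The sigma-algebra is the product of the Borel ones, so the set has to be reached through the
    coordinates. Distinct x and y are told apart by their distances to a point a of the countable
    dense set with d(x, a) < d(x, y) / 2. *)
Lemma offdiag_measurable : separable_space X ->
  measurable (~` @diag X : set (borel X * borel X)).
Proof.
move=> [A cA dA].
have -> : (~` @diag X : set (borel X * borel X)) =
    \bigcup_(a in A) [set z | mdist a z.1 - mdist a z.2 != 0].
  apply/seteqP; split => [[x y] /= xy|[x y] [a Aa /= axy] xy]; last first.
    by move: axy; rewrite [x]xy subrr eqxx.
  have d0 : 0 < mdist x y.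
    by rewrite mdist_gt0; apply/eqP.
  have [|a [xa Aa]] := dA (ball x (mdist x y / 2))° _ (open_interior _).
    by exists x; apply: nbhsx_ballx; rewrite divr_gt0.
  exists a => //=; apply/eqP => e.
  have := interior_subset xa; rewrite ballEmdist/= metric_sym.
  by have := metric_triangle x a y; rewrite (metric_sym x a); move/eqP: e; lra.
apply: measurable_countable_bigcup => // a _.
have mda := continuous_borel_measurable (continuous_mdist (a := a)).
have md : measurable_fun setT (fun z : borel X * borel X => mdist a z.1 - mdist a z.2).
  by apply: measurable_funB; [exact: (measurable_fst_comp mda)|exact: (measurable_snd_comp mda)].
rewrite (_ : [set z | _] = (fun z : borel X * borel X => mdist a z.1 - mdist a z.2) @^-1` (~` [set 0])).
  by rewrite -[X in measurable X]setTI; apply: md => //; apply: measurableC.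
by apply/seteqP; split => z /=; move/eqP.
Qed.

End borel_metric.

(** * The core is stable under products and Lipschitz maps *)

Section core_algebra.
Context (R : realType) (X : pmetricType R).
Variables (mu : {measure set borel X -> \bar R}) (E : dirichlet_form mu).
Variable P : R -> R.-spker borel X ~> borel X.
Hypothesis P_semigroup : symmetric_markov_semigroup mu P.
Hypothesis P_conservative : conservative mu P.
Hypothesis P_associated : associated E P.
Implicit Types f g h : X -> R.
Local Notation Et t := (approx_form mu P t).
Local Notation form := (Defs.form E).
Let Esi := form_semi_inner E.

Lemma core_measurable f : real_core E f -> measurable_fun [set: borel X] f.
Proof. by move=> [_ [cf _]]; exact: continuous_borel_measurable. Qed.

Lemma core_bounded f : real_core E f -> exists2 M : R, 0 <= M & forall x, `|f x| <= M.
Proof.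
move=> [_ [cf kf]]; have cf' : {within closure [set x | f x != 0], continuous f}.
  exact: continuous_subspaceT.
have [M [_ HM]] := compact_bounded (continuous_compact cf' kf).
exists (`|M| + 1) => // x; have [->|fx0] := eqVneq (f x) 0.
  by rewrite normr0 addr_ge0.
apply: HM; first by rewrite (le_lt_trans (ler_norm M))// ltrDl.
by exists x => //; exact: subset_closure.
Qed.

Lemma real_core_lin c f g : real_core E f -> real_core E g ->
  real_core E (fun x => c * f x + g x).
Proof.
move=> [fD [cf kf]] [gD [cg kg]]; split; first exact: (si_dom Esi).
split; first by move=> x; apply: cvgD; [apply: cvgM; [exact: cvg_cst|exact: cf]|exact: cg].
apply: (@subclosed_compact _ _ (closure [set x | f x != 0] `|` closure [set x | g x != 0])).
- exact: closed_closure.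
- exact: compactU.
rewrite -closureU; apply: closureS => x /=.
have [->|//] := eqVneq (f x) 0; last by left.
by rewrite mulr0 add0r; right.
Qed.

Lemma real_core0 : real_core E (fun=> 0).
Proof.
split; first exact: (si_dom0 Esi).
split; first by move=> x; exact: cvg_cst.
rewrite (_ : [set x | _] = set0) ?closure0; first exact: compact0.
by apply/seteqP; split => x //=; rewrite eqxx.
Qed.

(** Increments of h are bounded by those of f and g, so E_t(h, h) is bounded uniformly in t and
    [dom_of_bounded] applies. Two dominating functions are allowed in order to treat products
    together with Lipschitz images. *)
Lemma real_core_dominated (c1 c2 : R) f g h : real_core E f -> real_core E g ->
  continuous h -> (forall x, f x = 0 -> g x = 0 -> h x = 0) ->
  (forall x, `|h x| <= c1 * `|f x| + c2 * `|g x|) ->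
  (forall x y, `|h x - h y| <= c1 * `|f x - f y| + c2 * `|g x - g y|) ->
  0 <= c1 -> 0 <= c2 -> real_core E h.
Proof.
move=> fC gC ch fgh hle dh c10 c20; have [fD [cf kf]] := fC; have [gD [cg kg]] := gC.
have f2 : L2 mu f by exact: dom_L2 fD.
have g2 : L2 mu g by exact: dom_L2 gD.
have mh : measurable_fun [set: borel X] h by exact: continuous_borel_measurable.
have sqle (a b : R) : (a + b) ^+ 2 <= 2 * (a ^+ 2 + b ^+ 2).
  by have := sqr_ge0 (a - b); lra.
have h2 : L2 mu h.
  have mf2 := L2_sqr f2; have mg2 := L2_sqr g2.
  have f2' : L2 mu (fun x => c1 * `|f x|).
    apply: (L2_dominated (c := c1) _ f2).
      by apply: measurable_funM => //; apply: measurableT_comp => //; exact: L2_measurable f2.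
    by move=> x; rewrite normrM normr_id ger0_norm.
  have g2' : L2 mu (fun x => `|g x|).
    apply: (L2_dominated (c := 1) _ g2).
      by apply: measurableT_comp => //; exact: L2_measurable g2.
    by move=> x; rewrite normr_id mul1r.
  apply: (L2_dominated (c := 1) mh (L2_lin c2 g2' f2')) => x.
  rewrite mul1r [leRHS]ger0_norm ?addr_ge0 ?mulr_ge0// addrC; exact: hle.
split; last first.
  split=> //; apply: (@subclosed_compact _ _ (closure [set x | f x != 0] `|` closure [set x | g x != 0])).
  - exact: closed_closure.
  - exact: compactU.
  rewrite -closureU; apply: closureS => x /= hx.
  have [fx|] := eqVneq (f x) 0; last by left.
  have [gx|] := eqVneq (g x) 0; last by right.
  by move: hx; rewrite fgh// eqxx.
have S0 : 0 <= 2 * c1 ^+ 2 * form f f + 2 * c2 ^+ 2 * form g g.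
  by rewrite addr_ge0// mulr_ge0 ?(si_ge0 Esi)// mulr_ge0// sqr_ge0.
apply: (dom_of_bounded P_semigroup P_conservative P_associated h2 S0) => t t0.
apply: (@le_trans _ _ (2 * c1 ^+ 2 * Et t f f + 2 * c2 ^+ 2 * Et t g g)); last first.
  by apply: lerD; rewrite ler_wpM2l ?mulr_ge0 ?sqr_ge0//; exact: approx_form_le_form.
rewrite !(approx_form_sqE P_semigroup P_conservative t0)//.
have if2 := L2_joint_diff_integrable P_semigroup P_conservative t0 f2.
have ig2 := L2_joint_diff_integrable P_semigroup P_conservative t0 g2.
have ih2 := L2_joint_diff_integrable P_semigroup P_conservative t0 h2.
rewrite mulrCA [X in _ <= _ + X]mulrCA -mulrDr ler_wpM2l ?invr_ge0 ?mulr_ge0 ?(ltW t0)//.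
have if3 := integrableZl measurableT (2 * c1 ^+ 2) if2.
have ig3 := integrableZl measurableT (2 * c2 ^+ 2) ig2.
rewrite -!RintegralZl// -RintegralD//.
apply: le_Rintegral => //.
- by have := integrableD measurableT if3 ig3; apply: eq_integrable.
move=> [x y] _ /=; apply: (@le_trans _ _ ((c1 * `|f x - f y| + c2 * `|g x - g y|) ^+ 2)).
  by rewrite -[leLHS]real_normK ?num_real// ler_sqr ?nnegrE ?addr_ge0 ?mulr_ge0.
apply: le_trans (sqle _ _) _.
by rewrite !exprMn !real_normK ?num_real// mulrDr !mulrA.
Qed.

Lemma real_core_lipschitz (psi : R -> R) (c : R) f : real_core E f ->
  0 <= c -> psi 0 = 0 -> (forall a b, `|psi a - psi b| <= c * `|a - b|) ->
  real_core E (fun x => psi (f x)).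
Proof.
move=> fC c0 psi0 lip; have [fD [cf kf]] := fC.
apply: (real_core_dominated (c1 := c) (c2 := 0) fC fC) => //.
- move=> x; apply/cvgrPdist_le => e e0.
  have c1 : 0 < c + 1 by rewrite ltr_wpDl.
  have /cvgrPdist_le/(_ _ (divr_gt0 e0 c1)) := cf x.
  apply: filterS => y; rewrite ler_pdivlMr// => fxy.
  rewrite (le_trans (lip _ _))// (le_trans _ fxy)// mulrC ler_wpM2l// lerDl//.
- by move=> x ->.
- by move=> x; rewrite mul0r addr0; have := lip (f x) 0; rewrite psi0 !subr0.
- by move=> x y; rewrite mul0r addr0.
Qed.

Lemma real_core_mul f g : real_core E f -> real_core E g ->
  real_core E (fun x => f x * g x).
Proof.
move=> fC gC; have [M M0 fM] := core_bounded fC; have [N N0 gN] := core_bounded gC.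
have [_ [cf _]] := fC; have [_ [cg _]] := gC.
apply: (real_core_dominated (c1 := N) (c2 := M) fC gC) => //.
- by move=> x; apply: cvgM; [exact: cf|exact: cg].
- by move=> x ->; rewrite mul0r.
- move=> x; rewrite normrM; have := ler_wpM2l (normr_ge0 (f x)) (gN x).
  have : 0 <= M * `|g x| by rewrite mulr_ge0.
  by lra.
- move=> x y; have -> : f x * g x - f y * g y = (f x - f y) * g x + f y * (g x - g y) by ring.
  rewrite (le_trans (ler_normD _ _))// !normrM lerD//.
    by rewrite mulrC ler_wpM2r.
  by rewrite ler_wpM2r.
Qed.

End core_algebra.

(** * Limits of Pi_t on functions supported away from the diagonal *)

Section off_diagonal_limit.
Context (R : realType) (X : pmetricType R).
Variables (mu : {measure set borel X -> \bar R}) (E : dirichlet_form mu).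
Variable P : R -> R.-spker borel X ~> borel X.
Variable J : {measure set (borel X * borel X) -> \bar R}.
Hypothesis X_separable : separable_space X.
Hypothesis P_semigroup : symmetric_markov_semigroup mu P.
Hypothesis P_conservative : conservative mu P.
Hypothesis P_associated : associated E P.
Hypothesis J_jump : is_jump_measure E J.
Implicit Types f g h : X -> R.
Local Notation Et t := (approx_form mu P t).
Local Notation jm t := (joint_measure mu (P t)).
Local Notation form := (Defs.form E).
Local Notation od := (~` @diag X : set (borel X * borel X)).
Let Esi := form_semi_inner E.
Let mod_ : measurable od := offdiag_measurable X_separable.

Definition real_core_cst f : Prop := exists c : R, real_core E (fun x => f x - c).

Lemma real_core_cst_core f : real_core E f -> real_core_cst f.
Proof. by move=> fC; exists 0; under eq_fun do rewrite subr0. Qed.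

Lemma real_core_cst_cst (c : R) : real_core_cst (fun=> c).
Proof. by exists c; under eq_fun do rewrite subrr; exact: real_core0. Qed.

Lemma real_core_cst_lin c f g : real_core_cst f -> real_core_cst g ->
  real_core_cst (fun x => c * f x + g x).
Proof.
move=> [a fC] [b gC]; exists (c * a + b).
have := real_core_lin c fC gC; congr real_core.
by apply/funext => x; ring.
Qed.

Lemma real_core_mulr f g : real_core E f -> real_core_cst g ->
  real_core E (fun x => f x * g x).
Proof.
move=> fC [b gC].
have := real_core_lin b fC (real_core_mul P_semigroup P_conservative P_associated fC gC).
by congr real_core; apply/funext => x; ring.
Qed.

Lemma real_core_cst_mul f g : real_core_cst f -> real_core_cst g ->
  real_core_cst (fun x => f x * g x).
Proof.
move=> [a fC] gC; have [b gC'] := gC.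
have := real_core_lin a gC' (real_core_mulr fC gC) => h; exists (a * b); move: h.
by congr real_core; apply/funext => x; ring.
Qed.

(** If f - a is in the core, then s |-> psi(s + a) - psi(a) is a Lipschitz map fixing 0, to which
    the stability of the core applies. *)
Lemma real_core_cst_lipschitz (psi : R -> R) (c : R) f : real_core_cst f ->
  0 <= c -> (forall a b, `|psi a - psi b| <= c * `|a - b|) ->
  real_core_cst (fun x => psi (f x)).
Proof.
move=> [a fC] c0 lip; exists (psi a).
have := real_core_lipschitz P_semigroup P_conservative P_associated
   (psi := fun s => psi (s + a) - psi a) fC c0.
rewrite add0r subrr => /(_ erefl) h.
have -> : (fun x => psi (f x) - psi a) = (fun x => psi (f x - a + a) - psi a).
  by apply/funext => x; rewrite subrK.
apply: h => b d; rewrite (_ : psi (b + a) - psi a - (psi (d + a) - psi a) =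
  psi (b + a) - psi (d + a)); last by ring.
by rewrite (le_trans (lip _ _))// (_ : b + a - (d + a) = b - d)//; ring.
Qed.

Lemma real_core_cst_continuous f : real_core_cst f -> continuous f.
Proof.
move=> [c [_ [cf _]]] x.
have -> : f = (fun x => f x - c) + cst c by apply/funext => y; rewrite fctE subrK.
by apply: cvgD; [exact: cf|exact: cvg_cst].
Qed.

Lemma real_core_cst_measurable f : real_core_cst f -> measurable_fun [set: borel X] f.
Proof. by move/real_core_cst_continuous; exact: continuous_borel_measurable. Qed.

Lemma real_core_cst_bounded f : real_core_cst f -> exists2 M : R, 0 <= M & forall x, `|f x| <= M.
Proof.
move=> [c fC]; have [M M0 fM] := core_bounded fC.
exists (M + `|c|) => [|x]; first by rewrite addr_ge0.
by rewrite -[f x](subrK c) (le_trans (ler_normD _ _))// lerD.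
Qed.

Definition separated f g : Prop :=
  closure [set x | f x != 0] `&` closure [set x | g x != 0] = set0.

Lemma separated_sym f g : separated f g -> separated g f.
Proof. by rewrite /separated setIC. Qed.

Lemma separated_mul0 f g x : separated f g -> f x * g x = 0.
Proof.
move=> fg; apply/eqP; apply: contraT; rewrite mulf_eq0 negb_or => /andP[fx gx].
suff : set0 x by [].
by rewrite -fg; split; exact: subset_closure.
Qed.

Lemma Rintegral_jump_swap (h : X * X -> R) :
  measurable_fun [set: borel X * borel X] h ->
  J.-integrable od (fun z => (h z)%:E) ->
  J.-integrable od (fun z => (h (z.2, z.1))%:E) /\
  \int[J]_(z in od) h (z.2, z.1) = \int[J]_(z in od) h z.
Proof.
move=> mh ih; have [_ Jsym _ _] := J_jump.
pose sw (z : borel X * borel X) : borel X * borel X := (z.2, z.1).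
have msw : measurable_fun setT sw by exact/measurable_fun_pair.
have sw_od : sw @^-1` od = od.
  by apply/seteqP; split => -[x y] /= xy e; apply: xy.
have mh' : measurable_fun [set: borel X * borel X] (fun z => (h (z.2, z.1))).
  exact: (measurableT_comp mh msw).
have pushJ (k : X * X -> \bar R) :
    (\int[pushforward J sw]_(z in od) k z = \int[J]_(z in od) k z)%E.
  by apply: eq_measure_integral => A mA Aod; exact: Jsym.
have ih' : J.-integrable od (fun z => (h (z.2, z.1))%:E).
  have [mi fi] := integrableP _ _ _ ih.
  apply/integrableP; split; first by apply/measurable_EFinP; exact: measurable_funTS.
  move: fi; rewrite -pushJ.
  have -> := ge0_integral_pushforward msw J (D := od) (f := fun z => `|(h z)%:E|%E) mod_.
  - by rewrite sw_od.
  - by apply: measurableT_comp => //; exact/measurable_EFinP/measurable_funTS.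
  - by move=> z _; exact: abse_ge0.
split=> //; congr fine; rewrite -[RHS]pushJ.
have -> := integral_pushforward msw (mu := J) (D := od) (f := fun z => (h z)%:E).
- by rewrite sw_od.
- exact/measurable_EFinP.
- by rewrite sw_od.
- exact: mod_.
Qed.

Lemma jump_diff_integrable f g : real_core E f -> real_core E g ->
  J.-integrable od (fun z => ((f z.1 - f z.2) * (g z.1 - g z.2))%:E).
Proof.
move=> fC gC; have [_ _ Jint _] := J_jump.
have mf := core_measurable fC; have mg := core_measurable gC.
apply: (@le_integrable _ _ _ _ _ mod_ _ (fun z : borel X * borel X =>
  ((f z.1 - f z.2) ^+ 2 + (g z.1 - g z.2) ^+ 2)%:E)).
- apply/measurable_EFinP/measurable_funTS/measurable_funM; apply: measurable_funB;
    by [exact: (measurable_fst_comp mf)|exact: (measurable_snd_comp mf)|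
        exact: (measurable_fst_comp mg)|exact: (measurable_snd_comp mg)].
- move=> z _; rewrite lee_fin [leRHS]ger0_norm ?addr_ge0 ?sqr_ge0//.
  rewrite normrM; set a := f _ - _; set b := g _ - _.
  rewrite -[a ^+ 2]real_normK ?num_real// -[b ^+ 2]real_normK ?num_real//.
  by have := sqr_ge0 (`|a| - `|b|); have := normr_ge0 a; have := normr_ge0 b; nra.
- by have := integrableD mod_ (Jint f fC) (Jint g gC); apply: eq_integrable.
Qed.

(** Pi_t / 2 tends to J when tested on h; since [jm t] is t Pi_t, the factor is (2 t)^-1.
    Integrability is included so that the property is stable under linear combinations. *)
Definition tensor_limit (h : X * X -> R) : Prop :=
  [/\ measurable_fun [set: borel X * borel X] h,
      forall t, 0 < t -> (jm t).-integrable setT (fun z => (h z)%:E),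
      J.-integrable od (fun z => (h z)%:E) &
      (2 * t)^-1 * \int[jm t]_z h z @[t --> 0^'+] --> \int[J]_(z in od) h z].

(** As f g = 0, the product of the increments of f and g is -(f(x) g(y) + f(y) g(x)), so E_t(f, g0)
    and E(f, g0) are multiples of the integrals of f(x) g(y), and the convergence of the forms is
    the claim. Both orders of the factors are stated because either one may be the compactly
    supported factor. *)
Lemma tensor_limit_core f g : real_core E f -> real_core_cst g ->
  separated f g -> tensor_limit (fun z => f z.1 * g z.2) /\
  tensor_limit (fun z => g z.1 * f z.2).
Proof.
move=> fC gC fg; have [c g0C] := gC; pose g0 x := g x - c.
have fD : dom E f by case: fC. have g0D : dom E g0 by case: g0C.
have f2 : L2 mu f by exact: dom_L2 fD.
have g2 : L2 mu g0 by exact: dom_L2 g0D.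
have mf := core_measurable fC; have mg := real_core_cst_measurable gC.
have gfz x : g x * f x = 0 by rewrite mulrC separated_mul0.
have diffE x y : (f x - f y) * (g0 x - g0 y) = - (f x * g y + f y * g x).
  have := separated_mul0 x fg; have := separated_mul0 y fg; rewrite /g0 => ey ex.
  transitivity (f x * g x + f y * g y - (f x * g y + f y * g x)); first by ring.
  by rewrite ex ey addr0 sub0r.
(* At most one of f(x) g(y) and f(y) g(x) is nonzero. *)
have dom_ x y : `|f x * g y| <= `|(f x - f y) * (g0 x - g0 y)|.
  rewrite diffE normrN; have [fx|fx] := eqVneq (f x) 0.
    by rewrite fx mul0r normr0.
  suff gx : g x = 0 by rewrite gx mulr0 addr0.
  by move/eqP: (separated_mul0 x fg); rewrite mulf_eq0 (negbTE fx) => /eqP.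
have m1 : measurable_fun [set: borel X * borel X] (fun z => f z.1 * g z.2).
  by apply: measurable_funM; [exact: (measurable_fst_comp mf)|exact: (measurable_snd_comp mg)].
have m2 : measurable_fun [set: borel X * borel X] (fun z => g z.1 * f z.2).
  by apply: measurable_funM; [exact: (measurable_fst_comp mg)|exact: (measurable_snd_comp mf)].
have iP t : 0 < t -> (jm t).-integrable setT (fun z => (f z.1 * g z.2)%:E).
  move=> t0; have k_sym := semigroup_sym P_semigroup t0.
  have i1 := L2_joint_diff_integrable P_semigroup P_conservative t0 f2.
  have i2 := L2_joint_diff_integrable P_semigroup P_conservative t0 g2.
  apply: (@le_integrable _ _ _ _ _ measurableT _ (fun z : borel X * borel X =>
    ((f z.1 - f z.2) ^+ 2 + (g0 z.1 - g0 z.2) ^+ 2)%:E)).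
  - exact/measurable_EFinP.
  - move=> z _; rewrite lee_fin [leRHS]ger0_norm ?addr_ge0 ?sqr_ge0//.
    apply: (le_trans (dom_ _ _)); rewrite normrM; set a := f _ - _; set b := g0 _ - _.
    rewrite -[a ^+ 2]real_normK ?num_real// -[b ^+ 2]real_normK ?num_real//.
    by have := sqr_ge0 (`|a| - `|b|); have := normr_ge0 a; have := normr_ge0 b; nra.
  - by have := integrableD measurableT i1 i2; apply: eq_integrable.
have iP' t : 0 < t -> (jm t).-integrable setT (fun z => (g z.1 * f z.2)%:E).
  move=> t0; have k_sym := semigroup_sym P_semigroup t0.
  apply: (integrable_joint_swap k_sym) => //.
  by have := iP t t0; apply: eq_integrable => // z _; rewrite mulrC.
have eP t : 0 < t -> \int[jm t]_z (g z.1 * f z.2) = \int[jm t]_z (f z.1 * g z.2).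
  move=> t0; have k_sym := semigroup_sym P_semigroup t0.
  rewrite -(Rintegral_joint_swap k_sym)//.
    by apply: eq_Rintegral => z _; rewrite mulrC.
  by have := iP t t0; apply: eq_integrable => // z _; rewrite mulrC.
have iJ : J.-integrable od (fun z => (f z.1 * g z.2)%:E).
  apply: le_integrable (jump_diff_integrable fC g0C) => //.
  - by apply/measurable_EFinP; exact: measurable_funTS.
  - by move=> z _; rewrite lee_fin; exact: dom_.
have [iJ' eJ'] := Rintegral_jump_swap m1 iJ.
have {}iJ' : J.-integrable od (fun z => (g z.1 * f z.2)%:E).
  by apply: eq_integrable iJ' => // z _; rewrite /= mulrC.
have {}eJ' : \int[J]_(z in od) (g z.1 * f z.2) = \int[J]_(z in od) (f z.1 * g z.2).
  by rewrite -eJ'; apply: eq_Rintegral => z _ /=; rewrite mulrC.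
(* On the complement of the support of g, an open neighbourhood of the support of f, [g0] is the
   constant -c, so the strongly local part of E(f, g0) vanishes. *)
have formE : form f g0 = - (2 * \int[J]_(z in od) (f z.1 * g z.2)).
  have [_ _ _ [Ec [_ Ec_local EcE]]] := J_jump.
  rewrite EcE// Ec_local//; last first.
    exists (~` closure [set x | g x != 0]); split.
    - exact/closed_openC/closed_closure.
    - by rewrite -disjoints_subset.
    - exists (- c) => x xg; rewrite /g0; suff -> : g x = 0 by rewrite sub0r.
      by apply/eqP; apply: contraT => gx; exfalso; apply: xg; exact: subset_closure.
  rewrite add0r.
  transitivity (\int[J]_(z in od) (-1 * (f z.1 * g z.2 + g z.1 * f z.2))).
    by apply: eq_Rintegral => z _; rewrite diffE mulN1r [f z.2 * _]mulrC.
  have iD : J.-integrable od (fun z => (f z.1 * g z.2 + g z.1 * f z.2)%:E).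
    by have := integrableD mod_ iJ iJ'; apply: eq_integrable.
  rewrite RintegralZl//.
  by rewrite RintegralD// eJ' mulN1r; congr (- _); ring.
have lim : (2 * t)^-1 * \int[jm t]_z (f z.1 * g z.2) @[t --> 0^'+] -->
    \int[J]_(z in od) (f z.1 * g z.2).
  have := approx_form_cvg P_semigroup P_conservative P_associated fD g0D.
  rewrite formE => h.
  have {h} : - 2^-1 * Et t f g0 @[t --> 0^'+] --> - 2^-1 * - (2 * \int[J]_(z in od) (f z.1 * g z.2)).
    by apply: cvgM => //; exact: cvg_cst.
  rewrite mulrNN mulrA mulVf// mul1r; apply: cvg_trans.
  apply: near_eq_cvg; apply: filterS (nbhs_right_gt 0) => t t0.
  rewrite (approx_formE P_semigroup P_conservative t0)//.
  rewrite (_ : \int[jm t]_z ((f z.1 - f z.2) * (g0 z.1 - g0 z.2)) =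
    \int[jm t]_z (-1 * (f z.1 * g z.2 + g z.1 * f z.2))); last first.
    by apply: eq_Rintegral => z _; rewrite diffE mulN1r [f z.2 * _]mulrC.
  have i1 := iP t t0; have i2 := iP' t t0.
  have iD : (jm t).-integrable setT (fun z => (f z.1 * g z.2 + g z.1 * f z.2)%:E).
    by have := integrableD measurableT i1 i2; apply: eq_integrable.
  rewrite RintegralZl//.
  rewrite RintegralD// eP//; field; by rewrite gt_eqF.
split; first by split.
split; [exact: m2|exact: iP'|exact: iJ'|].
rewrite eJ'; apply: cvg_trans lim.
apply: near_eq_cvg; apply: filterS (nbhs_right_gt 0) => t t0.
by rewrite eP.
Qed.

End off_diagonal_limit.

(** * Moduli of complex numbers *)

Section complex_modulus.
Context (R : realType).
Implicit Types a b z : R[i].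
Local Notation Re := complex.Re.
Local Notation Im := complex.Im.
Local Notation nc := ComplexField.Normc.normc.

Lemma ReD a b : Re (a + b) = Re a + Re b. Proof. by case: a; case: b. Qed.
Lemma ImD a b : Im (a + b) = Im a + Im b. Proof. by case: a; case: b. Qed.
Lemma ReN a : Re (- a) = - Re a. Proof. by case: a. Qed.
Lemma ImN a : Im (- a) = - Im a. Proof. by case: a. Qed.
Lemma ReB a b : Re (a - b) = Re a - Re b. Proof. by rewrite ReD ReN. Qed.
Lemma ImB a b : Im (a - b) = Im a - Im b. Proof. by rewrite ImD ImN. Qed.
Lemma ReM a b : Re (a * b) = Re a * Re b - Im a * Im b.
Proof. by case: a; case: b. Qed.
Lemma ImM a b : Im (a * b) = Re a * Im b + Im a * Re b.
Proof. by case: a => a1 a2; case: b => b1 b2 /=; ring. Qed.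
Lemma ReJ a : Re a^* = Re a. Proof. by case: a. Qed.
Lemma ImJ a : Im a^* = - Im a. Proof. by case: a. Qed.

Lemma eqC a b : Re a = Re b -> Im a = Im b -> a = b.
Proof. by case: a => a1 a2; case: b => b1 b2 /= -> ->. Qed.

Lemma sqmodE z : sqmod z = Re z ^+ 2 + Im z ^+ 2.
Proof. by case: z => a b; rewrite /sqmod/= sqr_sqrtr// addr_ge0 ?sqr_ge0. Qed.

Lemma sqmod_ge0 z : 0 <= sqmod z. Proof. exact: sqr_ge0. Qed.

Lemma nc_ge0 z : 0 <= nc z. Proof. by case: z => a b; exact: sqrtr_ge0. Qed.

Lemma sqmodM a b : sqmod (a * b) = sqmod a * sqmod b.
Proof. by rewrite /sqmod ComplexField.Normc.normcM exprMn. Qed.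

Lemma sqmodN z : sqmod (- z) = sqmod z.
Proof. by rewrite !sqmodE ReN ImN !sqrrN. Qed.

Lemma sqmodJ z : sqmod z^* = sqmod z.
Proof. by rewrite !sqmodE ReJ ImJ sqrrN. Qed.

Lemma sqmod_real (r : R) : sqmod r%:C = r ^+ 2.
Proof. by rewrite sqmodE/= expr0n addr0. Qed.

Lemma sqmod_eq0 z : (sqmod z == 0) = (z == 0).
Proof.
case: z => a b; rewrite sqmodE paddr_eq0 ?sqr_ge0// !sqrf_eq0.
by rewrite eq_complex/=.
Qed.

Lemma Re_mulJ a b : Re (a * b^*) = Re a * Re b + Im a * Im b.
Proof. by rewrite ReM ReJ ImJ mulrN opprK. Qed.

Lemma sqmod_mulJ z : sqmod z = Re (z * z^*).
Proof. by rewrite Re_mulJ sqmodE !expr2. Qed.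

Lemma nc_real (r : R) : nc r%:C = `|r|.
Proof. by rewrite /= expr0n addr0 sqrtr_sqr. Qed.

Lemma nc_Re z : `|Re z| <= nc z.
Proof.
by case: z => a b /=; rewrite -sqrtr_sqr ler_wsqrtr// lerDl sqr_ge0.
Qed.

Lemma nc_Im z : `|Im z| <= nc z.
Proof.
by case: z => a b /=; rewrite -sqrtr_sqr ler_wsqrtr// lerDr sqr_ge0.
Qed.

Lemma normC_nc z : `|z| = (nc z)%:C. Proof. by rewrite normc_def; case: z. Qed.

Lemma ncD a b : nc (a + b) <= nc a + nc b.
Proof. by rewrite -lecR -normC_nc rmorphD/= -!normC_nc; exact: ler_normD. Qed.

Lemma ncN a : nc (- a) = nc a.
Proof. by apply: (@complexI R); rewrite -!normC_nc normrN. Qed.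

Lemma nc_ReIm z : nc z <= `|Re z| + `|Im z|.
Proof.
rewrite {1}(complexE z) (le_trans (ncD _ _))// nc_real lerD//.
rewrite ComplexField.Normc.normcM nc_real (_ : nc 'i%C = 1) ?mul1r//.
by rewrite /= expr0n expr1n add0r sqrtr1.
Qed.

(** Follows from 2 |a| |b| <= s |a|^2 + |b|^2 / s. For small s it compares squares up to a factor
    close to 1. *)
Lemma sqmodD_le (s : R) a b : 0 < s ->
  sqmod (a + b) <= (1 + s) * sqmod a + (1 + s^-1) * sqmod b.
Proof.
move=> s0; rewrite /sqmod; have := ncD a b; have := nc_ge0 (a + b).
have := nc_ge0 a; have := nc_ge0 b.
move: (nc a) (nc b) (nc (a + b)) => x y w y0 x0 w0 wxy.
apply: (@le_trans _ _ ((x + y) ^+ 2)); first by rewrite ler_sqr ?nnegrE ?addr_ge0.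
have : 0 <= s^-1 * (s * x - y) ^+ 2 by rewrite mulr_ge0 ?invr_ge0 ?(ltW s0)// sqr_ge0.
have -> : s^-1 * (s * x - y) ^+ 2 = s * x ^+ 2 - 2 * x * y + s^-1 * y ^+ 2.
  by field; rewrite gt_eqF.
by move: (s^-1) => u; nra.
Qed.

Lemma sqmodD_le2 a b : sqmod (a + b) <= 2 * sqmod a + 2 * sqmod b.
Proof. by have := sqmodD_le a b ltr01; rewrite invr1. Qed.

End complex_modulus.

(** * Tensors and the algebra of 1-forms *)

Section complex_tensors.
Context (R : realType) (X : pmetricType R).
Variables (mu : {measure set borel X -> \bar R}) (E : dirichlet_form mu).
Variable P : R -> R.-spker borel X ~> borel X.
Hypothesis P_semigroup : symmetric_markov_semigroup mu P.
Hypothesis P_conservative : conservative mu P.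
Hypothesis P_associated : associated E P.
Local Notation C := R[i].
Local Notation Re := complex.Re.
Local Notation Im := complex.Im.
Local Notation nc := ComplexField.Normc.normc.
Implicit Types (f g : X -> C) (w : X * X -> C).

Lemma core_cstP f : core_cst E f <->
  real_core_cst E (fun x => Re (f x)) /\ real_core_cst E (fun x => Im (f x)).
Proof.
split=> [[f0 [[rf imf] [c ->]]]|[[a rf] [b imf]]].
  split.
  - by exists (Re c); under eq_fun do rewrite ReD addrK.
  - by exists (Im c); under eq_fun do rewrite ImD addrK.
exists (fun x => f x - (a +i* b)); split; last first.
  by exists (a +i* b); apply/funext => x; rewrite subrK.
by split; [under eq_fun do rewrite ReB|under eq_fun do rewrite ImB].
Qed.

Lemma core_core_cst f : core E f -> core_cst E f.
Proof. by move=> fC; exists f; split=> //; exists 0; apply/funext => x; rewrite addr0. Qed.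

Lemma core_cst_cst (c : C) : core_cst E (fun=> c).
Proof. by apply/core_cstP; split; exact: real_core_cst_cst. Qed.

Lemma real_core_cstN (f : X -> R) : real_core_cst E f -> real_core_cst E (fun x => - f x).
Proof.
move=> fC; have := real_core_cst_lin (-1) fC (real_core_cst_cst E 0).
by congr real_core_cst; apply/funext => x; rewrite mulN1r addr0.
Qed.

Lemma real_core_cstD (f g : X -> R) : real_core_cst E f -> real_core_cst E g ->
  real_core_cst E (fun x => f x + g x).
Proof.
move=> fC gC; have := real_core_cst_lin 1 fC gC.
by congr real_core_cst; apply/funext => x; rewrite mul1r.
Qed.

Lemma core_cstM f g : core_cst E f -> core_cst E g ->
  core_cst E (fun x => f x * g x).
Proof.
move=> /core_cstP[fr fi] /core_cstP[gr gi].
have M := real_core_cst_mul P_semigroup P_conservative P_associated.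
apply/core_cstP; split.
- under eq_fun do rewrite ReM; apply: real_core_cstD; first exact: M.
  by apply: real_core_cstN; exact: M.
- by under eq_fun do rewrite ImM; apply: real_core_cstD; exact: M.
Qed.

Lemma core_cstD f g : core_cst E f -> core_cst E g ->
  core_cst E (fun x => f x + g x).
Proof.
move=> /core_cstP[fr fi] /core_cstP[gr gi]; apply/core_cstP; split.
- by under eq_fun do rewrite ReD; exact: real_core_cstD.
- by under eq_fun do rewrite ImD; exact: real_core_cstD.
Qed.

Lemma core_cstJ f : core_cst E f -> core_cst E (fun x => (f x)^*).
Proof.
move=> /core_cstP[fr fi]; apply/core_cstP; split.
- by under eq_fun do rewrite ReJ.
- by under eq_fun do rewrite ImJ; exact: real_core_cstN.
Qed.

Lemma core_mulr f g : core E f -> core_cst E g -> core E (fun x => f x * g x).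
Proof.
move=> [fr fi] /core_cstP[gr gi].
have M := real_core_mulr P_semigroup P_conservative P_associated.
split.
- under eq_fun do rewrite ReM; have := real_core_lin (-1) (M _ _ fi gi) (M _ _ fr gr).
  by congr real_core; apply/funext => x; rewrite mulN1r addrC.
- under eq_fun do rewrite ImM; have := real_core_lin 1 (M _ _ fr gi) (M _ _ fi gr).
  by congr real_core; apply/funext => x; rewrite mul1r.
Qed.

Lemma core_cst_bounded f : core_cst E f -> exists2 M : R, 0 <= M & forall x, nc (f x) <= M.
Proof.
move=> /core_cstP[/real_core_cst_bounded[M M0 fM] /real_core_cst_bounded[N N0 fN]].
exists (M + N) => [|x]; first exact: addr_ge0.
by rewrite (le_trans (nc_ReIm _))// lerD.
Qed.

Inductive tensor : (X * X -> C) -> Prop :=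
| tensor_prod f g : core_cst E f -> core_cst E g ->
    tensor (fun z => f z.1 * g z.2)
| tensor_add w1 w2 : tensor w1 -> tensor w2 -> tensor (fun z => w1 z + w2 z).

Definition cseparated f g : Prop :=
  closure [set x | f x != 0] `&` closure [set x | g x != 0] = set0.

(** One factor has to be in the core: the limit of Pi_t on the product is read off from the form,
    whose strong locality concerns core functions. *)
Inductive od_tensor : (X * X -> C) -> Prop :=
| od_tensor_prod f g : core_cst E f -> core_cst E g -> core E f \/ core E g ->
    cseparated f g -> od_tensor (fun z => f z.1 * g z.2)
| od_tensor_add w1 w2 : od_tensor w1 -> od_tensor w2 ->
    od_tensor (fun z => w1 z + w2 z).

Lemma cseparated_sub f g f' g' : cseparated f g ->
  (forall x, f x = 0 -> f' x = 0) -> (forall x, g x = 0 -> g' x = 0) ->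
  cseparated f' g'.
Proof.
rewrite /cseparated -!subset0 => fg ff gg; apply: subset_trans fg.
by apply: setISS; apply: closureS => x /=; apply: contra_neq; [exact: ff|exact: gg].
Qed.

Lemma tensorM w1 w2 : tensor w1 -> tensor w2 -> tensor (fun z => w1 z * w2 z).
Proof.
move=> t1; elim: t1 w2 => [f g fC gC w2|u v _ IHu _ IHv w2 t2]; last first.
  by under eq_fun do rewrite mulrDl; apply: tensor_add; [exact: IHu|exact: IHv].
elim=> [f' g' f'C g'C|u v _ IHu _ IHv]; last first.
  by under eq_fun do rewrite mulrDr; exact: tensor_add.
under eq_fun do rewrite mulrACA.
exact: (tensor_prod (core_cstM fC f'C) (core_cstM gC g'C)).
Qed.

Lemma tensor_cst (c : C) : tensor (fun=> c).
Proof.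
have := tensor_prod (core_cst_cst c) (core_cst_cst 1).
by congr tensor; apply/funext => z; rewrite mulr1.
Qed.

Lemma tensor_fst f : core_cst E f -> tensor (fun z => f z.1).
Proof.
move=> fC; have := tensor_prod fC (core_cst_cst 1).
by congr tensor; apply/funext => z; rewrite mulr1.
Qed.

Lemma tensor_snd f : core_cst E f -> tensor (fun z => f z.2).
Proof.
move=> fC; have := tensor_prod (core_cst_cst 1) fC.
by congr tensor; apply/funext => z; rewrite mul1r.
Qed.

Lemma tensorZ (c : C) w : tensor w -> tensor (fun z => c * w z).
Proof. by move=> tw; exact: (tensorM (tensor_cst c) tw). Qed.

Lemma tensorB w1 w2 : tensor w1 -> tensor w2 -> tensor (fun z => w1 z - w2 z).
Proof.
move=> t1 t2; have := tensor_add t1 (tensorZ (-1) t2).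
by congr tensor; apply/funext => z; rewrite mulN1r.
Qed.

Lemma tensorJ w : tensor w -> tensor (fun z => (w z)^*).
Proof.
elim=> [f g fC gC|u v _ IHu _ IHv].
- under eq_fun do rewrite rmorphM; exact: (tensor_prod (core_cstJ fC) (core_cstJ gC)).
- by under eq_fun do rewrite rmorphD; exact: tensor_add.
Qed.

Lemma tensor_bounded w : tensor w -> exists2 M : R, 0 <= M & forall z, nc (w z) <= M.
Proof.
elim=> [f g /core_cst_bounded[M M0 fM] /core_cst_bounded[N N0 gN]|u v _ [M M0 uM] _ [N N0 vN]].
- exists (M * N) => [|z]; first exact: mulr_ge0.
  by rewrite ComplexField.Normc.normcM ler_pM ?nc_ge0.
- exists (M + N) => [|z]; first exact: addr_ge0.
  by rewrite (le_trans (ncD _ _))// lerD.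
Qed.

Lemma tensor_measurable w : tensor w ->
  measurable_fun [set: borel X * borel X] (fun z => Re (w z)) /\
  measurable_fun [set: borel X * borel X] (fun z => Im (w z)).
Proof.
elim=> [f g /core_cstP[fr fi] /core_cstP[gr gi]|u v _ [ur ui] _ [vr vi]].
  have m1 := real_core_cst_measurable fr; have m2 := real_core_cst_measurable fi.
  have m3 := real_core_cst_measurable gr; have m4 := real_core_cst_measurable gi.
  have n1 := measurable_fst_comp m1; have n2 := measurable_fst_comp m2.
  have n3 := measurable_snd_comp m3; have n4 := measurable_snd_comp m4.
  split.
  - by under eq_fun do rewrite ReM; apply: measurable_funB; exact: measurable_funM.
  - by under eq_fun do rewrite ImM; apply: measurable_funD; exact: measurable_funM.
split.
- by under eq_fun do rewrite ReD; exact: measurable_funD.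
- by under eq_fun do rewrite ImD; exact: measurable_funD.
Qed.

Lemma od_tensor_tensor w : od_tensor w -> tensor w.
Proof. by elim=> [f g fC gC _ _|u v _ IHu _ IHv]; [exact: tensor_prod|exact: tensor_add]. Qed.

Lemma od_tensorMl w1 w2 : tensor w1 -> od_tensor w2 -> od_tensor (fun z => w1 z * w2 z).
Proof.
move=> t1; elim: t1 w2 => [f g fC gC w2|u v _ IHu _ IHv w2 t2]; last first.
  by under eq_fun do rewrite mulrDl; apply: od_tensor_add; [exact: IHu|exact: IHv].
elim=> [f' g' f'C g'C c' sep|u v _ IHu _ IHv]; last first.
  by under eq_fun do rewrite mulrDr; exact: od_tensor_add.
under eq_fun do rewrite mulrACA [f _ * _]mulrC [g _ * _]mulrC.
apply: (od_tensor_prod (core_cstM f'C fC) (core_cstM g'C gC)).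
- by case: c' => [f'0|g'0]; [left|right]; exact: core_mulr.
- by apply: (cseparated_sub sep) => x ->; rewrite mul0r.
Qed.

Lemma od_tensor_diag w x : od_tensor w -> w (x, x) = 0.
Proof.
elim=> [f g _ _ _ sep|u v _ /= -> _ /= ->]; last by rewrite addr0.
apply/eqP; apply: contraT => /=; rewrite mulf_eq0 negb_or => /andP[fx gx].
suff : set0 x by [].
by rewrite -sep; split; exact: subset_closure.
Qed.

Lemma Omega1_lin (c : C) w1 w2 : Omega1 E w1 -> Omega1 E w2 ->
  Omega1 E (fun z => c * w1 z + w2 z).
Proof.
move=> [n [a [f [g [fgC ->]]]]] [m [b [f' [g' [fgC' ->]]]]].
exists (n + m)%N, (fun k => match fintype.split k with inl i => c * a i | inr j => b j end),
  (fun k => match fintype.split k with inl i => f i | inr j => f' j end),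
  (fun k => match fintype.split k with inl i => g i | inr j => g' j end); split.
  by move=> k; case: (fintype.split k).
apply/funext => z; rewrite big_split_ord/= mulr_sumr; congr (_ + _).
- by apply: eq_bigr => i _; rewrite (unsplitK (inl i)) mulrA.
- by apply: eq_bigr => i _; rewrite (unsplitK (inr i)).
Qed.

Lemma Omega1_elem f g : core_cst E f -> core_cst E g -> Omega1 E (elem_form f g).
Proof.
move=> fC gC; exists 1%N, (fun=> 1), (fun=> f), (fun=> g); split => //.
by apply/funext => z; rewrite big_ord1 mul1r.
Qed.

Lemma Omega1_tensor w : Omega1 E w -> tensor w.
Proof.
move=> [n [c [f [g [fgC ->]]]]].
elim: n => [|n IHn] in c f g fgC *.
  by under eq_fun do rewrite big_ord0; exact: tensor_cst.
under eq_fun do rewrite big_ord_recl; apply: tensor_add.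
- have [f0 g0] := fgC ord0; apply: tensorZ; apply: (tensorM (tensor_snd g0)).
  by apply: tensorB; [exact: tensor_fst|exact: tensor_snd].
- exact: IHn.
Qed.

Lemma Omega1_diag w x : Omega1 E w -> w (x, x) = 0.
Proof.
move=> [n [c [f [g [_ ->]]]]]; rewrite big1// => k _.
by rewrite /elem_form/= subrr !mulr0.
Qed.

(** A tensor vanishing on the diagonal equals w(x, y) - w(y, y), and for w = f(x) g(y) this
    difference is g(y) (f(x) - f(y)). In this description, stability under conjugation and under
    multiplication by tensors is immediate. *)
Lemma Omega1P w : Omega1 E w <-> tensor w /\ forall x, w (x, x) = 0.
Proof.
split=> [wO|[tw w0]].
  by split=> [|x]; [exact: Omega1_tensor|exact: Omega1_diag].
suff : Omega1 E (fun z => w z - w (z.2, z.2)).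
  by congr Omega1; apply/funext => z; rewrite w0 subr0.
elim: tw {w0} => [f g fC gC|u v _ IHu _ IHv].
- have := Omega1_elem fC gC; congr Omega1; apply/funext => z.
  by rewrite /elem_form /=; ring.
- have := Omega1_lin 1 IHu IHv; congr Omega1; apply/funext => z.
  by rewrite mul1r; ring.
Qed.

Lemma Omega1_mul w1 w2 : tensor w1 -> Omega1 E w2 -> Omega1 E (fun z => w1 z * w2 z).
Proof.
move=> t1 /Omega1P[t2 w0]; apply/Omega1P; split; first exact: tensorM.
by move=> x; rewrite w0 mulr0.
Qed.

Lemma Omega1_od w : od_tensor w -> Omega1 E w.
Proof.
by move=> ow; apply/Omega1P; split => [|x]; [exact: od_tensor_tensor|exact: od_tensor_diag].
Qed.

End complex_tensors.

(** * Off-diagonal tensors and cutoffs *)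

Section off_diagonal_forms.
Context (R : realType) (X : pmetricType R).
Variables (mu : {measure set borel X -> \bar R}) (E : dirichlet_form mu).
Variable P : R -> R.-spker borel X ~> borel X.
Variable J : {measure set (borel X * borel X) -> \bar R}.
Hypothesis X_separable : separable_space X.
Hypothesis P_semigroup : symmetric_markov_semigroup mu P.
Hypothesis P_conservative : conservative mu P.
Hypothesis P_associated : associated E P.
Hypothesis J_jump : is_jump_measure E J.
Local Notation C := R[i].
Local Notation Re := complex.Re.
Local Notation Im := complex.Im.
Local Notation nc := ComplexField.Normc.normc.
Local Notation jm t := (joint_measure mu (P t)).
Local Notation od := (~` @diag X : set (borel X * borel X)).
Let mod_ : measurable od := offdiag_measurable X_separable.
Implicit Types (w : X * X -> C).

Lemma tensor_limit_lin (c : R) (h k : X * X -> R) : tensor_limit mu P J h ->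
  tensor_limit mu P J k -> tensor_limit mu P J (fun z => c * h z + k z).
Proof.
move=> [mh ih jh lh] [mk ik jk lk].
have jch : J.-integrable od (fun z => (c * h z)%:E).
  by have := integrableZl mod_ c jh; apply: eq_integrable.
have ich t : 0 < t -> (jm t).-integrable setT (fun z => (c * h z)%:E).
  by move=> t0; have := integrableZl measurableT c (ih t t0); apply: eq_integrable.
split.
- by apply: measurable_funD => //; exact: measurable_funM.
- move=> t t0; have := integrableD measurableT (ich t t0) (ik t t0).
  by apply: eq_integrable.
- by have := integrableD mod_ jch jk; apply: eq_integrable.
rewrite RintegralD// RintegralZl//.
have : c * ((2 * t)^-1 * \int[jm t]_z h z) + (2 * t)^-1 * \int[jm t]_z k z @[t --> 0^'+] -->
    c * \int[J]_(z in od) h z + \int[J]_(z in od) k z.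
  by apply: cvgD => //; apply: cvgM => //; exact: cvg_cst.
apply: cvg_trans; apply: near_eq_cvg; apply: filterS (nbhs_right_gt 0) => t t0.
have iht := ih t t0; have ikt := ik t t0; have icht := ich t t0.
by rewrite RintegralD// RintegralZl//; ring.
Qed.

Lemma od_tensor_limit w : od_tensor E w -> tensor_limit mu P J (fun z => Re (w z)).
Proof.
elim=> [f g fC gC fg sep|u v _ IHu _ IHv]; last first.
  under eq_fun do rewrite ReD.
  have := tensor_limit_lin 1 IHu IHv; congr tensor_limit.
  by apply/funext => z; rewrite mul1r.
have [/core_cstP[fr fi] /core_cstP[gr gi]] := (fC, gC).
have Re0 (h : X -> C) x : h x = 0 -> Re (h x) = 0 by move=> ->.
have Im0 (h : X -> C) x : h x = 0 -> Im (h x) = 0 by move=> ->.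
have seprr : separated (fun x => Re (f x)) (fun x => Re (g x)).
  rewrite /separated -subset0 -sep; apply: setISS; apply: closureS => x /=;
    by apply: contra_neq => ->.
have sepii : separated (fun x => Im (f x)) (fun x => Im (g x)).
  rewrite /separated -subset0 -sep; apply: setISS; apply: closureS => x /=;
    by apply: contra_neq => ->.
under eq_fun do rewrite ReM.
have L := tensor_limit_core X_separable P_semigroup P_conservative P_associated J_jump.
suff [t1 t2] : tensor_limit mu P J (fun z => Re (f z.1) * Re (g z.2)) /\
    tensor_limit mu P J (fun z => Im (f z.1) * Im (g z.2)).
  have := tensor_limit_lin (-1) t2 t1; congr tensor_limit.
  by apply/funext => z; rewrite mulN1r addrC.
case: fg => [[fr' fi']|[gr' gi']].
- by split; [exact: (L _ _ fr' gr seprr).1|exact: (L _ _ fi' gi sepii).1].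
- by split; [exact: (L _ _ gr' fr (separated_sym seprr)).2|
             exact: (L _ _ gi' fi (separated_sym sepii)).2].
Qed.

Lemma sqmod_measurable d (T : measurableType d) (D : set T) (w : T -> C) :
  measurable_fun D (fun z => Re (w z)) -> measurable_fun D (fun z => Im (w z)) ->
  measurable_fun D (fun z => sqmod (w z)).
Proof.
move=> mr mi; under eq_fun do rewrite sqmodE.
by apply: measurable_funD; exact: measurable_funX.
Qed.

Lemma half_Pi_sqnormE t w :
  measurable_fun [set: borel X * borel X] (fun z => sqmod (w z)) ->
  half_Pi_sqnorm mu P t w = ((2 * t)^-1%:E * \int[jm t]_z (sqmod (w z))%:E)%E.
Proof.
move=> mw; rewrite /half_Pi_sqnorm integral_joint//.
- by move=> z; rewrite lee_fin sqmod_ge0.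
- exact/measurable_EFinP.
Qed.

(** |w|^2 is w times a tensor, its conjugate, hence the real part of an off-diagonal tensor, for
    which the limit is known. *)
Lemma od_tensor_sqnorm w : od_tensor E w ->
  half_Pi_sqnorm mu P t w @[t --> 0^'+] --> jump_sqnorm J w /\
  (jump_sqnorm J w < +oo)%E.
Proof.
move=> ow; have tw := od_tensor_tensor ow; have [mr mi] := tensor_measurable tw.
have := od_tensor_limit (od_tensorMl P_semigroup P_conservative P_associated (tensorJ tw) ow).
under eq_fun do rewrite mulrC -sqmod_mulJ.
move=> [ms is_ js ls].
have Jfin : jump_sqnorm J w \is a fin_num by exact: integrable_fin_num.
split; last by rewrite -ge0_fin_numE// integral_ge0// => z _; rewrite lee_fin sqmod_ge0.
have e t : 0 < t -> half_Pi_sqnorm mu P t w =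
    ((2 * t)^-1 * \int[jm t]_z sqmod (w z))%:E.
  move=> t0; rewrite half_Pi_sqnormE// EFinM fineK//; apply: integrable_fin_num => //.
  exact: is_.
rewrite -(fineK Jfin); apply: cvg_EFin.
  by apply: filterS (nbhs_right_gt 0) => t t0; rewrite e.
apply: cvg_trans ls; apply: near_eq_cvg; apply: filterS (nbhs_right_gt 0) => t t0.
by rewrite /= e.
Qed.

(* The real functions by which forms are localized away from the diagonal. *)
Definition cutoff (kappa : X * X -> R) : Prop :=
  od_tensor E (fun z => (kappa z)%:C) /\ forall z, 0 <= kappa z <= 1.

Lemma cutoff0 : cutoff (fun=> 0).
Proof.
split=> [|z]; last by rewrite lexx ler01.
have c0 : core E (fun=> 0 : C) by split; exact: real_core0.
have := od_tensor_prod (core_core_cst c0) (core_core_cst c0) (or_introl c0).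
have -> : (fun z : X * X => (0 : C) * 0) = (fun=> 0%:C) by apply/funext => z; rewrite mul0r.
apply; rewrite /cseparated (_ : [set x | _] = set0) ?closure0 ?set0I//.
by apply/seteqP; split => x //=; rewrite eqxx.
Qed.

(** The witness satisfies 1 - k = (1 - k1) (1 - k2). The comparison is stated for 1 - k because this
    is the factor carried by the remainders. *)
Lemma cutoff_union k1 k2 : cutoff k1 -> cutoff k2 ->
  exists2 k, cutoff k & forall z, 1 - k z <= 1 - k1 z /\ 1 - k z <= 1 - k2 z.
Proof.
case=> o1 b1; case=> o2 b2; exists (fun z => k1 z + k2 z * (1 - k1 z)).
  split.
    under eq_fun do rewrite rmorphD rmorphM rmorphB rmorph1.
    apply: od_tensor_add => //; under eq_fun do rewrite mulrC.
    apply: (od_tensorMl P_semigroup P_conservative P_associated) => //.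
    apply: (tensorB P_semigroup P_conservative P_associated).
      exact: tensor_cst.
    exact: od_tensor_tensor.
  by move=> z; have := b1 z; have := b2 z; nra.
by move=> z; have := b1 z; have := b2 z; split; nra.
Qed.

Lemma cutoff_swap k : cutoff k -> cutoff (fun z => k (z.2, z.1)).
Proof.
move=> [ok bk]; split => [|z]; last exact: bk.
have : forall w, od_tensor E w -> od_tensor E (fun z => w (z.2, z.1)).
  move=> w; elim=> [f g fC gC c sep|u v _ IHu _ IHv]; last exact: od_tensor_add.
  under eq_fun do rewrite mulrC; apply: od_tensor_prod => //.
  - by case: c; [right|left].
  - by rewrite /cseparated setIC.
by move=> /(_ _ ok).
Qed.

Let th (r : R) : R := Num.min (Num.max r 0) 1.

Let thE r : th r = if r < 0 then 0 else if r < 1 then r else 1.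
Proof.
rewrite /th; have [r0|r0] := ltP r 0; first by rewrite min_l.
by have [r1|r1] := ltP r 1.
Qed.

Let th_lip (a b : R) : `|th a - th b| <= `|a - b|.
Proof.
have key (u v : R) : u <= v -> `|th u - th v| <= `|u - v|.
  move=> uv; rewrite distrC (distrC u) (ger0_norm (_ : 0 <= v - u)) ?subr_ge0//.
  rewrite !thE ger0_norm; case: (ltP u 0) => ?; case: (ltP v 0) => ?;
    case: (ltP u 1) => ?; case: (ltP v 1) => ?; lra.
by have [/key//|/ltW/key] := leP a b; rewrite distrC (distrC b).
Qed.

Let th01 r : 0 <= th r <= 1.
Proof. by rewrite thE; case: (ltP r 0) => ?; case: (ltP r 1) => ?; lra. Qed.

Let th0 r : r <= 0 -> th r = 0.
Proof. by move=> r0; rewrite thE; case: (ltP r 0) => ?; case: (ltP r 1) => ?; lra. Qed.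

Let th1 r : 1 <= r -> th r = 1.
Proof. by move=> r1; rewrite thE; case: (ltP r 0) => ?; case: (ltP r 1) => ?; lra. Qed.

Lemma core_real (f : X -> R) : real_core E f -> core E (fun x => (f x)%:C).
Proof. by move=> fC; split => //; exact: real_core0. Qed.

Lemma core_cst_real (f : X -> R) : real_core_cst E f -> core_cst E (fun x => (f x)%:C).
Proof. by move=> fC; apply/core_cstP; split => //; exact: real_core_cst_cst. Qed.

(* Localizes on {f(x) >= s + d, f(y) <= s - 2 d}; either the x-factor or the
   y-factor vanishes where f does, according to the sign of s. *)
Lemma cutoff_level (f : X -> R) (s d : R) : real_core E f -> 0 < d ->
  exists2 k, cutoff k & forall x y, s + d <= f x -> f y <= s - 2 * d -> k (x, y) = 1.
Proof.
move=> fC d0; pose psi1 a := th ((a - s) / d); pose psi2 a := th ((s - d - a) / d).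
have lip1 a b : `|psi1 a - psi1 b| <= d^-1 * `|a - b|.
  rewrite (le_trans (th_lip _ _))// -mulrBl normrM (gtr0_norm (_ : 0 < d^-1)) ?invr_gt0//.
  by rewrite mulrC (_ : a - s - (b - s) = a - b)//; ring.
have lip2 a b : `|psi2 a - psi2 b| <= d^-1 * `|a - b|.
  rewrite (le_trans (th_lip _ _))// -mulrBl normrM (gtr0_norm (_ : 0 < d^-1)) ?invr_gt0//.
  by rewrite mulrC (_ : s - d - a - (s - d - b) = b - a) 1?distrC//; ring.
have di0 : 0 <= d^-1 by rewrite invr_ge0 ltW.
have LC := real_core_cst_lipschitz P_semigroup P_conservative P_associated
  (real_core_cst_core fC) di0.
have L0 := real_core_lipschitz P_semigroup P_conservative P_associated fC di0.
have cf : continuous f by case: fC => _ [].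
exists (fun z => psi1 (f z.1) * psi2 (f z.2)).
  split; last first.
    move=> z; have /andP[? ?] := th01 ((f z.1 - s) / d).
    by have /andP[? ?] := th01 ((s - d - f z.2) / d); rewrite mulr_ge0// mulr_ile1.
  under eq_fun do rewrite rmorphM.
  apply: (@od_tensor_prod _ _ _ _ (fun x => (psi1 (f x))%:C) (fun x => (psi2 (f x))%:C)).
  - by apply: core_cst_real; exact: LC.
  - by apply: core_cst_real; exact: LC.
  - have [s0|s0] := leP 0 s; [left|right]; apply: core_real; apply: L0 => //.
    + by apply: th0; rewrite sub0r mulNr oppr_le0 divr_ge0// ltW.
    + by apply: th0; rewrite subr0 pmulr_lle0 ?invr_gt0//; lra.
  - rewrite /cseparated -subset0 => x [h1 h2].
    have : [set x | s <= f x] x.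
      move: h1; rewrite closureEbigcap => /(_ [set x | s <= f x]); apply; split.
        by apply: (@preimage_closed _ _ f [set r | s <= r]) => [y _|]; [exact: cf|exact: closed_ge].
      move=> y /=; apply: contra_neqT; rewrite -ltNge => /ltW fy.
      by rewrite /psi1 th0// pmulr_lle0 ?invr_gt0// subr_le0.
    have : [set x | f x <= s - d] x.
      move: h2; rewrite closureEbigcap => /(_ [set x | f x <= s - d]); apply; split.
        by apply: (@preimage_closed _ _ f [set r | r <= s - d]) => [y _|]; [exact: cf|exact: closed_le].
      move=> y /=; apply: contra_neqT; rewrite -ltNge => /ltW fy.
      by rewrite /psi2 th0// pmulr_lle0 ?invr_gt0// subr_le0.
    by move=> /= u v; lra.
move=> x y /= fx fy; rewrite /psi1 /psi2 !th1 ?mulr1//.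
- by rewrite ler_pdivlMr// mul1r; lra.
- by rewrite ler_pdivlMr// mul1r; lra.
Qed.

(** Finitely many levels, spaced by d = e / 4 over the range of f, are cut off together, in both
    orders of x and y. If |f(x) - f(y)| > 4 d, one level separates the two values with the margins
    of [cutoff_level] and the cutoff is 1; otherwise the product is at most 4 d = e. *)
Lemma cutoff_diff (f : X -> R) (e : R) : real_core E f -> 0 < e ->
  exists2 k, cutoff k & forall z, (1 - k z) * `|f z.1 - f z.2| <= e.
Proof.
move=> fC e0; have [M M0 fM] := core_bounded fC.
pose d := e / 4; have d0 : 0 < d by rewrite divr_gt0.
have grid (N : nat) : exists2 k, cutoff k & forall x y (j : nat), (j < N)%N ->
    (- M + j%:R * d) + d <= f x -> f y <= (- M + j%:R * d) - 2 * d ->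
    k (x, y) = 1 /\ k (y, x) = 1.
  elim: N => [|N [k kc kN]]; first by exists (fun=> 0) => //; exact: cutoff0.
  have [k1 k1c k1s] := cutoff_level (- M + N%:R * d) fC d0.
  have [k2 k2c k2u] := cutoff_union k1c (cutoff_swap k1c).
  have [k3 k3c k3u] := cutoff_union kc k2c.
  have one (z : X * X) (a : R) : 1 - k3 z <= 1 - a -> a = 1 -> k3 z = 1.
    by move=> h a1; have /andP[_ ?] := k3c.2 z; apply/eqP; rewrite eq_le; apply/andP; split=> //; lra.
  exists k3 => // x y j; rewrite ltnS leq_eqVlt => /predU1P[->|jN] fx fy.
    have h := k1s _ _ fx fy; split.
    - apply: (one _ (k1 (x, y))) => //.
      by rewrite (le_trans (k3u (x, y)).2)// (k2u (x, y)).1.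
    - apply: (one _ (k1 (x, y))) => //.
      by rewrite (le_trans (k3u (y, x)).2)// (k2u (y, x)).2.
  have [h1 h2] := kN _ _ _ jN fx fy.
  by split; [apply: (one _ (k (x, y))) => //; exact: (k3u (x, y)).1|
             apply: (one _ (k (y, x))) => //; exact: (k3u (y, x)).1].
(* The level used below has index t + 3, where t = trunc((f(y) + M) / d) is at most trunc(2 M / d);
   hence the 4 added here. *)
have [k kc kN] := grid (Num.truncn (2 * M / d)).+4.
exists k => // z.
have kz := kc.2 z.
have key x y : 4 * d < f x - f y -> k (x, y) = 1 /\ k (y, x) = 1.
  move=> fxy; have fx := fM x; have fy := fM y; rewrite !ler_norml in fx fy.
  have r0 : 0 <= (f y + M) / d by rewrite divr_ge0 ?(ltW d0)//; lra.
  have /andP[tl tu] := truncn_itv r0.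
  rewrite ler_pdivlMr// in tl; rewrite ltr_pdivrMr// in tu.
  (* With t d <= f(y) + M < (t + 1) d, the level s = -M + (t + 3) d satisfies f(y) <= s - 2 d and s
     + d <= f(y) + 4 d < f(x). *)
  apply: (kN _ _ (Num.truncn ((f y + M) / d)).+3).
  - rewrite !ltnS; apply: le_truncn; rewrite ler_wpM2r ?invr_ge0 ?(ltW d0)//; lra.
  - move: tl; rewrite -3!natr1; move: (_%:R) => q; lra.
  - move: tu; rewrite -4!natr1; move: (Num.truncn _)%:R => q; lra.
have [le4|] := leP `|f z.1 - f z.2| (4 * d).
  have -> : e = 4 * d by rewrite /d; field.
  by apply: le_trans le4; rewrite ler_piMl//; lra.
rewrite ltr_normr => /orP[|]; case: z kz => x y /= kz h.
- by have [-> _] := key _ _ h; rewrite subrr mul0r ltW.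
- by have [|_ ->] := key y x; [lra|rewrite subrr mul0r ltW].
Qed.

(** The form in which 1-forms are small near the diagonal: a single cutoff leaves a uniformly small
    remainder. The property passes from increments of real core functions to bounded multiples and
    finite sums. *)
Lemma cutoff_Omega1 w e : Omega1 E w -> 0 < e ->
  exists2 k, cutoff k & forall z, (1 - k z) * nc (w z) <= e.
Proof.
move=> [n [c [f [g [fgC ->]]]]].
have small (u : X * X -> C) (v : X * X -> C) : 
    (forall e, 0 < e -> exists2 k, cutoff k & forall z, (1 - k z) * nc (u z) <= e) ->
    (forall e, 0 < e -> exists2 k, cutoff k & forall z, (1 - k z) * nc (v z) <= e) ->
    (forall e, 0 < e -> exists2 k, cutoff k & forall z, (1 - k z) * nc (u z + v z) <= e).
  move=> hu hv d d0; have d2 : 0 < d / 2 by rewrite divr_gt0.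
  have [k1 k1c k1e] := hu _ d2; have [k2 k2c k2e] := hv _ d2.
  have [k kc ku] := cutoff_union k1c k2c; exists k => // z.
  have [h1 h2] := ku z; have := k1e z; have := k2e z.
  have := ncD (u z) (v z); have := nc_ge0 (u z); have := nc_ge0 (v z).
  have /andP[_ kz1] := kc.2 z.
  move: (nc (u z + v z)) (nc (u z)) (nc (v z)) => x a b b0 a0 xab hb ha.
  apply: (@le_trans _ _ ((1 - k z) * (a + b))); first by rewrite ler_wpM2l// subr_ge0.
  have : (1 - k z) * a <= (1 - k1 z) * a by rewrite ler_wpM2r.
  have : (1 - k z) * b <= (1 - k2 z) * b by rewrite ler_wpM2r.
  lra.
have smallM (M : R) (u v : X * X -> C) : 0 <= M -> (forall z, nc (v z) <= M * nc (u z)) ->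
    (forall e, 0 < e -> exists2 k, cutoff k & forall z, (1 - k z) * nc (u z) <= e) ->
    (forall e, 0 < e -> exists2 k, cutoff k & forall z, (1 - k z) * nc (v z) <= e).
  move=> M0 vu hu d d0; have M1 : 0 < M + 1 by rewrite ltr_wpDl.
  have [k kc ku] := hu _ (divr_gt0 d0 M1); exists k => // z.
  have /andP[_ kz1] := kc.2 z; have := ku z; rewrite ler_pdivlMr// => h.
  apply: (@le_trans _ _ ((1 - k z) * (M * nc (u z)))).
    by rewrite ler_wpM2l// subr_ge0.
  apply: le_trans h; have : 0 <= (1 - k z) * nc (u z) by rewrite mulr_ge0 ?nc_ge0// subr_ge0.
  by move=> ?; rewrite mulrCA mulrDr mulr1 mulrC lerDl.
elim: n => [|n IHn] in c f g fgC e *.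
  move=> e0; exists (fun=> 0) => [|z]; first exact: cutoff0.
  by rewrite big_ord0 ComplexField.Normc.normc0 mulr0 ltW.
move=> e0; have [||k kc kz] := @small (fun z => c ord0 * elem_form (f ord0) (g ord0) z)
  (fun z => \sum_(i < n) c (lift ord0 i) * elem_form (f (lift ord0 i)) (g (lift ord0 i)) z) _ _ e e0;
  last by exists k => // z; rewrite big_ord_recl; exact: kz.
  2: by move=> d d0; apply: IHn d0 => i; exact: fgC.
have [f0 g0] := fgC ord0.
have [N N0 gN] := core_cst_bounded g0.
have /core_cstP[[a fr] [b fi]] := f0.
have := smallM (nc (c ord0) * N) (fun z => (Re (f ord0 z.1) - Re (f ord0 z.2))%:C +
   'i%C * (Im (f ord0 z.1) - Im (f ord0 z.2))%:C)
  (fun z => c ord0 * elem_form (f ord0) (g ord0) z).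
apply.
- by rewrite mulr_ge0 ?nc_ge0.
- move=> z; rewrite /elem_form !ComplexField.Normc.normcM mulrA.
  rewrite (_ : _%:C + _ = f ord0 z.1 - f ord0 z.2); last first.
    by rewrite [RHS]complexE ReB ImB.
  by rewrite ler_wpM2r ?nc_ge0// ler_wpM2l ?nc_ge0.
apply: small => d d0.
- have [k kc kd] := cutoff_diff fr d0; exists k => // z.
  by rewrite nc_real; have := kd z; rewrite (_ : Re (f ord0 z.1) - a - (Re (f ord0 z.2) - a) = Re (f ord0 z.1) - Re (f ord0 z.2))//; ring.
- have [k kc kd] := cutoff_diff fi d0; exists k => // z.
  rewrite ComplexField.Normc.normcM nc_real (_ : nc 'i%C = 1) ?mul1r; last first.
    by rewrite /= expr0n expr1n add0r sqrtr1.
  by have := kd z; rewrite (_ : Im (f ord0 z.1) - b - (Im (f ord0 z.2) - b) = Im (f ord0 z.1) - Im (f ord0 z.2))//; ring.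
Qed.

End off_diagonal_forms.

(** * Norm and scalar product of a complex Hilbert space *)

Section complex_hilbert.
Context (R : realType) (V : completeNormedModType R[i]).
Variable ip : {dot V for (@conjc R)}.
Hypothesis ip_norm : forall u : V, `|u| ^+ 2 = ip u u.
Implicit Types (u v : V) (c : R[i]).
Local Notation Re := complex.Re.
Local Notation Im := complex.Im.
Local Notation nc := ComplexField.Normc.normc.

(** The norm of the space takes its values in R[i]; its real part allows estimates in the ordered
    field R. *)
Definition nrm u : R := Re `|u|.

Lemma nrmE u : `|u| = (nrm u)%:C.
Proof.
by rewrite /nrm {1}(complexE `|u|) ger0_Im ?normr_ge0// mulr0 addr0.
Qed.

Lemma nrm_ge0 u : 0 <= nrm u. Proof. by rewrite -ler0c -nrmE. Qed.

Lemma nrmD u v : nrm (u + v) <= nrm u + nrm v.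
Proof. by rewrite -lecR rmorphD/= -!nrmE ler_normD. Qed.

Lemma nrmN u : nrm (- u) = nrm u. Proof. by rewrite /nrm normrN. Qed.

Lemma nrmB u v : nrm (u - v) = nrm (v - u). Proof. by rewrite /nrm distrC. Qed.

Lemma nrmZ c u : nrm (c *: u) = nc c * nrm u.
Proof. by apply: (@complexI R); rewrite -nrmE normrZ nrmE normC_nc rmorphM. Qed.

Lemma nrm0 : nrm 0 = 0. Proof. by rewrite /nrm normr0. Qed.

Lemma nrm_eq0 u : nrm u = 0 -> u = 0.
Proof. by move=> u0; apply/eqP; rewrite -normr_eq0 nrmE u0. Qed.

Lemma nrm_dist u v : `|nrm u - nrm v| <= nrm (u - v).
Proof.
rewrite ler_norml; apply/andP; split.
- by have := nrmD u (v - u); rewrite addrC subrK nrmB; lra.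
- by have := nrmD v (u - v); rewrite addrC subrK; lra.
Qed.

Lemma ip_nrm u : ip u u = ((nrm u) ^+ 2)%:C.
Proof. by rewrite -ip_norm nrmE rmorphXn. Qed.

Lemma ipDl u v w : ip (u + v) w = ip u w + ip v w.
Proof. exact: linearDl. Qed.
Lemma ipZl c u v : ip (c *: u) v = c * ip u v.
Proof. exact: linearZl_LR. Qed.
Lemma ipC u v : ip u v = (ip v u)^*.
Proof. by rewrite hermC expr0 mul1r. Qed.
Lemma ipDr u v w : ip w (u + v) = ip w u + ip w v.
Proof. by rewrite ipC ipDl rmorphD/= -!ipC. Qed.
Lemma ipZr c u v : ip u (c *: v) = c^* * ip u v.
Proof. by rewrite ipC ipZl rmorphM/= -ipC. Qed.
Lemma ipNl u v : ip (- u) v = - ip u v.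
Proof. by rewrite -scaleN1r ipZl mulN1r. Qed.
Lemma ipBl u v w : ip (u - v) w = ip u w - ip v w.
Proof. by rewrite ipDl ipNl. Qed.

Lemma nrm_sqD u v : nrm (u + v) ^+ 2 = nrm u ^+ 2 + 2 * Re (ip u v) + nrm v ^+ 2.
Proof.
have -> : nrm (u + v) ^+ 2 = Re (ip (u + v) (u + v)) by rewrite ip_nrm.
rewrite ipDl !ipDr !ReD !ip_nrm/= (ipC v u) ReJ; ring.
Qed.

(** Testing with -e ip(u, v) for real e gives 0 <= |ip|^2 |v|^2 e^2 - 2 |ip|^2 e, a quadratic with
    constant term 0, so its linear coefficient vanishes. *)
Lemma ip_eq0_of_min u v : (forall c, nrm u <= nrm (u + c *: v)) -> ip u v = 0.
Proof.
move=> h; set c := ip u v.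
have : (- sqmod c) ^+ 2 <= sqmod c * nrm v ^+ 2 * 0.
  apply: discriminant_le => [|e]; first by rewrite mulr_ge0 ?sqmod_ge0 ?sqr_ge0.
  have := h (- e%:C * c); rewrite -ler_sqr ?nnegrE ?nrm_ge0// nrm_sqD ipZr nrmZ exprMn.
  rewrite -/c -[nc _ ^+ 2]/(sqmod _) sqmodM sqmodN sqmod_real.
  have -> : (- e%:C * c)^* * c = - (e%:C * (c * c^*)).
    by apply: eqC; rewrite !(ReM, ImM, ReN, ImN, ReJ, ImJ)/=; ring.
  rewrite ReN ReM /= mul0r subr0 -sqmod_mulJ; lra.
rewrite mulr0 => c0; apply/eqP; rewrite -sqmod_eq0 -sqrf_eq0 -[sqmod c]opprK sqrrN.
by rewrite eq_le c0 sqr_ge0.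
Qed.

Lemma cvgVP (u_ : nat -> V) u : u_ @ \oo --> u <->
  forall e : R, 0 < e -> exists N : nat, forall n, (N <= n)%N -> nrm (u - u_ n) < e.
Proof.
split=> [/cvgrPdist_lt h e e0|h].
  have e0' : 0 < e%:C by rewrite ltcR.
  by have [N _ HN] := h _ e0'; exists N => n /HN /=; rewrite nrmE ltcR.
apply/cvgrPdist_lt => e; rewrite ltcE => /andP[/eqP/= ei er].
have [N HN] := h _ er; exists N => // n /HN /= hn.
by rewrite nrmE [e]complexE ei mulr0 addr0 ltcR.
Qed.

Lemma cvgV_nrm (u_ : nat -> V) u : u_ @ \oo --> u -> (fun n => nrm (u_ n)) @ \oo --> nrm u.
Proof.
move=> /cvgVP h; apply/cvgrPdist_lt => e e0; have [N HN] := h _ e0.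
by exists N => // n /= /HN; apply: le_lt_trans; exact: nrm_dist.
Qed.

Lemma cauchyV (u_ : nat -> V) :
  (forall e : R, 0 < e -> exists N : nat, forall m n, (N <= m)%N -> (N <= n)%N ->
     nrm (u_ m - u_ n) < e) ->
  exists u, u_ @ \oo --> u.
Proof.
move=> h; have : cvg (u_ @ \oo); last by move=> cu; exists (lim (u_ @ \oo)).
apply/cauchy_cvgP/cauchyP => e; rewrite ltcE => /andP[/eqP/= ei er].
have [N HN] := h _ er; exists (u_ N); exists N => // n /= Nn.
rewrite -ball_normE /ball_/= nrmE [e]complexE ei mulr0 addr0 ltcR.
exact: HN.
Qed.

End complex_hilbert.

(** * Orthogonal projections *)

Section orthogonal_projection.
Context (R : realType) (V : completeNormedModType R[i]).
Variable ip : {dot V for (@conjc R)}.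
Hypothesis ip_norm : forall u : V, `|u| ^+ 2 = ip u u.
Variable K : set V.
Hypothesis K_lin : forall c u v, K u -> K v -> K (c *: u + v).
Hypothesis K_cvg : forall (u_ : nat -> V) u, (forall n, K (u_ n)) -> u_ @ \oo --> u -> K u.
Implicit Types (u v k : V) (c : R[i]).

Definition orth v : Prop := forall k, K k -> ip v k = 0.

Definition orth_proj u : V := xget 0 [set k | K k /\ orth (u - k)].

Lemma orth_lin c u v : orth u -> orth v -> orth (c *: u + v).
Proof. by move=> ou ov k kK; rewrite ipDl ipZl ou// ov// mulr0 addr0. Qed.

Lemma K_sub k1 k2 : K k1 -> K k2 -> K (k1 - k2).
Proof. by move=> K1 K2; rewrite addrC -scaleN1r; exact: K_lin. Qed.

Lemma orth_sub u v : orth u -> orth v -> orth (u - v).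
Proof. by move=> ou ov; rewrite addrC -scaleN1r; exact: orth_lin. Qed.

Lemma orth_K_eq0 u : K u -> orth u -> u = 0.
Proof.
move=> Ku /(_ _ Ku) u0; apply: nrm_eq0.
have := ip_nrm ip_norm u; rewrite u0 => /(congr1 (@complex.Re R))/= /esym/eqP.
by rewrite sqrf_eq0 => /eqP.
Qed.

Lemma orth_pythagoras u v : ip u v = 0 -> nrm (u + v) ^+ 2 = nrm u ^+ 2 + nrm v ^+ 2.
Proof. by move=> uv; rewrite (nrm_sqD ip_norm) uv/= mulr0 addr0. Qed.

Lemma orth_proj_eq u k : K k -> orth (u - k) -> orth_proj u = k.
Proof.
move=> Kk ok; rewrite /orth_proj; case: xgetP => [k' _ [Kk' ok']|/(_ k)/=[]//].
apply/eqP; rewrite -subr_eq0; apply/eqP; apply: orth_K_eq0; first exact: K_sub.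
have -> : k' - k = (u - k) - (u - k') by rewrite opprB [in RHS]addrC addrA subrK.
exact: orth_sub.
Qed.

(** Existence of the projection is carried as a property: for classes of 1-forms it is an explicit
    limit of cut off forms, and density extends it to all vectors. *)
Definition has_proj u : Prop := exists2 k, K k & orth (u - k).

Lemma has_projP u : has_proj u -> K (orth_proj u) /\ orth (u - orth_proj u).
Proof. by move=> [k Kk ok]; rewrite (orth_proj_eq Kk ok). Qed.

Lemma orth_proj_lin c u v : has_proj u -> has_proj v ->
  orth_proj (c *: u + v) = c *: orth_proj u + orth_proj v.
Proof.
move=> /has_projP[Ku ou] /has_projP[Kv ov]; apply: orth_proj_eq; first exact: K_lin.
by rewrite opprD addrACA -scalerN -scalerDr; exact: orth_lin.
Qed.

Lemma has_proj_lin c u v : has_proj u -> has_proj v -> has_proj (c *: u + v).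
Proof.
move=> [k Kk ok] [l Kl ol]; exists (c *: k + l); first exact: K_lin.
by rewrite opprD addrACA -scalerN -scalerDr; exact: orth_lin.
Qed.

Lemma orth_proj_sq u : has_proj u ->
  nrm u ^+ 2 = nrm (orth_proj u) ^+ 2 + nrm (u - orth_proj u) ^+ 2.
Proof.
move=> /has_projP[Ku ou]; rewrite addrC -(orth_pythagoras (ou _ Ku)); congr (nrm _ ^+ 2).
by rewrite subrK.
Qed.

Lemma orth_proj_le u : has_proj u -> nrm (orth_proj u) <= nrm u.
Proof.
move=> /orth_proj_sq e; rewrite -ler_sqr ?nnegrE ?nrm_ge0// e.
by rewrite lerDl sqr_ge0.
Qed.

Lemma orth_projB u v : has_proj u -> has_proj v ->
  orth_proj (u - v) = orth_proj u - orth_proj v.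
Proof. by move=> hu hv; rewrite addrC -scaleN1r orth_proj_lin// scaleN1r addrC. Qed.

Lemma orth_proj_cvg (u_ : nat -> V) u : (forall n, has_proj (u_ n)) -> has_proj u ->
  u_ @ \oo --> u -> (fun n => orth_proj (u_ n)) @ \oo --> orth_proj u.
Proof.
move=> hu hu0 /cvgVP h; apply/cvgVP => e e0; have [N HN] := h _ e0.
exists N => n /HN; apply: le_lt_trans; rewrite -orth_projB//.
by apply: orth_proj_le; rewrite addrC -scaleN1r; exact: has_proj_lin.
Qed.

(** Orthogonality to k amounts to minimality of the norm along the line of all u + c k, a condition
    preserved by limits. *)
Lemma orth_cvg (u_ : nat -> V) u : (forall n, orth (u_ n)) -> u_ @ \oo --> u -> orth u.
Proof.
move=> ou /cvgVP h k Kk; apply: (ip_eq0_of_min ip_norm) => c.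
apply/ler_addgt0Pl => e e0; have e2 : 0 < e / 2 by rewrite divr_gt0.
have [N /(_ _ (leqnn N)) HN] := h _ e2.
have le1 : nrm (u_ N) <= nrm (u_ N + c *: k).
  rewrite -ler_sqr ?nnegrE ?nrm_ge0// orth_pythagoras ?lerDl ?sqr_ge0//.
  by rewrite ipZr ou// mulr0.
have := nrmD (u - u_ N) (u_ N); rewrite subrK.
have := nrmD (u_ N - u) (u + c *: k); rewrite addrA subrK [nrm (u_ N - u)]nrmB.
by move: HN le1; lra.
Qed.

Lemma has_proj_cvg (u_ : nat -> V) u : (forall n, has_proj (u_ n)) ->
  u_ @ \oo --> u -> has_proj u.
Proof.
move=> hu cu; have cu' := (cvgVP _ _).1 cu.
have [|k ck] := cauchyV (u_ := fun n => orth_proj (u_ n)).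
  move=> e e0; have e2 : 0 < e / 2 by rewrite divr_gt0.
  have [N HN] := cu' _ e2.
  exists N => m n /HN um /HN un; rewrite -orth_projB//.
  apply: le_lt_trans (orth_proj_le _) _.
    by rewrite addrC -scaleN1r; exact: has_proj_lin.
  have := nrmD (u_ m - u) (u - u_ n); rewrite addrA subrK [nrm (u_ m - u)]nrmB.
  by move: um un; lra.
exists k; first by apply: (K_cvg _ ck) => n; exact: (has_projP (hu n)).1.
apply: (orth_cvg (u_ := fun n => u_ n - orth_proj (u_ n))).
  by move=> n; exact: (has_projP (hu n)).2.
exact: cvgB.
Qed.

End orthogonal_projection.

(** * The exponential on the imaginary axis *)

Section unit_exponential.
Context (R : realType).
Local Notation C := R[i].
Local Notation Re := complex.Re.
Local Notation Im := complex.Im.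
Local Notation nc := ComplexField.Normc.normc.
Implicit Types (s t : R) (a b z : C).

Lemma normr_sin_le s : `|sin s| <= `|s|.
Proof.
wlog s0 : s / 0 <= s => [h|].
  have [|/ltW s0] := leP 0 s; first exact: h.
  by rewrite -[leRHS]normrN -[leLHS]normrN -sinN h// oppr_ge0.
have [|c _] := MVT_segment s0 (fun x _ => is_derive_sin x).
  exact/continuous_subspaceT/continuous_sin.
rewrite sin0 !subr0 => ->; rewrite normrM ler_piMl// cos_max//.
Qed.

Lemma cos_half s : 1 - cos s = 2 * sin (s / 2) ^+ 2.
Proof.
have {1}-> : s = (s / 2) *+ 2 by rewrite -mulr_natr -mulrA mulVf ?mulr1.
by rewrite cos_mulr2n cos2sin2 -mulr_natr; ring.
Qed.

Lemma cos_ge_quadratic s : 1 - cos s <= s ^+ 2 / 2.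
Proof.
rewrite cos_half; have : sin (s / 2) ^+ 2 <= (s / 2) ^+ 2.
  by rewrite -[leLHS]real_normK ?num_real// -[leRHS]real_normK ?num_real// ler_sqr ?nnegrE// normr_sin_le.
rewrite expr_div_n; move: (sin _ ^+ 2) => x; lra.
Qed.

Lemma cos_ge_linear s : 1 - cos s <= `|s|.
Proof.
rewrite cos_half; have := normr_sin_le (s / 2); rewrite normrM (ger0_norm (_ : 0 <= 2^-1))//.
have := sin_max (s / 2); rewrite -[sin _ ^+ 2]real_normK ?num_real//.
have := normr_ge0 (sin (s / 2)); move: `|sin _| => x; rewrite expr2; nra.
Qed.

Lemma normr_sin_sub_le s : `|sin s - s| <= s ^+ 2.
Proof.
wlog s0 : s / 0 <= s => [h|].
  have [|/ltW s0] := leP 0 s; first exact: h.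
  have /h : 0 <= - s by rewrite oppr_ge0.
  by rewrite sinN -opprD normrN sqrrN.
have dd (x : R) : x \in `]0, s[%R -> is_derive x 1 (fun y : R => sin y - y) (cos x - 1).
  by move=> _; apply: is_deriveB.
have [|c cs] := MVT_segment s0 dd.
  apply/continuous_subspaceT => x; apply: cvgB; [exact: continuous_sin|exact: cvg_id].
rewrite sin0 !subr0 => ->; rewrite normrM (ger0_norm s0) expr2 ler_wpM2r//.
rewrite distrC ger0_norm ?subr_ge0 ?cos_le1// (le_trans (cos_ge_linear _))//.
by move: cs; rewrite in_itv/= => /andP[c0 cs]; rewrite ger0_norm.
Qed.

Definition eir s : C := cos s +i* sin s.

Lemma expc_eir z : Im z = 0 -> expc ('i%C * z) = eir (Re z).
Proof.
move=> z0; rewrite /expc ReM ImM /= z0 !mul0r mulr0 subrr expR0 add0r mul1r.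
by rewrite mul1r.
Qed.

Lemma nc_eir s : nc (eir s) = 1.
Proof. by rewrite /= cos2Dsin2 sqrtr1. Qed.

Lemma eirD s t : eir (s + t) = eir s * eir t.
Proof. by apply: eqC; rewrite ?ReM ?ImM/= ?cosD ?sinD//; ring. Qed.

Lemma eirX s n : eir (s *+ n) = eir s ^+ n.
Proof.
elim: n => [|n IHn]; last by rewrite mulrS exprS eirD IHn.
by rewrite mulr0n expr0 /eir cos0 sin0.
Qed.

Lemma sqmod_eirB s t : sqmod (eir s - eir t) <= (s - t) ^+ 2.
Proof.
have -> : sqmod (eir s - eir t) = 2 * (1 - cos (s - t)).
  rewrite sqmodE ReB ImB/= cosB; have := cos2Dsin2 s; have := cos2Dsin2 t.
  by rewrite !expr2; lra.
by have := cos_ge_quadratic (s - t); lra.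
Qed.

Lemma nc_eir_taylor s : nc (eir s - (1 + 'i%C * s%:C)) <= 2 * s ^+ 2.
Proof.
apply: le_trans (nc_ReIm _) _.
have -> : Re (eir s - (1 + 'i%C * s%:C)) = cos s - 1.
  by rewrite ReB ReD ReM/=; ring.
have -> : Im (eir s - (1 + 'i%C * s%:C)) = sin s - s.
  by rewrite ImB ImD ImM/=; ring.
rewrite distrC ger0_norm ?subr_ge0 ?cos_le1//.
have := normr_sin_sub_le s; have := cos_ge_quadratic s; have := sqr_ge0 s; lra.
Qed.

Lemma ncM a b : nc (a * b) = nc a * nc b.
Proof. exact: ComplexField.Normc.normcM. Qed.

Lemma nc_subXX (k : R) a b n : 1 <= k -> nc a <= k -> nc b <= k ->
  nc (a ^+ n - b ^+ n) <= n%:R * k ^+ n * nc (a - b).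
Proof.
move=> k1 ak bk; have k0 : 0 <= k := le_trans ler01 k1.
have ncX x m : nc x <= k -> nc (x ^+ m) <= k ^+ m.
  move=> xk; elim: m => [|m IHm]; first by rewrite expr0 nc_real normr1.
  by rewrite exprS ncM exprS ler_pM ?nc_ge0.
elim: n => [|n IHn]; first by rewrite !expr0 subrr mul0r mul0r nc_real normr0.
have -> : a ^+ n.+1 - b ^+ n.+1 = a * (a ^+ n - b ^+ n) + (a - b) * b ^+ n.
  by rewrite !exprS; ring.
apply: le_trans (ncD _ _) _; rewrite !ncM -natr1 mulrDl mulrDl mul1r; apply: lerD.
- rewrite [k ^+ n.+1]exprS mulrCA -mulrA.
  by apply: ler_pM => //; exact: nc_ge0.
- rewrite mulrC ler_wpM2r ?nc_ge0// (le_trans (ncX _ _ bk))//.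
  by rewrite exprS ler_peMl// exprn_ge0.
Qed.

(** Write m for m.+1 and x = s / m. The number k = e^{M/m} bounds both |e^{ix}| and |1 + i x|, and
    k^m = e^M; the Taylor error 2 x^2 is then multiplied by m e^M. One factor |s| is kept on the
    right, so that the error is small relative to a 1-form and not just uniformly. *)
Lemma eir_approx (M : R) s m : `|s| <= M ->
  nc (eir s - (1 + 'i%C * (s / m.+1%:R)%:C) ^+ m.+1) <=
  (2 * expR M * M) * m.+1%:R^-1 * `|s|.
Proof.
move=> sM; have M0 : 0 <= M := le_trans (normr_ge0 _) sM.
have m0 : 0 < m.+1%:R :> R by [].
set x := s / m.+1%:R; set k := expR (M / m.+1%:R).
have xM : `|x| <= M / m.+1%:R by rewrite normrM normfV (ger0_norm (ltW m0)) ler_wpM2r// invr_ge0 ltW.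
have k1 : 1 <= k by rewrite -expR0 ler_expR divr_ge0// ltW.
have kM : k ^+ m.+1 = expR M.
  by rewrite -expRM_natl mulrC -mulrA mulVf ?mulr1// gt_eqF.
have {1}-> : s = x *+ m.+1 by rewrite -mulr_natr -mulrA mulVf ?mulr1// gt_eqF.
rewrite eirX; apply: le_trans (nc_subXX _ k1 _ _) _.
- by rewrite nc_eir.
- apply: le_trans (ncD _ _) _; rewrite (_ : nc 1 = 1); last by rewrite nc_real normr1.
  rewrite ncM nc_real (_ : nc 'i%C = 1) ?mul1r; last by rewrite /= expr0n expr1n add0r sqrtr1.
  by apply: le_trans (expR_ge1Dx _) _; rewrite ler_expR.
rewrite kM.
apply: (@le_trans _ _ (m.+1%:R * expR M * (2 * x ^+ 2))).
  by rewrite ler_wpM2l ?mulr_ge0 ?expR_ge0//; exact: nc_eir_taylor.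
have -> : m.+1%:R * expR M * (2 * x ^+ 2) = 2 * expR M * m.+1%:R^-1 * (`|s| * `|s|).
  by rewrite -normrM -expr2 ger0_norm ?sqr_ge0// /x; field; rewrite gt_eqF.
rewrite mulrA ler_wpM2r// mulrAC ler_wpM2r ?invr_ge0//.
by rewrite ler_wpM2l// mulr_ge0 ?expR_ge0.
Qed.

End unit_exponential.

(** * Integrated inequalities, perturbed limits and polarization *)

Lemma integral_sqmod_le d (T : measurableType d) (R : realType)
    (m : {measure set T -> \bar R}) (D : set T) (x y u v : T -> R[i]) (k : R) :
  measurable D -> measurable_fun D (fun z => sqmod (x z)) ->
  measurable_fun D (fun z => sqmod (y z)) -> measurable_fun D (fun z => sqmod (u z)) ->
  measurable_fun D (fun z => sqmod (v z)) -> 0 <= k ->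
  (forall z, D z -> sqmod (x z) <= sqmod (y z) + k * (sqmod (u z) + sqmod (v z))) ->
  (\int[m]_(z in D) (sqmod (x z))%:E <= \int[m]_(z in D) (sqmod (y z))%:E +
    k%:E * (\int[m]_(z in D) (sqmod (u z))%:E + \int[m]_(z in D) (sqmod (v z))%:E))%E.
Proof.
move=> mD mx my mu mv k0 h.
have pos (w : T -> R[i]) z : D z -> (0 <= (sqmod (w z))%:E)%E.
  by move=> _; rewrite lee_fin sqmod_ge0.
have me (w : T -> R[i]) : measurable_fun D (fun z => sqmod (w z)) ->
    measurable_fun D (fun z => (sqmod (w z))%:E) by move=> mw; exact/measurable_EFinP.
rewrite -ge0_integralD//; [|exact: pos|exact: me|exact: pos|exact: me].
rewrite -ge0_integralZl_EFin//; last 2 first.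
- by move=> z Dz; rewrite adde_ge0// pos.
- by apply: emeasurable_funD; exact: me.
rewrite -ge0_integralD//; last 4 first.
- exact: pos.
- exact: me.
- by move=> z Dz; rewrite mule_ge0 ?lee_fin// addr_ge0 ?sqmod_ge0.
- by apply: measurable_funeM; apply: emeasurable_funD; exact: me.
apply: ge0_le_integral => //.
- exact: pos.
- exact: me.
- apply: emeasurable_funD; first exact: me.
  by apply: measurable_funeM; apply: emeasurable_funD; exact: me.
Qed.

(** g is compared with functions y whose limits k are known and close to l. The error is allowed to
    be a small multiple of a function h that merely converges. *)
Lemma cvg_perturb (R : realType) (T : Type) (F : set_system T) {FF : Filter F}
    (g h : T -> R) (l b : R) : h @ F --> b ->
  (forall e, 0 < e -> e <= 1 -> exists (y : T -> R) (k : R),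
     [/\ y @ F --> k, `|l - k| <= e * b & \forall t \near F, `|g t - y t| <= e * h t]) ->
  g @ F --> l.
Proof.
move=> hb approx; apply/cvgrPdist_lt => e e0.
have b1 : 0 < 2 * (`|b| + 1) by rewrite mulr_gt0// ltr_wpDl.
(* Near the limit h is at most 2 (|b| + 1), so the two errors r b and r h are both at most e / 4. *)
pose r := Num.min 1 (e / 4 / (2 * (`|b| + 1))).
have r1 : r <= 1 by rewrite ge_min lexx.
have r0 : 0 < r by rewrite lt_min ltr01 !divr_gt0.
have rb : r * (2 * (`|b| + 1)) <= e / 4 by rewrite -ler_pdivlMr// ge_min lexx orbT.
have [y [k [yk lk near_gy]]] := approx _ r0 r1.
have e4 : 0 < e / 4 by rewrite divr_gt0.
have h1 : \forall t \near F, `|b - h t| < 1 by exact: ((cvgrPdist_lt _ _).1 hb).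
have h2 : \forall t \near F, `|k - y t| < e / 4 by exact: ((cvgrPdist_lt _ _).1 yk).
near=> t.
have : `|b - h t| < 1 by near: t.
have : `|k - y t| < e / 4 by near: t.
have : `|g t - y t| <= r * h t by near: t.
have : r * b <= r * (2 * (`|b| + 1)).
  by rewrite ler_wpM2l ?(ltW r0)//; have := ler_norm b; have := normr_ge0 b; lra.
have hbt : `|b - h t| < 1 -> r * h t <= r * (2 * (`|b| + 1)).
  move=> c; rewrite ler_wpM2l ?(ltW r0)//.
  by have := ler_norm b; have := normr_ge0 b; move: c; rewrite ltr_norml => /andP[]; lra.
move=> rb' gy ky /hbt.
have -> : l - g t = (l - k) + (k - y t) - (g t - y t) by ring.
have := ler_normB ((l - k) + (k - y t)) (g t - y t).
have := ler_normD (l - k) (k - y t).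
by move: lk gy ky rb rb'; lra.
Unshelve. all: end_near. Qed.

Lemma fine_le_bound (R : realType) (a b c d : \bar R) (k : R) :
  a \is a fin_num -> b \is a fin_num -> c \is a fin_num -> d \is a fin_num ->
  (a <= b + k%:E * (c + d))%E -> fine a <= fine b + k * (fine c + fine d).
Proof. by case: a => // a; case: b => // b; case: c => // c; case: d => // d _ _ _ _; rewrite lee_fin. Qed.

Lemma bound_fin_num (R : realType) (a b c d : \bar R) (k : R) :
  (0 <= a)%E -> b \is a fin_num -> c \is a fin_num -> d \is a fin_num ->
  (a <= b + k%:E * (c + d))%E -> a \is a fin_num.
Proof.
case: b => // b; case: c => // c; case: d => // d; move=> a0 _ _ _ le.
by rewrite ge0_fin_numE// (le_lt_trans le)// ltry.
Qed.

Lemma normr_le_bounds (R : realType) (x y k : R) : x <= y + k -> y <= x + k -> `|x - y| <= k.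
Proof. by move=> xy yx; rewrite ler_norml; apply/andP; split; lra. Qed.

Lemma integral_sqmod_le2 d (T : measurableType d) (R : realType)
    (m : {measure set T -> \bar R}) (D : set T) (x y u : T -> R[i]) (k l : R) :
  measurable D -> measurable_fun D (fun z => sqmod (x z)) ->
  measurable_fun D (fun z => sqmod (y z)) -> measurable_fun D (fun z => sqmod (u z)) ->
  0 <= k -> 0 <= l ->
  (forall z, D z -> sqmod (x z) <= k * sqmod (y z) + l * sqmod (u z)) ->
  (\int[m]_(z in D) (sqmod (x z))%:E <= k%:E * \int[m]_(z in D) (sqmod (y z))%:E +
    l%:E * \int[m]_(z in D) (sqmod (u z))%:E)%E.
Proof.
move=> mD mx my mu k0 l0 h.
have pos (w : T -> R[i]) z : D z -> (0 <= (sqmod (w z))%:E)%E.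
  by move=> _; rewrite lee_fin sqmod_ge0.
have me (w : T -> R[i]) : measurable_fun D (fun z => sqmod (w z)) ->
    measurable_fun D (fun z => (sqmod (w z))%:E) by move=> mw; exact/measurable_EFinP.
rewrite -!ge0_integralZl_EFin//; [|exact: pos|exact: me|exact: pos|exact: me].
rewrite -ge0_integralD//; last 4 first.
- by move=> z Dz; rewrite mule_ge0 ?lee_fin// sqmod_ge0.
- by apply: measurable_funeM; exact: me.
- by move=> z Dz; rewrite mule_ge0 ?lee_fin// sqmod_ge0.
- by apply: measurable_funeM; exact: me.
apply: ge0_le_integral => //.
- exact: pos.
- exact: me.
- by apply: emeasurable_funD; apply: measurable_funeM; exact: me.
Qed.

Lemma fine_le_lin (R : realType) (a b c : \bar R) (k l : R) :
  a \is a fin_num -> b \is a fin_num -> c \is a fin_num ->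
  (a <= k%:E * b + l%:E * c)%E -> fine a <= k * fine b + l * fine c.
Proof. by case: a => // a; case: b => // b; case: c => // c _ _ _; rewrite lee_fin. Qed.

Lemma lin_fin_num (R : realType) (a b c : \bar R) (k l : R) :
  (0 <= a)%E -> b \is a fin_num -> c \is a fin_num ->
  (a <= k%:E * b + l%:E * c)%E -> a \is a fin_num.
Proof.
case: b => // b; case: c => // c; move=> a0 _ _ le.
by rewrite ge0_fin_numE// (le_lt_trans le)// ltry.
Qed.

(* Convergence of squared norms along a norm convergent sequence, from the
   weighted form [|x + y|^2 <= (1 + e) |x|^2 + (1 + 1/e) |y|^2] of the triangle
   inequality. *)
Lemma cvg_of_weighted_triangle (R : realType) (x d : nat -> R) (l : R) :
  (forall n, 0 <= x n) -> 0 <= l -> d @ \oo --> (0 : R) ->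
  (forall e n, 0 < e -> x n <= (1 + e) * l + (1 + e^-1) * d n) ->
  (forall e n, 0 < e -> l <= (1 + e) * x n + (1 + e^-1) * d n) ->
  x @ \oo --> l.
Proof.
move=> x0 l0 d0 xl lx; pose b := 3 * l + 4.
have cb : (fun=> b) @ \oo --> b by exact: cvg_cst.
apply: (cvg_perturb cb) => e e0 e1; exists (fun=> l), l; split.
- exact: cvg_cst.
- by rewrite subrr normr0 mulr_ge0 ?(ltW e0)// /b; lra.
have k0 : 0 < 1 + e^-1 by rewrite addr_gt0// invr_gt0.
have m0 : 0 < Num.min (1 / 2) (e / (1 + e^-1)) by rewrite lt_min !divr_gt0.
have [N _ HN] := (cvgrPdist_lt _ _).1 d0 _ m0.
exists N => // n /HN /=; rewrite sub0r normrN => dn.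
have /andP[d1 d2] : (d n < 1 / 2) && ((1 + e^-1) * d n < e).
  have := le_lt_trans (ler_norm _) dn; rewrite lt_min => /andP[-> /=].
  by rewrite ltr_pdivlMr// mulrC.
have := xl e n e0; have := lx e n e0; have := xl 1 n ltr01; rewrite invr1.
have := x0 n; move: d1 d2; move: (_ * d n) => D d1 d2 xn0 x1 l1 x2.
have exn : e * x n <= e * (2 * l + 2) by rewrite ler_wpM2l ?(ltW e0)//; lra.
have el0 : 0 <= e * l by rewrite mulr_ge0// ltW.
by apply: normr_le_bounds; rewrite /b; nra.
Qed.

(** The sums of i^k and of i^{2k} over k < 4 vanish, so only the coefficient of y survives. *)
Lemma polarization4 (R : realType) (x y z w : R[i]) :
  4^-1 * \sum_(k < 4) 'i%C ^+ k * (x + conjc ('i%C ^+ k) * y + 'i%C ^+ k * z + w) = y.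
Proof.
have i2 : ('i%C : R[i]) * 'i%C = -1 by rewrite -expr2 sqr_i.
have iJ : conjc ('i%C : R[i]) = - 'i%C by apply: eqC; rewrite ?ReJ ?ImJ ?ReN ?ImN/= ?oppr0.
have e2 : ('i%C : R[i]) ^+ 2 = -1 by rewrite expr2.
have e3 : ('i%C : R[i]) ^+ 3 = - 'i%C by rewrite exprS e2 mulrN1.
have J1 : conjc (1 : R[i]) = 1 by rewrite rmorph1.
have J2 : conjc (-1 : R[i]) = -1 by rewrite rmorphN rmorph1.
have J3 : conjc (- 'i%C : R[i]) = 'i%C by apply: eqC; rewrite ?ReJ ?ImJ ?ReN ?ImN/= ?oppr0 ?opprK.
pose g (c : R[i]) := c * (x + conjc c * y + c * z + w).
have sum4 (h : nat -> R[i]) : \sum_(k < 4) h k = h 0%N + h 1%N + h 2%N + h 3%N.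
  by rewrite !big_ord_recl big_ord0 addr0 !addrA.
rewrite (sum4 (fun k => g ('i%C ^+ k))) expr0 expr1 e2 e3 /g J1 J2 J3 iJ.
have -> : 1 * (x + 1 * y + 1 * z + w) + 'i%C * (x + - 'i%C * y + 'i%C * z + w) +
    -1 * (x + -1 * y + -1 * z + w) + - 'i%C * (x + 'i%C * y + - 'i%C * z + w) =
  2 * y - 2 * ('i%C * 'i%C) * y + 2 * (1 + 'i%C * 'i%C) * z by ring.
by rewrite i2; field.
Qed.

(** * The space K of off-diagonal classes and the splitting of H *)

Section one_forms.
Context (R : realType) (X : pmetricType R).
Variables (mu : {measure set borel X -> \bar R}) (E : dirichlet_form mu).
Variable P : R -> R.-spker borel X ~> borel X.
Variable J : {measure set (borel X * borel X) -> \bar R}.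
Variable H : one_form_space E P.
Hypothesis X_separable : separable_space X.
Hypothesis P_semigroup : symmetric_markov_semigroup mu P.
Hypothesis P_conservative : conservative mu P.
Hypothesis P_associated : associated E P.
Hypothesis J_jump : is_jump_measure E J.
Local Notation C := R[i].
Local Notation Re := complex.Re.
Local Notation Im := complex.Im.
Local Notation nc := ComplexField.Normc.normc.
Local Notation jm t := (joint_measure mu (P t)).
Local Notation od := (~` @diag X : set (borel X * borel X)).
Local Notation cls := (ofclass H).
Local Notation jmp := (jump_sqnorm J).
Implicit Types (w d : X * X -> C) (u v : H).
Let mod_ : measurable od := offdiag_measurable X_separable.
Let ipn := ip_norm (o := H).
Let tM := tensorM P_semigroup P_conservative P_associated.
Let tB := tensorB P_semigroup P_conservative P_associated.
Let odM := od_tensorMl P_semigroup P_conservative P_associated.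
Let O1od := Omega1_od P_semigroup P_conservative P_associated.
Let O1M := Omega1_mul P_semigroup P_conservative P_associated.
Let O1t := Omega1_tensor P_semigroup P_conservative P_associated.

Lemma half_Pi_cvg w : Omega1 E w ->
  half_Pi_sqnorm mu P t w @[t --> 0^'+] --> (nrm (cls w) ^+ 2)%:E.
Proof. by move=> /(ofclass_sqnorm (o := H)); rewrite (ip_nrm ipn). Qed.

Lemma tensor_sqmod_measurable w : tensor E w ->
  measurable_fun [set: borel X * borel X] (fun z => sqmod (w z)).
Proof. by move=> /tensor_measurable[mr mi]; exact: sqmod_measurable. Qed.

Lemma half_Pi_le (M t : R) (v w : X * X -> C) : 0 < t -> tensor E v -> tensor E w -> 0 <= M ->
  (forall z, sqmod (v z) <= M * sqmod (w z)) ->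
  (half_Pi_sqnorm mu P t v <= M%:E * half_Pi_sqnorm mu P t w)%E.
Proof.
move=> t0 tv tw M0 vw; have mv := tensor_sqmod_measurable tv.
have mw := tensor_sqmod_measurable tw.
rewrite !half_Pi_sqnormE// muleCA lee_wpmul2l//.
  by rewrite lee_fin invr_ge0 mulr_ge0// ltW.
rewrite -ge0_integralZl_EFin//; last 2 first.
- by move=> z _; rewrite lee_fin sqmod_ge0.
- exact/measurable_EFinP.
apply: ge0_le_integral => //.
- by move=> z _; rewrite lee_fin sqmod_ge0.
- exact/measurable_EFinP.
- by apply: measurable_funeM; exact/measurable_EFinP.
- by move=> z _; rewrite -EFinM lee_fin.
Qed.

Lemma jump_sqnorm_ge0 w : (0 <= jmp w)%E.
Proof. by apply: integral_ge0 => z _; rewrite lee_fin sqmod_ge0. Qed.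

Lemma jump_sqnorm_le (M : R) (v w : X * X -> C) :
  measurable_fun od (fun z => sqmod (v z)) ->
  measurable_fun od (fun z => sqmod (w z)) -> 0 <= M ->
  (forall z, sqmod (v z) <= M * sqmod (w z)) -> (jmp v <= M%:E * jmp w)%E.
Proof.
move=> mv mw M0 vw; rewrite /jump_sqnorm -ge0_integralZl_EFin//; last 2 first.
- by move=> z _; rewrite lee_fin sqmod_ge0.
- exact/measurable_EFinP.
apply: ge0_le_integral => //.
- by move=> z _; rewrite lee_fin sqmod_ge0.
- exact/measurable_EFinP.
- by apply: measurable_funeM; exact/measurable_EFinP.
- by move=> z _; rewrite -EFinM lee_fin.
Qed.

(** Pointwise domination passes to the norm of H because that norm is a limit of integrals of |w|^2;
    most norm estimates in H below are obtained in this way. *)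
Lemma ofclass_le (M : R) (v w : X * X -> C) : Omega1 E v -> Omega1 E w -> 0 <= M ->
  (forall z, sqmod (v z) <= M ^+ 2 * sqmod (w z)) -> nrm (cls v) <= M * nrm (cls w).
Proof.
move=> vO wO M0 vw; have tv := Omega1_tensor P_semigroup P_conservative P_associated vO.
have tw := Omega1_tensor P_semigroup P_conservative P_associated wO.
rewrite -ler_sqr ?nnegrE ?mulr_ge0 ?nrm_ge0// exprMn -lee_fin (EFinM (M ^+ 2) (nrm (cls w) ^+ 2)).
have cv := half_Pi_cvg vO.
have cw : ((M ^+ 2)%:E * half_Pi_sqnorm mu P t w @[t --> 0^'+] -->
    (M ^+ 2)%:E * (nrm (cls w) ^+ 2)%:E)%E.
  by apply: cvgeZl => //; exact: half_Pi_cvg.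
rewrite -(cvg_lim _ cv)// -(cvg_lim _ cw)//.
apply: lee_lim; [exact: cvgP cv|exact: cvgP cw|].
apply: filterS (nbhs_right_gt 0) => t t0.
by apply: half_Pi_le => //; exact: sqr_ge0.
Qed.

Lemma od_tensor_ofclass w : od_tensor E w -> jmp w = (nrm (cls w) ^+ 2)%:E.
Proof.
move=> ow; have wO := Omega1_od P_semigroup P_conservative P_associated ow.
have [c _] := od_tensor_sqnorm X_separable P_semigroup P_conservative P_associated J_jump ow.
exact: (cvg_unique _ c (half_Pi_cvg wO)).
Qed.

Lemma cutoff_sequence w : Omega1 E w -> exists k : nat -> X * X -> R,
  (forall n, cutoff E (k n)) /\
  forall n z, (1 - k n z) * nc (w z) <= n.+1%:R^-1.
Proof.
move=> wO; have ex (n : nat) : exists k, cutoff E k /\ forall z, (1 - k z) * nc (w z) <= n.+1%:R^-1.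
  have n0 : 0 < n.+1%:R^-1 :> R by rewrite invr_gt0.
  have [k kc kn] := cutoff_Omega1 P_semigroup P_conservative P_associated wO n0.
  by exists k.
by have [k /all_and2[kc kn]] := choice ex; exists k.
Qed.

(** Cutoffs k_n tend to 1 wherever w is nonzero. On the off-diagonal tensor k_n w the two norms
    agree and are at most the norm of w in H, and Fatou's lemma concludes. *)
Lemma jump_le_ofclass w : Omega1 E w -> (jmp w <= (nrm (cls w) ^+ 2)%:E)%E.
Proof.
move=> wO; have tw := Omega1_tensor P_semigroup P_conservative P_associated wO.
have mw := tensor_sqmod_measurable tw.
have [k [kc kn]] := cutoff_sequence wO.
pose v n z := (k n z)%:C * w z.
have ov n : od_tensor E (v n) by rewrite /v; under eq_fun do rewrite mulrC; apply: odM => //; case: (kc n).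
have mv n : measurable_fun [set: borel X * borel X] (fun z => (sqmod (v n z))%:E).
  by apply/measurable_EFinP; apply: tensor_sqmod_measurable; exact: od_tensor_tensor.
have lim z : (sqmod (v n z))%:E @[n --> \oo] --> (sqmod (w z))%:E.
  apply: cvg_EFin; first exact: nearW.
  have vE n : sqmod (v n z) = sqmod (w z) * k n z ^+ 2.
    by rewrite /v sqmodM sqmod_real mulrC.
  under eq_fun do rewrite /= vE.
  have [w0|w0] := eqVneq (sqmod (w z)) 0.
    by rewrite w0; under eq_fun do rewrite mul0r; exact: cvg_cst.
  have wp : 0 < nc (w z).
    by rewrite lt_def nc_ge0 andbT; move: w0; rewrite /sqmod sqrf_eq0.
  have : k n z @[n --> \oo] --> (1 : R).
    apply/cvgrPdist_lt => e e0; have ew : 0 < e * nc (w z) by rewrite mulr_gt0.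
    have [N _ HN] := near_infty_natSinv_lt (PosNum ew).
    exists N => // n /HN /= h; have /andP[_ k1] := (kc n).2 z.
    rewrite ger0_norm ?subr_ge0// -(ltr_pM2r wp).
    exact: le_lt_trans (kn n z) h.
  move=> k1; have := cvgM (cvg_cst (sqmod (w z))) (cvgM k1 k1); rewrite !mulr1.
  by move/(_ _ _ _); apply: cvg_trans; apply: near_eq_cvg; apply: nearW => n /=; rewrite expr2.
have := fatou J mod_ (f := fun n z => (sqmod (v n z))%:E) (fun n => measurable_funTS (mv n)).
move=> /(_ _)/le_trans H1.
apply: (@le_trans _ _ (limn_einf (fun n => jmp (v n)))).
  apply: le_trans (H1 _ _ (lexx _)).
    rewrite le_eqVlt; apply/orP; left; apply/eqP; apply: eq_integral => z _.
    by rewrite (cvg_limn_einf_sup (lim z)).1.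
  by move=> n z _; rewrite lee_fin sqmod_ge0.
rewrite limn_einf_lim; apply: lime_le; first exact: is_cvg_einfs.
apply: nearW => n; apply: (@le_trans _ _ (jmp (v n))).
  by apply: ereal_inf_lbound; exists n => /=.
rewrite od_tensor_ofclass// lee_fin ler_sqr ?nnegrE ?nrm_ge0// -[leRHS]mul1r.
apply: ofclass_le => //; first exact: (Omega1_od P_semigroup P_conservative P_associated).
move=> z; rewrite expr1n mul1r /v sqmodM sqmod_real ler_piMl ?sqmod_ge0//.
by have /andP[k0 k1] := (kc n).2 z; rewrite expr_le1.
Qed.

Lemma od_tensor0 : od_tensor E (fun=> 0).
Proof. exact: (cutoff0 E).1. Qed.

Lemma od_tensor_lin (c : C) d1 d2 : od_tensor E d1 -> od_tensor E d2 ->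
  od_tensor E (fun z => c * d1 z + d2 z).
Proof. by move=> o1 o2; apply: od_tensor_add => //; apply: odM => //; exact: tensor_cst. Qed.

Lemma od_tensorB d1 d2 : od_tensor E d1 -> od_tensor E d2 ->
  od_tensor E (fun z => d1 z - d2 z).
Proof.
move=> o1 o2; have := od_tensor_lin (-1) o2 o1.
by congr od_tensor; apply/funext => z; rewrite mulN1r addrC.
Qed.

Lemma Omega1B w1 w2 : Omega1 E w1 -> Omega1 E w2 -> Omega1 E (fun z => w1 z - w2 z).
Proof.
move=> o1 o2; have := Omega1_lin (-1) o2 o1.
by congr Omega1; apply/funext => z; rewrite mulN1r addrC.
Qed.

Lemma Omega1D w1 w2 : Omega1 E w1 -> Omega1 E w2 -> Omega1 E (fun z => w1 z + w2 z).
Proof.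
move=> o1 o2; have := Omega1_lin 1 o1 o2.
by congr Omega1; apply/funext => z; rewrite mul1r.
Qed.

Lemma ofclassB w1 w2 : Omega1 E w1 -> Omega1 E w2 ->
  cls (fun z => w1 z - w2 z) = cls w1 - cls w2.
Proof.
move=> o1 o2; rewrite addrC -scaleN1r -(ofclass_linear H)//.
by congr cls; apply/funext => z; rewrite mulN1r addrC.
Qed.

Lemma ofclassD w1 w2 : Omega1 E w1 -> Omega1 E w2 ->
  cls (fun z => w1 z + w2 z) = cls w1 + cls w2.
Proof.
move=> o1 o2; rewrite -[cls w1]scale1r -(ofclass_linear H)//.
by congr cls; apply/funext => z; rewrite mul1r.
Qed.

Lemma ofclass0 : cls (fun=> 0) = 0.
Proof.
have o0 := O1od od_tensor0; rewrite -[RHS](subrr (cls (fun=> 0))) -ofclassB//.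
by congr cls; apply/funext => z; rewrite subrr.
Qed.

Lemma ofclassZ (c : C) w : Omega1 E w -> cls (fun z => c * w z) = c *: cls w.
Proof.
move=> o1; rewrite -[RHS]addr0 -ofclass0 -(ofclass_linear H)//; last exact: O1od od_tensor0.
by congr cls; apply/funext => z; rewrite addr0.
Qed.

Lemma cutoff_tensor (k : X * X -> R) : cutoff E k -> tensor E (fun z => (k z)%:C).
Proof. by move=> [/od_tensor_tensor]. Qed.

Lemma cutoffC_tensor (k : X * X -> R) : cutoff E k -> tensor E (fun z => (1 - k z)%:C).
Proof.
move=> /cutoff_tensor tk; have := tB (tensor_cst E 1) tk.
by congr tensor; apply/funext => z; rewrite rmorphB.
Qed.

Lemma cvg_jump_dominated (v_ : nat -> X * X -> C) (v w : X * X -> C) :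
  (forall n, tensor E (v_ n)) -> tensor E v -> Omega1 E w ->
  (forall z, sqmod (v_ n z) @[n --> \oo] --> sqmod (v z)) ->
  (forall n z, sqmod (v_ n z) <= sqmod (w z)) ->
  jmp (v_ n) @[n --> \oo] --> jmp v.
Proof.
move=> tv_ tv wO vv vw.
have me (x : X * X -> C) : tensor E x -> measurable_fun od (fun z => (sqmod (x z))%:E).
  move=> /(tensor_sqmod_measurable) mx; apply: measurable_funTS.
  exact/measurable_EFinP.
apply: (dominated_cvg mod_ (g := fun z => (sqmod (w z))%:E)).
- by move=> n; exact: me.
- by move=> z _; apply: cvg_EFin; [exact: nearW|exact: vv].
- by [].
- apply/integrableP; split; first exact: me (O1t wO).
  have -> : (\int[J]_(z in od) `|(sqmod (w z))%:E|)%E = jmp w.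
    by apply: eq_integral => z _; rewrite gee0_abs// lee_fin sqmod_ge0.
  apply: le_lt_trans (ltry (nrm (cls w) ^+ 2)).
  exact: (jump_le_ofclass).
- by move=> n z _; rewrite gee0_abs ?lee_fin ?sqmod_ge0.
Qed.

Lemma cvg_cutoff w (k : nat -> X * X -> R) z :
  (forall n, cutoff E (k n)) ->
  (forall n z, (1 - k n z) * nc (w z) <= n.+1%:R^-1) -> w z != 0 ->
  k n z @[n --> \oo] --> (1 : R).
Proof.
move=> kc kn w0.
have wp : 0 < nc (w z).
  by rewrite lt_def nc_ge0 andbT; move: w0; rewrite -sqmod_eq0 /sqmod sqrf_eq0.
apply/cvgrPdist_lt => e e0; have ew : 0 < e * nc (w z) by rewrite mulr_gt0.
have [N _ HN] := near_infty_natSinv_lt (PosNum ew).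
exists N => // n /HN /= h; have /andP[_ k1] := (kc n).2 z.
rewrite ger0_norm ?subr_ge0// -(ltr_pM2r wp).
exact: le_lt_trans (kn n z) h.
Qed.

Let realM_sqmod (x : R) (a : C) : 0 <= x <= 1 -> sqmod (x%:C * a) <= sqmod a.
Proof.
by move=> /andP[x0 x1]; rewrite sqmodM sqmod_real ler_piMl ?sqmod_ge0// expr_le1.
Qed.

Lemma cutoffC_ge0 (k : X * X -> R) z : cutoff E k -> 0 <= 1 - k z <= 1.
Proof. by move=> [_ /(_ z)/andP[k0 k1]]; rewrite subr_ge0 k1 gerBl. Qed.

Lemma cvg_jump_cutoff w (k : nat -> X * X -> R) : Omega1 E w ->
  (forall n, cutoff E (k n)) ->
  (forall n z, (1 - k n z) * nc (w z) <= n.+1%:R^-1) ->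
  jmp (fun z => (1 - k n z)%:C * w z) @[n --> \oo] --> 0%E.
Proof.
move=> wO kc kn.
have -> : 0%E = jmp (fun=> 0 : C).
  by rewrite /jump_sqnorm integral0_eq// => z _; rewrite sqmod_real expr0n.
apply: (cvg_jump_dominated (w := w)) => //.
- by move=> n; apply: tM; [exact: cutoffC_tensor|exact: O1t].
- exact: tensor_cst.
- move=> z; rewrite sqmod_real expr0n; have [w0|w0] := eqVneq (w z) 0.
    by rewrite w0; under eq_fun do rewrite mulr0 sqmod_real expr0n; exact: cvg_cst.
  have k1 := cvg_cutoff kc kn w0.
  have k0 : (fun n => 1 - k n z) @ \oo --> (0 : R).
    by rewrite -(subrr (1 : R)); apply: cvgB => //; exact: cvg_cst.
  have := cvgM (cvgM k0 k0) (cvg_cst (sqmod (w z))); rewrite !mul0r.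
  move=> /(_ _ _ _); apply: cvg_trans; apply: near_eq_cvg; apply: nearW => n /=.
  by rewrite sqmodM sqmod_real expr2.
- by move=> n z; apply: realM_sqmod; exact: cutoffC_ge0.
Qed.

Lemma cvg_jump_cutoff_mul w (k : nat -> X * X -> R) : Omega1 E w ->
  (forall n, cutoff E (k n)) ->
  (forall n z, (1 - k n z) * nc (w z) <= n.+1%:R^-1) ->
  jmp (fun z => (k n z)%:C * w z) @[n --> \oo] --> jmp w.
Proof.
move=> wO kc kn; apply: (cvg_jump_dominated (w := w)) => //.
- by move=> n; apply: tM; [exact: cutoff_tensor|exact: O1t].
- exact: O1t.
- move=> z; have [w0|w0] := eqVneq (w z) 0.
    by rewrite w0; under eq_fun do rewrite mulr0; exact: cvg_cst.
  have k1 := cvg_cutoff kc kn w0.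
  have := cvgM (cvgM k1 k1) (cvg_cst (sqmod (w z))); rewrite !mul1r.
  move=> /(_ _ _ _); apply: cvg_trans; apply: near_eq_cvg; apply: nearW => n /=.
  by rewrite sqmodM sqmod_real expr2.
- by move=> n z; apply: realM_sqmod; exact: (kc n).2.
Qed.

Lemma od_tensor_cvg0 (d_ : nat -> X * X -> C) : (forall n, od_tensor E (d_ n)) ->
  jmp (d_ n) @[n --> \oo] --> 0%E -> (fun n => cls (d_ n)) @ \oo --> (0 : H).
Proof.
move=> od_ /fine_cvgP[_ /cvgrPdist_lt c]; apply/cvgVP => e e0.
have [N _ HN] := c _ (exprn_gt0 2 e0); exists N => n /HN /=.
rewrite !sub0r nrmN normrN od_tensor_ofclass//= ger0_norm ?sqr_ge0//.
by rewrite ltr_sqr ?nnegrE ?nrm_ge0// ltW.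
Qed.

Definition od_closure : set H :=
  [set u | forall e, 0 < e -> exists2 d, od_tensor E d & nrm (u - cls d) < e].

Lemma od_closure_od d : od_tensor E d -> od_closure (cls d).
Proof. by move=> odd e e0; exists d => //; rewrite subrr nrm0. Qed.

Lemma od_closure_lin (c : C) u v : od_closure u -> od_closure v -> od_closure (c *: u + v).
Proof.
move=> Ku Kv e e0; have c1 : 0 < nc c + 1 by rewrite ltr_wpDl ?nc_ge0.
have e1 : 0 < e / 2 / (nc c + 1) by rewrite !divr_gt0.
have e2 : 0 < e / 2 by rewrite divr_gt0.
have [d od_ du] := Ku _ e1; have [d' od' dv] := Kv _ e2.
exists (fun z => c * d z + d' z); first exact: od_tensor_lin.
have dO := O1od od_; have dO' := O1od od'.
have cO : Omega1 E (fun z => c * d z) by apply: O1M => //; exact: tensor_cst.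
rewrite ofclassD// ofclassZ//.
rewrite opprD addrACA -scalerN -scalerDr (le_lt_trans (nrmD _ _))// nrmZ.
have h : (nc c + 1) * nrm (u - cls d) < e / 2 by rewrite mulrC -ltr_pdivlMr.
have := nrm_ge0 (u - cls d); move: dv h; rewrite mulrDl mul1r; lra.
Qed.

Lemma od_closure_cvg (u_ : nat -> H) u : (forall n, od_closure (u_ n)) -> u_ @ \oo --> u -> od_closure u.
Proof.
move=> Ku /cvgVP cu e e0; have e2 : 0 < e / 2 by rewrite divr_gt0.
have [N /(_ _ (leqnn N)) HN] := cu _ e2; have [d od_ du] := Ku N _ e2.
exists d => //; have := nrmD (u - u_ N) (u_ N - cls d); rewrite addrA subrK.
by move: HN du; lra.
Qed.

(** Identifies the limit u of k_n w as the projection of w to K, by showing that w - u has minimal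
    norm. The competitor d brings its own cutoffs l_n. *)
Lemma Omega1_min w d u (k : nat -> X * X -> R) : Omega1 E w ->
  (forall n, cutoff E (k n)) ->
  (forall n z, (1 - k n z) * nc (w z) <= n.+1%:R^-1) ->
  (fun n => cls (fun z => (k n z)%:C * w z)) @ \oo --> u ->
  od_tensor E d -> nrm (cls w - u) <= nrm (cls w + cls d).
Proof.
move=> wO kc kn cu odd.
have [l [lc ln]] := cutoff_sequence (O1od odd).
have tk n : tensor E (fun z => (k n z)%:C) := cutoff_tensor (kc n).
pose a n z := (1 - l n z)%:C * d z.
pose b n z := (l n z)%:C * ((1 - k n z)%:C * w z).
have oa n : od_tensor E (a n) by apply: odM => //; exact: cutoffC_tensor.
have ob n : od_tensor E (b n).
  have -> : b n = fun z => ((1 - k n z)%:C * w z) * (l n z)%:C.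
    by apply/funext => z; rewrite /b mulrC.
  by apply: odM; [apply: tM; [exact: cutoffC_tensor|exact: O1t]|exact: (lc n).1].
have O1r n : Omega1 E (fun z => (1 - k n z)%:C * w z) by apply: O1M => //; exact: cutoffC_tensor.
have O1wd : Omega1 E (fun z => w z + d z) by apply: Omega1D => //; exact: O1od.
have rE n : cls (fun z => (1 - k n z)%:C * w z) = cls w - cls (fun z => (k n z)%:C * w z).
  rewrite -ofclassB//; last exact: O1M.
  by congr cls; apply/funext => z; rewrite rmorphB/= mulrBl mul1r.
have a0 : (fun n => nrm (cls (a n))) @ \oo --> (0 : R).
  rewrite -(nrm0 H); apply: cvgV_nrm; apply: od_tensor_cvg0 => //.
  exact: cvg_jump_cutoff (O1od odd) lc ln.
have b0 : (fun n => nrm (cls (b n))) @ \oo --> (0 : R).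
  rewrite -(nrm0 H); apply: cvgV_nrm; apply: od_tensor_cvg0 => //.
  apply: (squeeze_cvge (f := fun=> 0%E) (h := fun n => jmp (fun z => (1 - k n z)%:C * w z))).
  - apply: nearW => n; rewrite jump_sqnorm_ge0/=.
    rewrite -[leRHS]mul1e; apply: (jump_sqnorm_le (M := 1)) => //.
    + by apply: measurable_funTS; apply: tensor_sqmod_measurable; exact: od_tensor_tensor.
    + by apply: measurable_funTS; apply: tensor_sqmod_measurable; exact: O1t.
    + move=> z; rewrite mul1r /b sqmodM sqmod_real ler_piMl ?sqmod_ge0//.
      by have /andP[l0 l1] := (lc n).2 z; rewrite expr_le1.
  - exact: cvg_cst.
  - exact: cvg_jump_cutoff.
have le n : nrm (cls (fun z => (1 - k n z)%:C * w z)) <=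
    nrm (cls w + cls d) + (nrm (cls (a n)) + nrm (cls (b n))).
  (* (1 - k) w = (1 - l) (1 - k) (w + d) - (1 - k) (1 - l) d + l (1 - k) w. The first term has norm
     at most that of w + d; (1 - l_n) d and l_n (1 - k_n) w are off-diagonal tensors whose norms in
     L^2(J) tend to 0. *)
  pose s z := (1 - l n z)%:C * ((1 - k n z)%:C * (w z + d z)).
  have sO : Omega1 E s by do 2 (apply: O1M; first exact: cutoffC_tensor).
  pose a' z := (1 - k n z)%:C * a n z.
  have oa' : od_tensor E a' by apply: odM => //; exact: cutoffC_tensor.
  have -> : (fun z => (1 - k n z)%:C * w z) = fun z => (s z - a' z) + b n z.
    apply/funext => z; rewrite /s /a' /a /b !rmorphB/=; ring.
  rewrite ofclassD; [|by apply: Omega1B => //; exact: O1od|exact: O1od].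
  rewrite ofclassB//; last exact: O1od.
  apply: le_trans (nrmD _ _) _; rewrite addrA lerD2r.
  apply: le_trans (nrmD _ _) _; rewrite nrmN; apply: lerD.
  - rewrite -ofclassD//; last exact: O1od.
    rewrite -[leRHS]mul1r; apply: ofclass_le => // z; rewrite expr1n mul1r.
    rewrite /s mulrA -rmorphM sqmodM sqmod_real ler_piMl ?sqmod_ge0//.
    have := cutoffC_ge0 z (lc n); have := cutoffC_ge0 z (kc n).
    by move=> /andP[x0 x1] /andP[y0 y1]; rewrite expr_le1 ?mulr_ge0// mulr_ile1.
  - rewrite -[leRHS]mul1r; apply: ofclass_le => //; [exact: O1od..|].
    move=> z; rewrite expr1n mul1r sqmodM sqmod_real ler_piMl ?sqmod_ge0//.
    by have /andP[x0 x1] := cutoffC_ge0 z (kc n); rewrite expr_le1.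
have c1 : (fun n => nrm (cls (fun z => (1 - k n z)%:C * w z))) @ \oo --> nrm (cls w - u).
  by apply: cvgV_nrm; under eq_fun do rewrite rE; apply: cvgB => //; exact: cvg_cst.
have c2 : (fun n => nrm (cls w + cls d) + (nrm (cls (a n)) + nrm (cls (b n)))) @ \oo -->
    nrm (cls w + cls d) + (0 + 0).
  by apply: cvgD; [exact: cvg_cst|exact: cvgD].
rewrite -(cvg_lim _ c1)//; have := cvg_lim (@Rhausdorff R) c2; rewrite !addr0 => <-.
apply: ler_lim; [exact: cvgP c1|exact: cvgP c2|exact: nearW].
Qed.

(** The sequence k_n w is Cauchy in H because its differences are off-diagonal tensors, whose norms
    are those of L^2(J), where (1 - k_n) w tends to 0. *)
Lemma Omega1_proj w : Omega1 E w -> exists2 u, od_closure u /\ orth (ip H) od_closure (cls w - u) &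
  jmp w = (nrm u ^+ 2)%:E.
Proof.
move=> wO; have [k [kc kn]] := cutoff_sequence wO.
pose d n z := (k n z)%:C * w z; pose r n z := (1 - k n z)%:C * w z.
have odd n : od_tensor E (d n).
  have -> : d n = fun z => w z * (k n z)%:C by apply/funext => z; rewrite /d mulrC.
  by apply: odM; [exact: O1t|exact: (kc n).1].
have [|u cu] := cauchyV (u_ := fun n => cls (d n)).
  move=> e e0; have e4 : 0 < e ^+ 2 / 4 by rewrite divr_gt0// exprn_gt0.
  have /fine_cvgP[[N1 _ fn] /cvgrPdist_lt/(_ _ e4)[N2 _ HN]] := cvg_jump_cutoff wO kc kn.
  have fnd n : (maxn N1 N2 <= n)%N ->
      (jmp (r n) < (e ^+ 2 / 4)%:E)%E.
    rewrite geq_max => /andP[n1 n2]; rewrite -(fineK (fn _ n1)) lte_fin.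
    by have := HN _ n2; rewrite /= sub0r normrN; exact/le_lt_trans/ler_norm.
  exists (maxn N1 N2) => m n /fnd hm /fnd hn.
  have oB : od_tensor E (fun z => d m z - d n z) by exact: od_tensorB.
  rewrite -ofclassB; [|exact: O1od..].
  rewrite -ltr_sqr ?nnegrE ?nrm_ge0 ?(ltW e0)// -lte_fin -od_tensor_ofclass//.
  have me n' : measurable_fun od (fun z => (sqmod (r n' z))%:E).
    apply/measurable_EFinP; apply: measurable_funTS; apply: tensor_sqmod_measurable.
    by apply: tM; [exact: cutoffC_tensor|exact: O1t].
  have pos n' z : od z -> (0 <= (sqmod (r n' z))%:E)%E.
    by move=> _; rewrite lee_fin sqmod_ge0.
  (* d_m - d_n = r_n - r_m, so its squared norm is at most twice the sum of two numbers below e^2 /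
     4. *)
  apply: (@le_lt_trans _ _ (2%:E * jmp (r n) +
      2%:E * jmp (r m))%E).
    have h2 n' : (2%:E * jmp (r n') = \int[J]_(z in od) (2%:E * (sqmod (r n' z))%:E))%E.
      by rewrite ge0_integralZl_EFin//; exact: pos.
    rewrite !h2 -ge0_integralD//; last 4 first.
    - by move=> z zo; rewrite mule_ge0 ?pos// lee_fin.
    - exact: measurable_funeM.
    - by move=> z zo; rewrite mule_ge0 ?pos// lee_fin.
    - exact: measurable_funeM.
    apply: ge0_le_integral => //.
    - by move=> z _; rewrite lee_fin sqmod_ge0.
    - apply/measurable_EFinP; apply: measurable_funTS.
      exact: (tensor_sqmod_measurable (od_tensor_tensor oB)).
    - by apply: emeasurable_funD; exact: measurable_funeM.
    - move=> z _; rewrite -!EFinM -EFinD lee_fin.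
      have -> : d m z - d n z = r n z + - r m z.
        by rewrite /d /r !rmorphB/=; ring.
      by apply: le_trans (sqmodD_le2 _ _) _; rewrite sqmodN.
  have two : (0 < 2%:E :> \bar R)%E by rewrite lte_fin.
  have -> : (e ^+ 2)%:E = (2%:E * (e ^+ 2 / 4)%:E + 2%:E * (e ^+ 2 / 4)%:E)%E.
    by rewrite -!EFinM -EFinD; congr _%:E; field.
  by apply: lteD; rewrite lte_pmul2l.
exists u.
  have Ku : od_closure u by apply: (od_closure_cvg _ cu) => n; exact: od_closure_od.
  split => // x Kx; apply: (ip_eq0_of_min ipn) => c; apply/ler_addgt0Pl => e e0.
  (* c x - u belongs to K; a tensor within e of it reduces minimality over K to [Omega1_min]. *)
  have [d' od' hd'] := od_closure_lin c Kx (od_closure_lin (-1) Ku (od_closure_od od_tensor0)) e0.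
  have := Omega1_min wO kc kn cu od'.
  move: hd'; rewrite (ofclass0) addr0 scaleN1r => hd'.
  move/le_trans; apply; set y := c *: x - u in hd'.
  have := nrmD (cls w + y) (cls d' - y).
  rewrite -addrA [y + _]addrC subrK [nrm (cls d' - y)]nrmB.
  have -> : cls w - u + c *: x = cls w + y by rewrite /y addrAC addrA.
  by move: hd'; lra.
have c1 : jmp (d n) @[n --> \oo] --> jmp w by exact: cvg_jump_cutoff_mul.
have c2 : jmp (d n) @[n --> \oo] --> (nrm u ^+ 2)%:E.
  under eq_fun do rewrite od_tensor_ofclass//.
  apply: cvg_EFin; first exact: nearW.
  have cn := cvgV_nrm cu; rewrite expr2.
  have := cvgM cn cn; move=> /(_ _ _ _); apply: cvg_trans.
  by apply: near_eq_cvg; apply: nearW => n /=; rewrite expr2.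
exact: (cvg_unique _ c1 c2).
Qed.

Lemma Omega1_seq u : exists w_ : nat -> X * X -> C,
  (forall n, Omega1 E (w_ n)) /\ (fun n => cls (w_ n)) @ \oo --> u.
Proof.
have ex (n : nat) : exists w, Omega1 E w /\ nrm (u - cls w) < n.+1%:R^-1.
  have e0 : 0 < (n.+1%:R^-1)%:C :> C by rewrite ltcR invr_gt0.
  have ne : (ball u (n.+1%:R^-1)%:C)^° !=set0 by exists u; exact: nbhsx_ballx.
  have [x [/interior_subset bu [w wO wu]]] := ofclass_dense (o := H) ne (@open_interior _ _).
  by exists w; split => //; move: bu; rewrite -wu -ball_normE /ball_/= nrmE ltcR.
have [w_ /all_and2[wO wu]] := choice ex; exists w_; split => //.
apply/cvgVP => e e0; have [N _ HN] := near_infty_natSinv_lt (PosNum e0).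
by exists N => n /HN; apply: lt_trans.
Qed.

Lemma all_has_proj u : has_proj (ip H) od_closure u.
Proof.
have [w_ [wO wu]] := Omega1_seq u; apply: (has_proj_cvg ipn od_closure_lin od_closure_cvg _ wu) => n.
by have [v [Kv ov] _] := Omega1_proj (wO n); exists v.
Qed.

Definition jump_proj u : H := orth_proj (ip H) od_closure u.

Lemma jump_projP u : od_closure (jump_proj u) /\ orth (ip H) od_closure (u - jump_proj u).
Proof. exact: (has_projP ipn od_closure_lin (all_has_proj u)). Qed.

Lemma jump_proj_lin (c : C) u v : jump_proj (c *: u + v) = c *: jump_proj u + jump_proj v.
Proof. exact: (orth_proj_lin ipn od_closure_lin c (all_has_proj u) (all_has_proj v)). Qed.

Lemma jump_proj_cvg (u_ : nat -> H) u : u_ @ \oo --> u -> (fun n => jump_proj (u_ n)) @ \oo --> jump_proj u.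
Proof.
by apply: (orth_proj_cvg ipn od_closure_lin) => [n|]; exact: all_has_proj.
Qed.

Lemma jump_proj_id u : od_closure u -> jump_proj u = u.
Proof.
move=> Ku; apply: (orth_proj_eq ipn od_closure_lin) => //.
by move=> k _; rewrite subrr -(scale0r (0 : H)) ipZl mul0r.
Qed.

Lemma jump_proj_ofclass w : Omega1 E w -> jmp w = (nrm (jump_proj (cls w)) ^+ 2)%:E.
Proof.
by move=> /Omega1_proj[u [Ku ou] ->]; congr ((nrm _ ^+ 2)%:E); rewrite /jump_proj (orth_proj_eq ipn od_closure_lin Ku ou).
Qed.

Lemma cvg_nrm_sq (u_ : nat -> H) u : u_ @ \oo --> u ->
  (nrm (u_ n) ^+ 2)%:E @[n --> \oo] --> (nrm u ^+ 2)%:E.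
Proof.
move=> cu; apply: cvg_EFin; first exact: nearW.
have cn := cvgV_nrm cu; have := cvgM cn cn; move=> /(_ _ _ _); rewrite expr2; apply: cvg_trans.
by apply: near_eq_cvg; apply: nearW => n /=; rewrite expr2.
Qed.

(** The value chosen by [get] is pinned down by the uniqueness of limits along one approximating
    sequence, so the existence of such a sequence is an assumption. *)
Lemma extend_along_eq (S : set (X * X -> C)) (G : (X * X -> C) -> \bar R) u (v : \bar R) :
  (exists w_ : nat -> X * X -> C, (forall n, S (w_ n)) /\ (fun n => cls (w_ n)) @ \oo --> u) ->
  (forall w_ : nat -> X * X -> C, (forall n, S (w_ n)) ->
    (fun n => cls (w_ n)) @ \oo --> u -> (fun n => G (w_ n)) @ \oo --> v) ->
  extend_along S G u = v.
Proof.
move=> [w_ [wS wu]] hv; rewrite /extend_along; case: xgetP => [x _ /(_ _ wS wu) cx|/(_ v)//].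
by apply: (cvg_unique _ cx (hv _ wS wu)).
Qed.

Lemma extend_along_jump u : extend_along (Omega1 E) jmp u = (nrm (jump_proj u) ^+ 2)%:E.
Proof.
apply: extend_along_eq => [|w_ wO wu]; first exact: Omega1_seq.
by under eq_fun do rewrite jump_proj_ofclass//; apply: cvg_nrm_sq; exact: jump_proj_cvg.
Qed.

Lemma HcE u : Hc J u <-> jump_proj u = 0.
Proof.
rewrite /Hc/= extend_along_jump; split=> [[/eqP]|->]; last by rewrite nrm0 expr0n.
by rewrite sqrf_eq0 => /eqP; exact: nrm_eq0.
Qed.

Lemma jump_projB u v : jump_proj (u - v) = jump_proj u - jump_proj v.
Proof. by rewrite addrC -scaleN1r jump_proj_lin scaleN1r addrC. Qed.

Lemma jump_proj_idem u : jump_proj (u - jump_proj u) = 0.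
Proof. by rewrite jump_projB (jump_proj_id (jump_projP u).1) subrr. Qed.

Lemma Hc_partE u : Hc_part J u = u - jump_proj u.
Proof.
have orthP (w : H) : Hc J w -> forall k, od_closure k -> ip H w k = 0.
  by move=> /HcE w0 k Kk; have := (jump_projP w).2 _ Kk; rewrite w0 subr0.
rewrite /Hc_part; case: xgetP => [v _ [Hv ov]|/(_ (u - jump_proj u))/= []]; last first.
  split=> [|w Hw]; first by apply/HcE; exact: jump_proj_idem.
  by rewrite opprB addrC subrK (ipC _ (jump_proj u)) (orthP _ Hw) ?rmorph0//; exact: (jump_projP u).1.
apply/eqP; rewrite -subr_eq0; apply/eqP; apply: nrm_eq0; apply/eqP; rewrite -sqrf_eq0.
suff : ip H (v - (u - jump_proj u)) (v - (u - jump_proj u)) = 0.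
  by rewrite (ip_nrm ipn) => /(congr1 (@complex.Re R))/= ->.
have Hd : Hc J (v - (u - jump_proj u)).
  by apply/HcE; rewrite jump_projB jump_proj_idem subr0; exact/HcE.
have vE : v - (u - jump_proj u) = jump_proj u - (u - v) by rewrite !opprB addrCA addrC.
rewrite {1}vE ipBl ov// (ipC _ (jump_proj u)) (orthP _ Hd) ?rmorph0 ?subrr//; exact: (jump_projP u).1.
Qed.

Lemma Hj_partE u : Hj_part J u = jump_proj u.
Proof. by rewrite /Hj_part Hc_partE opprB addrC subrK. Qed.

Lemma Hc_part_lin (c : C) u v : Hc_part J (c *: u + v) = c *: Hc_part J u + Hc_part J v.
Proof. by rewrite !Hc_partE jump_proj_lin opprD addrACA -scalerN -scalerDr. Qed.

Lemma Hc_part_cvg (u_ : nat -> H) u : u_ @ \oo --> u ->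
  (fun n => Hc_part J (u_ n)) @ \oo --> Hc_part J u.
Proof.
move=> cu; rewrite Hc_partE; under eq_fun do rewrite Hc_partE.
by apply: cvgB => //; exact: jump_proj_cvg.
Qed.

Lemma Hc_part_sq w : Omega1 E w ->
  ((nrm (cls w) ^+ 2)%:E = (nrm (Hc_part J (cls w)) ^+ 2)%:E + jmp w)%E.
Proof.
move=> wO; rewrite jump_proj_ofclass// Hc_partE -EFinD addrC; congr _%:E.
exact: (orth_proj_sq ipn od_closure_lin (all_has_proj (cls w))).
Qed.

Lemma Hc_part_od_closure u : od_closure u -> Hc_part J u = 0.
Proof. by move=> Ku; rewrite Hc_partE (jump_proj_id Ku) subrr. Qed.

(** Only w1 is cut off: (1 - k) w1 is uniformly at most e / (|w2| + 1), so (1 - k) w1 w2 has norm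
    below e in H. *)
Lemma od_closure_mul w1 w2 : Omega1 E w1 -> Omega1 E w2 -> od_closure (cls (fun z => w1 z * w2 z)).
Proof.
move=> o1 o2 e e0; have n1 : 0 < nrm (cls w2) + 1 by rewrite ltr_wpDl ?nrm_ge0.
have e1 : 0 < e / (nrm (cls w2) + 1) by rewrite divr_gt0.
have [k kc kn] := cutoff_Omega1 P_semigroup P_conservative P_associated o1 e1.
pose d z := (w1 z * w2 z) * (k z)%:C.
have odd : od_tensor E d by apply: odM; [apply: tM; exact: O1t|exact: kc.1].
have O12 : Omega1 E (fun z => w1 z * w2 z) by apply: O1M => //; exact: O1t.
exists d => //; rewrite -ofclassB//; last exact: O1od.
apply: le_lt_trans (_ : e / (nrm (cls w2) + 1) * nrm (cls w2) < e); last first.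
  by rewrite -mulrA gtr_pMr// mulrC ltr_pdivrMr// mul1r ltrDl.
apply: ofclass_le => //; [by apply: Omega1B => //; exact: O1od|exact: ltW|].
move=> z; have -> : w1 z * w2 z - d z = ((1 - k z)%:C * w1 z) * w2 z.
  by rewrite /d rmorphB/=; ring.
rewrite [sqmod (_ * w2 z)]sqmodM ler_wpM2r ?sqmod_ge0// sqmodM sqmod_real -exprMn.
rewrite ler_sqr ?nnegrE ?(ltW e1)//.
by rewrite mulr_ge0 ?nc_ge0//; have /andP[] := cutoffC_ge0 z kc.
Qed.

Lemma od_closure_seq u : od_closure u -> exists d_ : nat -> X * X -> C,
  (forall n, od_tensor E (d_ n)) /\ (fun n => cls (d_ n)) @ \oo --> u.
Proof.
move=> Ku; have ex (n : nat) : exists d, od_tensor E d /\ nrm (u - cls d) < n.+1%:R^-1.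
  by have [|d od_ du] := Ku n.+1%:R^-1; [rewrite invr_gt0|exists d].
have [d_ /all_and2[odd du]] := choice ex; exists d_; split => //.
apply/cvgVP => e e0; have [N _ HN] := near_infty_natSinv_lt (PosNum e0).
by exists N => n /HN; apply: lt_trans.
Qed.

(** * The right action respects the splitting of H *)

Section right_action.
Variable h : X -> C.
Hypothesis hC : core_cst E h.

Lemma ractlin (c : C) u v : ract h (c *: u + v) = c *: ract h u + ract h v.
Proof. exact: (ract_linear (o := H)). Qed.

Lemma ract0 : ract h (0 : H) = 0.
Proof. by have := ractlin (-1) 0 0; rewrite scaler0 addr0 scaleN1r addNr. Qed.

Lemma ract_ofclass w : Omega1 E w -> ract h (cls w) = cls (fun z => w z * h z.2).
Proof.
move=> [n [c [f [g [fg ->]]]]]; elim: n => [|n IHn] in c f g fg *.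
  under [in RHS]eq_fun do rewrite big_ord0 mul0r.
  under eq_fun do rewrite big_ord0.
  by rewrite (ofclass0) ract0.
have [f0 g0] := fg ord0.
have o0 : Omega1 E (elem_form (f ord0) (g ord0)) by exact: Omega1_elem.
have fg' : forall k : 'I_n, core_cst E (f (lift ord0 k)) /\ core_cst E (g (lift ord0 k)) by [].
have o' : Omega1 E (fun z => \sum_(k < n) c (lift ord0 k) * elem_form (f (lift ord0 k)) (g (lift ord0 k)) z).
  by exists n, (fun k => c (lift ord0 k)), (fun k => f (lift ord0 k)), (fun k => g (lift ord0 k)).
under eq_fun do rewrite big_ord_recl.
rewrite (ofclass_linear H)// ractlin ract_elem// IHn//.
rewrite -(ofclass_linear H); last 2 first.
- apply: Omega1_elem => //; exact: (core_cstM P_semigroup P_conservative P_associated).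
- under eq_fun do rewrite mulrC; apply: O1M => //.
  exact: (tensor_snd hC).
by congr cls; apply/funext => z; rewrite big_ord_recl mulrDl /elem_form; ring.
Qed.

Lemma ract_cvg (u_ : nat -> H) u : u_ @ \oo --> u ->
  (fun n => ract h (u_ n)) @ \oo --> ract h u.
Proof. by move=> cu; apply: continuous_cvg => //; exact: (ract_continuous (o := H)). Qed.

(** Multiplication by the bounded function h(y) is bounded in L^2(J), and the norm of the projection
    to K is the norm of L^2(J). In particular the action preserves H_c, the kernel of the
    projection. *)
Lemma ract_pj_le : exists M : R, forall u, nrm (jump_proj (ract h u)) <= M * nrm (jump_proj u).
Proof.
have [M M0 hM] := core_cst_bounded hC; exists M => u.
have th : tensor E (fun z => h z.2) by exact: tensor_snd.
have le w : Omega1 E w -> nrm (jump_proj (ract h (cls w))) <= M * nrm (jump_proj (cls w)).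
  move=> wO; rewrite ract_ofclass//.
  have wO' : Omega1 E (fun z => w z * h z.2) by under eq_fun do rewrite mulrC; exact: O1M.
  rewrite -ler_sqr ?nnegrE ?mulr_ge0 ?nrm_ge0// exprMn -lee_fin.
  rewrite (EFinM (M ^+ 2) (nrm (jump_proj (cls w)) ^+ 2)) -!jump_proj_ofclass//.
  apply: (jump_sqnorm_le) => //; [| |exact: sqr_ge0|].
  - by apply: measurable_funTS; apply: tensor_sqmod_measurable; exact: O1t.
  - by apply: measurable_funTS; apply: tensor_sqmod_measurable; exact: O1t.
  - move=> z; rewrite sqmodM mulrC ler_wpM2r ?sqmod_ge0// /sqmod ler_sqr ?nnegrE ?nc_ge0//.
have [w_ [wO wu]] := Omega1_seq u.
have c1 := cvgV_nrm (jump_proj_cvg (ract_cvg wu)).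
have c2 : (fun n => M * nrm (jump_proj (cls (w_ n)))) @ \oo --> M * nrm (jump_proj u).
  by apply: cvgM; [exact: cvg_cst|exact: (cvgV_nrm (jump_proj_cvg wu))].
by apply: (ler_cvg_to c1 c2); apply: nearW => n; exact: le.
Qed.

Lemma ract_Kod u : od_closure u -> od_closure (ract h u).
Proof.
move=> /od_closure_seq[d_ [odd cd]].
apply: (od_closure_cvg _ (ract_cvg cd)) => n.
rewrite /= ract_ofclass; last exact: O1od.
apply: od_closure_od; under eq_fun do rewrite mulrC.
by apply: odM => //; exact: tensor_snd.
Qed.

(** The action preserves K, since off-diagonal tensors form an ideal among tensors, and it preserves
    H_c; hence it commutes with the projections. *)
Lemma ract_Hc_part u : Hc_part J (ract h u) = ract h (Hc_part J u).
Proof.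
suff pjr : jump_proj (ract h u) = ract h (jump_proj u).
  by rewrite !Hc_partE pjr [u - _]addrC -(scaleN1r (jump_proj u)) ractlin scaleN1r addrC.
have [M hM] := ract_pj_le; have := hM (u - jump_proj u).
rewrite jump_proj_idem nrm0 mulr0 => le0.
have /nrm_eq0 : nrm (jump_proj (ract h (u - jump_proj u))) = 0 by apply/eqP; rewrite eq_le le0 nrm_ge0.
rewrite [u - _]addrC -scaleN1r ractlin jump_proj_lin (jump_proj_id (ract_Kod (jump_projP u).1)) scaleN1r addrC.
by move/eqP; rewrite subr_eq0 => /eqP.
Qed.

End right_action.

(** * The energy of f twisted by a real 1-form *)

Lemma binomial_remainder (v : X * X -> C) n : tensor E v -> exists2 T, tensor E T &
  forall z, (1 + v z) ^+ n = 1 + n%:R * v z + v z * (v z * T z).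
Proof.
move=> tv; elim: n => [|n [T tT hT]].
  exists (fun=> 0) => [|z]; first exact: tensor_cst.
  by rewrite expr0 mul0r !mulr0 !addr0.
exists (fun z => T z * (1 + v z) + n%:R) => [|z].
  apply: tensor_add; last exact: tensor_cst.
  by apply: tM => //; apply: tensor_add => //; exact: tensor_cst.
by rewrite exprSr hT -natr1; ring.
Qed.

Definition linear_twist w (f : X -> C) : X * X -> C :=
  fun z => elem_form f (fun=> 1) z - ('i%C * w z) * f z.2.

Lemma linear_twist_Omega1 w f : Omega1 E w -> core_cst E f -> Omega1 E (linear_twist w f).
Proof.
move=> wO fC; apply: Omega1B; first by apply: Omega1_elem => //; exact: core_cst_cst.
under eq_fun do rewrite mulrAC; apply: O1M => //.
by apply: tM; [exact: tensor_cst|exact: tensor_snd].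
Qed.

Lemma linear_twist_class w f : Omega1 E w -> core_cst E f ->
  Hc_part J (cls (linear_twist w f)) = magnetic_derivative_c J (cls w) f.
Proof.
move=> wO fC.
have wf : Omega1 E (fun z => w z * f z.2).
  by under eq_fun do rewrite mulrC; apply: O1M => //; exact: tensor_snd.
have -> : linear_twist w f = fun z => - 'i%C * (w z * f z.2) + elem_form f (fun=> 1) z.
  by apply/funext => z; rewrite /linear_twist; ring.
rewrite (ofclass_linear H)//; last by apply: Omega1_elem => //; exact: core_cst_cst.
rewrite Hc_part_lin addrC /magnetic_derivative_c scaleNr; congr (_ - _ *: _).
rewrite -(ract_ofclass fC wO).
exact: (ract_Hc_part fC).
Qed.

(** y is f(x) - (1 + v)^m f(y) with v = i w / m. It is a 1-form, and it differs from the linear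
    twist by v times v T f(y), a product of two 1-forms, which has no component in H_c. *)
Lemma twisted_approx w f (e : R) : Omega1 E w -> real_valued w -> core_cst E f -> 0 < e ->
  exists y, [/\ Omega1 E y, Hc_part J (cls y) = Hc_part J (cls (linear_twist w f)) &
    forall z, nc (twisted_diff w f z - y z) <= e * nc (w z)].
Proof.
move=> wO wr fC e0; have [M M0 wM] := tensor_bounded (O1t wO).
have [N N0 fN] := core_cst_bounded fC.
(* c / m.+1 is the constant of [eir_approx] times the bound N of f; m is chosen to make it at most
   e. *)
pose c := 2 * expR M * M * N.
have c0 : 0 <= c by rewrite !mulr_ge0// expR_ge0.
have ec : 0 < e / (c + 1) by rewrite divr_gt0// ltr_wpDl.
have [m _ /(_ _ (leqnn m))/= hm] := near_infty_natSinv_lt (PosNum ec).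
pose v z := ('i%C * (m.+1%:R^-1)%:C) * w z.
have vO : Omega1 E v by apply: O1M => //; exact: tensor_cst.
have [T tT hT] := binomial_remainder m.+1 (O1t vO).
have vTO : Omega1 E (fun z => v z * T z * f z.2).
  under eq_fun do rewrite -mulrA mulrC; apply: O1M => //.
  by apply: tM => //; exact: tensor_snd.
have lO := linear_twist_Omega1 wO fC.
have vvO : Omega1 E (fun z => v z * (v z * T z * f z.2)) by apply: O1M => //; exact: O1t.
pose y z := linear_twist w f z - v z * (v z * T z * f z.2).
have wE z : w z = (Re (w z))%:C by apply: eqC => //=; exact: wr.
have yE z : y z = f z.1 - (1 + v z) ^+ m.+1 * f z.2.
  have mv : m.+1%:R * v z = 'i%C * w z.
    rewrite /v mulrA mulrCA -[m.+1%:R * _]mulrC -!mulrA; congr (_ * _).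
    by rewrite mulrA fmorphV/= rmorph_nat mulVf ?mul1r// pnatr_eq0.
  by rewrite hT mv /y /linear_twist /elem_form; ring.
exists y; split.
- exact: Omega1B.
- rewrite ofclassB// -scaleN1r addrC Hc_part_lin (Hc_part_od_closure (u := cls _)) ?scaler0 ?add0r//.
  exact: (od_closure_mul vO vTO).
move=> z; rewrite yE /twisted_diff.
have -> : f z.1 - expc ('i%C * w z) * f z.2 - (f z.1 - (1 + v z) ^+ m.+1 * f z.2) =
  - ((expc ('i%C * w z) - (1 + v z) ^+ m.+1) * f z.2) by ring.
rewrite ncN ncM (expc_eir (wr z)).
have -> : v z = 'i%C * (Re (w z) / m.+1%:R)%:C.
  by rewrite /v {1}wE rmorphM/= -mulrA; congr (_ * _); rewrite mulrC.
have sM : `|Re (w z)| <= M := le_trans (nc_Re _) (wM z).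
apply: (@le_trans _ _ ((2 * expR M * M) * m.+1%:R^-1 * nc (w z) * N)).
  apply: ler_pM => //; [exact: nc_ge0..|].
  apply: le_trans (eir_approx m sM) _; rewrite ler_wpM2l ?nc_Re//.
  by rewrite !mulr_ge0 ?expR_ge0.
have -> : 2 * expR M * M * m.+1%:R^-1 * nc (w z) * N = (c * m.+1%:R^-1) * nc (w z).
  by rewrite /c; ring.
rewrite ler_wpM2r ?nc_ge0//.
have c1 : 0 < c + 1 by rewrite ltr_wpDl.
move: hm; rewrite ltr_pdivlMr// mulrDr mulr1 => hm.
have : 0 <= m.+1%:R^-1 :> R by rewrite invr_ge0.
by move: hm; move: m.+1%:R^-1 => x; rewrite [x * c]mulrC; lra.
Qed.

Lemma half_Pi_bound (x y u v : X * X -> C) (k t : R) : 0 < t -> 0 <= k ->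
  measurable_fun [set: borel X * borel X] (fun z => sqmod (x z)) ->
  measurable_fun [set: borel X * borel X] (fun z => sqmod (y z)) ->
  measurable_fun [set: borel X * borel X] (fun z => sqmod (u z)) ->
  measurable_fun [set: borel X * borel X] (fun z => sqmod (v z)) ->
  (forall z, sqmod (x z) <= sqmod (y z) + k * (sqmod (u z) + sqmod (v z))) ->
  (half_Pi_sqnorm mu P t x <= half_Pi_sqnorm mu P t y +
    k%:E * (half_Pi_sqnorm mu P t u + half_Pi_sqnorm mu P t v))%E.
Proof.
move=> t0 k0 mx my mu_ mv h; rewrite !half_Pi_sqnormE//.
have c0 : (0 <= (2 * t)^-1%:E :> \bar R)%E by rewrite lee_fin invr_ge0 mulr_ge0// ltW.
rewrite -ge0_muleDr; [|by apply: integral_ge0 => z _; rewrite lee_fin sqmod_ge0..].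
rewrite muleCA -ge0_muleDr; last 2 first.
- by apply: integral_ge0 => z _; rewrite lee_fin sqmod_ge0.
- rewrite mule_ge0 ?lee_fin// adde_ge0//; apply: integral_ge0 => z _; rewrite lee_fin sqmod_ge0//.
by apply: lee_wpmul2l => //; apply: integral_sqmod_le.
Qed.

Lemma half_Pi_fine_cvg w : Omega1 E w ->
  (\forall t \near 0^'+, half_Pi_sqnorm mu P t w \is a fin_num) /\
  fine (half_Pi_sqnorm mu P t w) @[t --> 0^'+] --> nrm (cls w) ^+ 2.
Proof. by move=> /half_Pi_cvg/fine_cvgP. Qed.

Lemma expc_measurable (disp : measure_display) (T : measurableType disp) (D : set T)
    (w : T -> C) :
  measurable_fun D (fun z => Re (w z)) -> measurable_fun D (fun z => Im (w z)) ->
  measurable_fun D (fun z => Re (expc ('i%C * w z))) /\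
  measurable_fun D (fun z => Im (expc ('i%C * w z))).
Proof.
move=> mr mi.
have mexp : measurable_fun D (fun z => expR (- Im (w z))).
  by apply: measurableT_comp => //; exact: measurable_funN.
have mcos : measurable_fun D (fun z => cos (Re (w z))).
  apply: measurableT_comp => //; apply: continuous_measurable_fun; exact: continuous_cos.
have msin : measurable_fun D (fun z => sin (Re (w z))).
  apply: measurableT_comp => //; apply: continuous_measurable_fun; exact: continuous_sin.
have eE z : expc ('i%C * w z) = (expR (- Im (w z)))%:C * (cos (Re (w z)) +i* sin (Re (w z))).
  by rewrite /expc ReM ImM/= !mul0r !mul1r !add0r.
split.
- under eq_fun do rewrite eE ReM/= mul0r subr0; exact: measurable_funM.
- under eq_fun do rewrite eE ImM/= mul0r addr0; exact: measurable_funM.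
Qed.

Lemma twisted_measurable (D : set (borel X * borel X)) w f :
  measurable D -> core_cst E f ->
  measurable_fun D (fun z => Re (w z)) -> measurable_fun D (fun z => Im (w z)) ->
  measurable_fun D (fun z => Re (twisted_diff w f z)) /\
  measurable_fun D (fun z => Im (twisted_diff w f z)).
Proof.
move=> mD fC mr mi; have [er ei] := expc_measurable mr mi.
have [f1r f1i] := tensor_measurable (tensor_fst fC).
have [f2r f2i] := tensor_measurable (tensor_snd fC).
have m1r := measurable_funTS f1r (D := D); have m1i := measurable_funTS f1i (D := D).
have m2r := measurable_funTS f2r (D := D); have m2i := measurable_funTS f2i (D := D).
rewrite /twisted_diff; split.
- under eq_fun do rewrite ReB ReM.
  by apply: measurable_funB => //; apply: measurable_funB; exact: measurable_funM.
- under eq_fun do rewrite ImB ImM.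
  by apply: measurable_funB => //; apply: measurable_funD; exact: measurable_funM.
Qed.

(** The exponential takes the twisted difference out of the 1-forms, so it is compared with the
    approximants y at error r |w|. For y the squared norm splits into the H_c part and the jump
    part. Passing from y to the twisted difference costs at most r c (|df|^2 + |w|^2), for Pi_t as
    well as for J, and r is arbitrary. *)
Lemma twisted_limit w f : Omega1 E w -> real_valued w -> core_cst E f ->
  half_Pi_sqnorm mu P t (twisted_diff w f) @[t --> 0^'+] -->
    ((nrm (magnetic_derivative_c J (cls w) f) ^+ 2)%:E + jmp (twisted_diff w f))%E /\
  (jmp (twisted_diff w f) < +oo)%E.
Proof.
move=> wO wr fC; have [N N0 fN] := core_cst_bounded fC.
set th := twisted_diff w f; pose df := elem_form f (fun=> 1 : C).
have dfO : Omega1 E df by apply: Omega1_elem => //; exact: core_cst_cst.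
(* The constant results from |th|^2 <= (1 + e) |y|^2 + 2 e |w|^2 and the same with th and y
   exchanged, together with e <= 1 and |th|^2 <= 2 |df|^2 + 2 N^2 |w|^2. *)
pose c := 4 * N ^+ 2 + 4.
have c0 : 0 < c by rewrite /c; have := sqr_ge0 N; lra.
have th_le z : sqmod (th z) <= 2 * sqmod (df z) + 2 * N ^+ 2 * sqmod (w z).
  have -> : th z = df z + (1 - expc ('i%C * w z)) * f z.2.
    by rewrite /th /twisted_diff /df /elem_form; ring.
  apply: le_trans (sqmodD_le2 _ _) _; rewrite lerD2l -mulrA ler_wpM2l//.
  rewrite sqmodM mulrC; apply: ler_pM; rewrite ?sqmod_ge0//.
    by rewrite /sqmod ler_sqr ?nnegrE ?nc_ge0.
  rewrite (expc_eir (wr z)) (_ : 1 = eir 0); last by rewrite /eir cos0 sin0.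
  apply: le_trans (sqmod_eirB _ _) _; rewrite sub0r sqrrN sqmodE lerDl sqr_ge0//.
have cmp (e : R) (y : X * X -> C) : 0 < e -> e <= 1 ->
    (forall z, nc (th z - y z) <= e * nc (w z)) ->
    (forall z, sqmod (th z) <= sqmod (y z) + e * c * (sqmod (df z) + sqmod (w z))) /\
    (forall z, sqmod (y z) <= sqmod (th z) + e * c * (sqmod (df z) + sqmod (w z))).
  move=> e0 e1 hy.
  have hd z : sqmod (th z - y z) <= e ^+ 2 * sqmod (w z).
    rewrite /sqmod -exprMn ler_sqr ?nnegrE ?nc_ge0// mulr_ge0 ?nc_ge0//; exact: ltW.
  have hd' z : (1 + e^-1) * sqmod (th z - y z) <= 2 * e * sqmod (w z).
    apply: (@le_trans _ _ ((1 + e^-1) * (e ^+ 2 * sqmod (w z)))).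
      by rewrite ler_wpM2l// addr_ge0// invr_ge0 ltW.
    have -> : (1 + e^-1) * (e ^+ 2 * sqmod (w z)) = (e ^+ 2 + e) * sqmod (w z).
      by field; rewrite gt_eqF.
    rewrite ler_wpM2r ?sqmod_ge0//; nra.
  have t1 z : sqmod (th z) <= (1 + e) * sqmod (y z) + 2 * e * sqmod (w z).
    have {1}-> : th z = y z + (th z - y z) by rewrite addrC subrK.
    by apply: le_trans (sqmodD_le _ _ e0) _; rewrite lerD2l hd'.
  have t2 z : sqmod (y z) <= (1 + e) * sqmod (th z) + 2 * e * sqmod (w z).
    have {1}-> : y z = th z + - (th z - y z) by rewrite opprB addrC subrK.
    by apply: le_trans (sqmodD_le _ _ e0) _; rewrite sqmodN lerD2l hd'.
  have eN := sqr_ge0 N.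
  split=> z; have := t1 z; have := t2 z; have := th_le z; have := sqmod_ge0 (w z);
    have := sqmod_ge0 (df z); have := sqmod_ge0 (th z); have := sqmod_ge0 (y z);
    rewrite /c; move: (sqmod (y z)) (sqmod (th z)) (sqmod (df z)) (sqmod (w z)) eN;
    move: (N ^+ 2) => n2 Y T D W n20 Y0 T0 D0 W0 hT hY hT2.
  - have eY : e * Y <= e * (2 * T + 2 * W) by rewrite ler_wpM2l ?(ltW e0)//; nra.
    have eT : e * T <= e * (2 * D + 2 * n2 * W) by rewrite ler_wpM2l// ltW.
    have nD : 0 <= e * n2 * D by rewrite !mulr_ge0// ltW.
    nra.
  - have eT : e * T <= e * (2 * D + 2 * n2 * W) by rewrite ler_wpM2l// ltW.
    have nD : 0 <= e * n2 * D by rewrite !mulr_ge0// ltW.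
    have nW : 0 <= e * n2 * W by rewrite !mulr_ge0// ltW.
    have eD : 0 <= e * D by rewrite mulr_ge0// ltW.
    have eW : 0 <= e * W by rewrite mulr_ge0// ltW.
    nra.
have mO (x : X * X -> C) : Omega1 E x -> measurable_fun [set: borel X * borel X] (fun z => sqmod (x z)).
  by move=> xO; apply: tensor_sqmod_measurable; exact: O1t.
have mth : measurable_fun [set: borel X * borel X] (fun z => sqmod (th z)).
  have [mr mi] := tensor_measurable (O1t wO).
  by have [] := twisted_measurable measurableT fC mr mi; exact: sqmod_measurable.
have jfin (x : X * X -> C) : Omega1 E x -> jmp x \is a fin_num.
  by move=> xO; rewrite ge0_fin_numE ?jump_sqnorm_ge0// (le_lt_trans (jump_le_ofclass xO))// ltry.
have cmpE (e : R) (y : X * X -> C) : 0 < e -> e <= 1 -> Omega1 E y ->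
    (forall z, nc (th z - y z) <= e * nc (w z)) ->
    [/\ (forall t, 0 < t -> (half_Pi_sqnorm mu P t th <= half_Pi_sqnorm mu P t y +
        (e * c)%:E * (half_Pi_sqnorm mu P t df + half_Pi_sqnorm mu P t w))%E),
      (forall t, 0 < t -> (half_Pi_sqnorm mu P t y <= half_Pi_sqnorm mu P t th +
        (e * c)%:E * (half_Pi_sqnorm mu P t df + half_Pi_sqnorm mu P t w))%E),
      (jmp th <= jmp y + (e * c)%:E * (jmp df + jmp w))%E &
      (jmp y <= jmp th + (e * c)%:E * (jmp df + jmp w))%E].
  move=> e0 e1 yO hy; have [h1 h2] := cmp _ _ e0 e1 hy.
  have k0 : 0 <= e * c by rewrite mulr_ge0// ltW.
  split.
  - by move=> t t0; apply: half_Pi_bound => //; exact: mO.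
  - by move=> t t0; apply: half_Pi_bound => //; exact: mO.
  - by apply: integral_sqmod_le => //; apply: measurable_funTS => //; exact: mO.
  - by apply: integral_sqmod_le => //; apply: measurable_funTS => //; exact: mO.
have jthn : jmp th \is a fin_num.
  have [y [yO _ hy]] := twisted_approx wO wr fC ltr01.
  have [_ _ le1 _] := cmpE _ _ ltr01 (lexx 1) yO hy.
  exact: (bound_fin_num (jump_sqnorm_ge0 _) (jfin _ yO) (jfin _ dfO) (jfin _ wO) le1).
split; last by rewrite -ge0_fin_numE ?jump_sqnorm_ge0.
rewrite -(fineK jthn) -EFinD; set A := nrm (magnetic_derivative_c _ _ _) ^+ 2.
have [fdf cdf] := half_Pi_fine_cvg dfO; have [fw cw] := half_Pi_fine_cvg wO.
have h0 (x : X * X -> C) t : 0 < t -> (0 <= half_Pi_sqnorm mu P t x)%E.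
  move=> t0; rewrite mule_ge0 ?lee_fin ?invr_ge0 ?mulr_ge0 ?(ltW t0)//.
  apply: integral_ge0 => z _; apply: integral_ge0 => z' _.
  by rewrite lee_fin sqmod_ge0.
have near_th : \forall t \near 0^'+, half_Pi_sqnorm mu P t th \is a fin_num.
  have [y [yO _ hy]] := twisted_approx wO wr fC ltr01.
  have [+ _ _ _] := cmpE _ _ ltr01 (lexx 1) yO hy => le1.
  have [fy _] := half_Pi_fine_cvg yO.
  have t0 := nbhs_right_gt (0 : R).
  apply: filterS (filterI (filterI fy t0) (filterI fdf fw)) => t [[ft {}t0] [fd' fw']].
  exact: (bound_fin_num (h0 _ _ t0) ft fd' fw' (le1 _ t0)).
suff : fine (half_Pi_sqnorm mu P t th) @[t --> 0^'+] --> A + fine (jmp th).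
  exact: cvg_EFin.
pose h t := c * (fine (half_Pi_sqnorm mu P t df) + fine (half_Pi_sqnorm mu P t w)).
pose b := c * (nrm (cls df) ^+ 2 + nrm (cls w) ^+ 2).
have hb : h t @[t --> 0^'+] --> b.
  by apply: cvgM; [exact: cvg_cst|exact: cvgD].
apply: (cvg_perturb hb) => r r0 r1.
have [y [yO yc hy]] := twisted_approx wO wr fC r0.
have [h1 h2 h3 h4] := cmpE _ _ r0 r1 yO hy.
have [fy cy] := half_Pi_fine_cvg yO.
exists (fun t => fine (half_Pi_sqnorm mu P t y)), (nrm (cls y) ^+ 2); split => //.
  (* The H_c component of y is that of the linear twist for every r, so A stays fixed and only the
     jump terms have to be compared. *)
  have -> : nrm (cls y) ^+ 2 = A + fine (jmp y).
    have := Hc_part_sq yO; rewrite yc linear_twist_class// -/A -(fineK (jfin _ yO)) -EFinD.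
    by case.
  have jd : fine (jmp df) <= nrm (cls df) ^+ 2 by rewrite -lee_fin fineK ?jfin// jump_le_ofclass.
  have jw : fine (jmp w) <= nrm (cls w) ^+ 2 by rewrite -lee_fin fineK ?jfin// jump_le_ofclass.
  have le : r * c * (fine (jmp df) + fine (jmp w)) <= r * b.
    by rewrite -mulrA ler_wpM2l ?(ltW r0)// /b ler_wpM2l ?(ltW c0)// lerD.
  have i3 := fine_le_bound jthn (jfin _ yO) (jfin _ dfO) (jfin _ wO) h3.
  have i4 := fine_le_bound (jfin _ yO) jthn (jfin _ dfO) (jfin _ wO) h4.
  rewrite (_ : _ - _ = fine (jmp th) - fine (jmp y)); last by ring.
  apply: le_trans le; exact: normr_le_bounds i3 i4.
have t0 := nbhs_right_gt (0 : R).
apply: filterS (filterI (filterI (filterI near_th fy) t0) (filterI fdf fw)).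
move=> t [[[fth ft] {}t0] [fd' fw']].
have i1 := fine_le_bound fth ft fd' fw' (h1 _ t0).
have i2 := fine_le_bound ft fth fd' fw' (h2 _ t0).
by rewrite -mulrA in i1 i2; exact: normr_le_bounds i1 i2.
Qed.

Lemma magnetic_energy_funE w f : Omega1 E w -> real_valued w -> core_cst E f ->
  magnetic_energy_fun mu P w f =
  ((nrm (magnetic_derivative_c J (cls w) f) ^+ 2)%:E + jmp (twisted_diff w f))%E.
Proof.
move=> wO wr fC; apply: cvg_lim => //.
exact: (twisted_limit wO wr fC).1.
Qed.

(** * Approximation of a by real antisymmetric forms, and the representative of its jump part *)

Lemma Omega1J w : Omega1 E w -> Omega1 E (fun z => (w z)^*).
Proof.
have O1P := Omega1P P_semigroup P_conservative P_associated.
by move=> /O1P[tw w0]; apply/O1P; split=> [|x]; [exact: tensorJ|rewrite w0 rmorph0].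
Qed.

Lemma nrm_ofclassJ w : Omega1 E w -> nrm (cls (fun z => (w z)^*)) <= nrm (cls w).
Proof.
move=> wO; rewrite -[leRHS]mul1r; apply: ofclass_le => //; first exact: Omega1J.
by move=> z; rewrite expr1n mul1r sqmodJ.
Qed.

(** The two assumptions give an antisymmetric v and a real w near a. The real part of v is
    antisymmetric and no farther from w than v is, because conjugation does not increase the norm of
    H. *)
Lemma real_antisymmetric_seq (a : H) : Ha a -> real_oneform a ->
  exists r_ : nat -> X * X -> C,
    (forall n, (Omega1a E `&` (@real_valued R X)) (r_ n)) /\ (fun n => cls (r_ n)) @ \oo --> a.
Proof.
move=> aH [w_ [wP wa]].
have ex (n : nat) : exists r, (Omega1a E `&` (@real_valued R X)) r /\ nrm (a - cls r) < n.+1%:R^-1.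
  (* The distance from a to r is at most |a - w| + |v - w| <= 2 |a - w| + |a - v|, hence the
     division by 3. *)
  have e0 : 0 < n.+1%:R^-1 / 3 :> R by rewrite divr_gt0// invr_gt0.
  have e0' : 0 < (n.+1%:R^-1 / 3)%:C :> C by rewrite ltcR.
  have [_ [[v [vO va] <-]]] := aH _ (nbhsx_ballx a _ e0').
  rewrite -ball_normE /ball_/= nrmE ltcR => av.
  have [N /(_ _ (leqnn N)) aw] := (cvgVP _ _).1 wa _ e0.
  have [wO wr] := wP N; set w := w_ N in wO wr aw.
  pose r z := 2^-1 * v z + 2^-1 * (v z)^*.
  have vJ := Omega1J vO.
  have vO2 : Omega1 E (fun z => 2^-1 * v z) by apply: O1M => //; exact: tensor_cst.
  have vJ2 : Omega1 E (fun z => 2^-1 * (v z)^*) by apply: O1M => //; exact: tensor_cst.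
  exists r; split; [split; [split|]|].
  - exact: Omega1D.
  - by move=> x y; rewrite /r va rmorphN/= !mulrN opprD.
  - move=> z; rewrite /r -mulrDr ImM ImD ImJ subrr mulr0 add0r.
    by rewrite (_ : Im (2^-1 : C) = 0) ?mul0r// -(rmorph_nat (real_complex R)) -fmorphV.
  have vw : cls v - cls w = cls (fun z => v z - w z) by rewrite ofclassB.
  have vwJ : cls (fun z => (v z)^*) - cls w = cls (fun z => (v z - w z)^*).
    rewrite -ofclassB//; congr cls; apply/funext => z; rewrite rmorphB/=; congr (_ - _).
    by apply: eqC; rewrite ?ReJ ?ImJ// (wr z) oppr0.
  have rw : cls r - cls w = 2^-1 *: (cls v - cls w) + 2^-1 *: (cls (fun z => (v z)^*) - cls w).
    rewrite ofclassD// !ofclassZ// !scalerBr addrACA; congr (_ + _).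
    by rewrite -opprD -scalerDl -[in RHS](mul1r (2^-1)) -[X in X *: _]mulrDl mulfV ?scale1r// pnatr_eq0.
  have n2 : nc (2^-1 : C) = 2^-1.
    by rewrite -(rmorph_nat (real_complex R)) -fmorphV nc_real ger0_norm.
  have := nrmD (2^-1 *: (cls v - cls w)) (2^-1 *: (cls (fun z => (v z)^*) - cls w)).
  rewrite -rw !nrmZ n2 vwJ.
  have := nrm_ofclassJ (Omega1B vO wO); rewrite -vw.
  have := nrmD (cls v - a) (a - cls w); rewrite addrA subrK nrmB.
  have := nrmD (a - cls w) (cls w - cls r); rewrite addrA subrK [nrm (cls w - cls r)]nrmB.
  by move: av aw e0; move: n.+1%:R^-1 => e; lra.
have [r_ /all_and2[rP ra]] := choice ex; exists r_; split => //.
apply/cvgVP => e e0; have [N _ HN] := near_infty_natSinv_lt (PosNum e0).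
by exists N => n /HN; apply: lt_trans.
Qed.

Section jump_representative.
Variables (a : H) (aj : X * X -> C).
Hypothesis aj_repr : jump_representative J (Hj_part J a) aj.
Let mre : measurable_fun od (fun z => Re (aj z)). Proof. by case: aj_repr. Qed.
Let mim : measurable_fun od (fun z => Im (aj z)). Proof. by case: aj_repr. Qed.

Let O1re w : Omega1 E w -> measurable_fun od (fun z => Re (w z)).
Proof. by move=> /O1t/tensor_measurable[mr mi]; exact: measurable_funTS. Qed.
Let O1im w : Omega1 E w -> measurable_fun od (fun z => Im (w z)).
Proof. by move=> /O1t/tensor_measurable[mr mi]; exact: measurable_funTS. Qed.

(** The representative is defined by sequences converging to the jump part of a, while here w_n
    tends to a itself. Tensors d_n tending to the jump part mediate: the norm of w_n - d_n in L^2(J)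
    is the norm of its projection to K, which tends to 0. *)
Lemma jump_representative_cvg (w_ : nat -> X * X -> C) : (forall n, Omega1 E (w_ n)) ->
  (fun n => cls (w_ n)) @ \oo --> a ->
  jmp (fun z => w_ n z - aj z) @[n --> \oo] --> 0%E.
Proof.
move=> wO wa; have [_ _ rep] := aj_repr.
have Ka : od_closure (jump_proj a) := (jump_projP a).1.
have [d_ [odd dj]] := od_closure_seq Ka.
have c1 : jmp (fun z => d_ n z - aj z) @[n --> \oo] --> 0%E.
  by apply: rep => [n|]; [exact: O1od|rewrite Hj_partE].
have c2 : jmp (fun z => w_ n z - d_ n z) @[n --> \oo] --> 0%E.
  have -> : (fun n => jmp (fun z => w_ n z - d_ n z)) =
      fun n => (nrm (jump_proj (cls (w_ n)) - cls (d_ n)) ^+ 2)%:E.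
    apply/funext => n; rewrite jump_proj_ofclass; last by apply: Omega1B => //; exact: O1od.
    rewrite ofclassB//; last exact: O1od.
    by rewrite jump_projB (jump_proj_id (u := cls (d_ n)))//; exact: od_closure_od.
  have c : (fun n => jump_proj (cls (w_ n)) - cls (d_ n)) @ \oo --> (0 : H).
    by rewrite -(subrr (jump_proj a)); apply: cvgB => //; exact: jump_proj_cvg.
  by have := cvg_nrm_sq c; rewrite nrm0 expr0n.
have c3 : (2%:E * jmp (fun z => w_ n z - d_ n z)%R + 2%:E * jmp (fun z => d_ n z - aj z)%R @[n --> \oo] --> 0)%E.
  have -> : 0%E = (2%:E * 0 + 2%:E * 0 :> \bar R)%E by rewrite !mule0 adde0.
  by apply: cvgeD; [rewrite !mule0|exact: cvgeZl|exact: cvgeZl].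
apply: (squeeze_cvge (f := fun=> 0%E) _ _ c3); last exact: cvg_cst.
apply: nearW => n; rewrite jump_sqnorm_ge0/=.
have wm := O1re (wO n); have wi := O1im (wO n).
have dm := O1re (O1od (odd n)); have di := O1im (O1od (odd n)).
apply: integral_sqmod_le2 => //.
- apply: sqmod_measurable.
  + by under eq_fun do rewrite ReB; exact: measurable_funB.
  + by under eq_fun do rewrite ImB; exact: measurable_funB.
- apply: sqmod_measurable.
  + by under eq_fun do rewrite ReB; exact: measurable_funB.
  + by under eq_fun do rewrite ImB; exact: measurable_funB.
- apply: sqmod_measurable.
  + by under eq_fun do rewrite ReB; exact: measurable_funB.
  + by under eq_fun do rewrite ImB; exact: measurable_funB.
- move=> z _; have -> : w_ n z - aj z = (w_ n z - d_ n z) + (d_ n z - aj z).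
    by rewrite addrA subrK.
  exact: sqmodD_le2.
Qed.

(** [aj] is real only J-almost everywhere; this version is real everywhere, as the bound |e^{is} -
    e^{it}| <= |s - t| demands. *)
Definition real_part_form : X * X -> C := fun z => (Re (aj z))%:C.

Variable r_ : nat -> X * X -> C.
Hypothesis r_S : forall n, (Omega1a E `&` (@real_valued R X)) (r_ n).
Hypothesis r_a : (fun n => cls (r_ n)) @ \oo --> a.

(** For real r_n, |Im a_j| is at most |r_n - a_j|, which tends to 0 in L^2(J). *)
Lemma jump_representative_ae_real : {ae J, forall z, od z -> aj z = real_part_form z}.
Proof.
have rO n : Omega1 E (r_ n) := (r_S n).1.1.
have mI : measurable_fun od (fun z => sqmod (Im (aj z))%:C).
  by under eq_fun do rewrite sqmod_real; exact: measurable_funX.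
have I0 : (\int[J]_(z in od) `|(sqmod (Im (aj z))%:C)%:E|)%E = 0%E.
  apply/eqP; rewrite eq_le integral_ge0 ?andbT//.
  have cv := jump_representative_cvg rO r_a.
  rewrite -(cvg_lim (@ereal_hausdorff R) cv); apply: lime_ge; first exact: cvgP cv.
  apply: nearW => n.
  apply: ge0_le_integral => //.
  - by apply: measurableT_comp => //; exact/measurable_EFinP.
  - have wm := O1re (rO n); have wi := O1im (rO n).
    apply/measurable_EFinP; apply: sqmod_measurable.
    + by under eq_fun do rewrite ReB; exact: measurable_funB.
    + by under eq_fun do rewrite ImB; exact: measurable_funB.
  - move=> z _; rewrite gee0_abs ?lee_fin ?sqmod_ge0// sqmod_real sqmodE ImB.
    by rewrite ((r_S n).2 z) sub0r sqrrN lerDr sqr_ge0.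
have FF : Filter (almost_everywhere J) by exact: ae_filter_ringOfSetsType.
have mI' : measurable_fun od (fun z => (sqmod (Im (aj z))%:C)%:E) by exact/measurable_EFinP.
have := (ae_eq_integral_abs J mod_ mI').1 I0.
apply: filterS => z h oz; have := h oz => -[] /eqP; rewrite sqmod_real sqrf_eq0 => /eqP i0.
by apply: eqC.
Qed.

Lemma jump_representative_real_cvg :
  jmp (fun z => r_ n z - real_part_form z) @[n --> \oo] --> 0%E.
Proof.
have rO n : Omega1 E (r_ n) := (r_S n).1.1.
apply: (squeeze_cvge (f := fun=> 0%E) _ _ (jump_representative_cvg rO r_a)); last exact: cvg_cst.
apply: nearW => n; rewrite jump_sqnorm_ge0/= -[leRHS]mul1e.
have wm := O1re (rO n); have wi := O1im (rO n).
apply: (jump_sqnorm_le (M := 1)) => //.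
- apply: sqmod_measurable.
  + by under eq_fun do rewrite ReB; exact: measurable_funB.
  + by under eq_fun do rewrite ImB/= subr0.
- apply: sqmod_measurable.
  + by under eq_fun do rewrite ReB; exact: measurable_funB.
  + by under eq_fun do rewrite ImB; exact: measurable_funB.
- move=> z; rewrite mul1r !sqmodE !ReB !ImB /= lerD2l subr0 ((r_S n).2 z) sub0r.
  by rewrite expr0n sqr_ge0.
Qed.

End jump_representative.

(** * The energy formula for general a *)

Section energy_formula.
Variables (a : H) (aj : X * X -> C).
Hypothesis aj_repr : jump_representative J (Hj_part J a) aj.
Let mre : measurable_fun od (fun z => Re (aj z)). Proof. by case: aj_repr. Qed.
Let mim : measurable_fun od (fun z => Im (aj z)). Proof. by case: aj_repr. Qed.

Let O1re w : Omega1 E w -> measurable_fun od (fun z => Re (w z)).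
Proof. by move=> /O1t/tensor_measurable[mr mi]; exact: measurable_funTS. Qed.
Let O1im w : Omega1 E w -> measurable_fun od (fun z => Im (w z)).
Proof. by move=> /O1t/tensor_measurable[mr mi]; exact: measurable_funTS. Qed.

Let RJ := real_part_form aj.

Let mreB w : Omega1 E w -> measurable_fun od (fun z => sqmod (w z - RJ z)).
Proof.
move=> wO; have wm := O1re wO; have wi := O1im wO; apply: sqmod_measurable.
- by under eq_fun do rewrite ReB; exact: measurable_funB.
- by under eq_fun do rewrite ImB/= subr0.
Qed.

Let mtw w f : core_cst E f -> measurable_fun od (fun z => Re (w z)) ->
  measurable_fun od (fun z => Im (w z)) ->
  measurable_fun od (fun z => sqmod (twisted_diff w f z)).
Proof.
move=> fC mr mi; have [tr ti] := twisted_measurable mod_ fC mr mi.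
exact: sqmod_measurable.
Qed.

Let mRJre : measurable_fun od (fun z => Re (RJ z)). Proof. exact: mre. Qed.
Let mRJim : measurable_fun od (fun z => Im (RJ z)). Proof. exact: measurable_cst. Qed.

(** The twisted differences of r_n and a_j differ pointwise by at most N |r_n - a_j|, so the
    possibly unbounded a_j enters only through its distance to r_n in L^2(J). *)
Lemma twisted_jump_cvg (r_ : nat -> X * X -> C) f :
  (forall n, (Omega1a E `&` (@real_valued R X)) (r_ n)) ->
  (fun n => cls (r_ n)) @ \oo --> a -> core_cst E f ->
  jmp (twisted_diff RJ f) \is a fin_num /\
  fine (jmp (twisted_diff (r_ n) f)) @[n --> \oo] --> fine (jmp (twisted_diff RJ f)).
Proof.
move=> r_S r_a fC; have rO n : Omega1 E (r_ n) := (r_S n).1.1.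
have rr n : real_valued (r_ n) := (r_S n).2.
have [N N0 fN] := core_cst_bounded fC.
have /fine_cvgP[[m0 _ /(_ m0 (leqnn _))/= fm] dcvg] := jump_representative_real_cvg aj_repr r_S r_a.
have jfin (x : X * X -> C) : Omega1 E x -> jmp x \is a fin_num.
  by move=> xO; rewrite ge0_fin_numE ?jump_sqnorm_ge0// (le_lt_trans (jump_le_ofclass xO))// ltry.
(* The convergence provides finiteness from some index m0 on; every other r_n is compared with
   r_{m0}, differences of 1-forms having finite norm in L^2(J). *)
have dfin n : jmp (fun z => r_ n z - RJ z) \is a fin_num.
  have Om : Omega1 E (fun z => r_ n z - r_ m0 z) by exact: Omega1B.
  apply: (lin_fin_num (jump_sqnorm_ge0 _) (jfin _ Om) fm (k := 2) (l := 2)).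
  apply: integral_sqmod_le2 => //; [exact: mreB|apply: sqmod_measurable; [exact: O1re|exact: O1im]|exact: mreB|].
  move=> z _; have -> : r_ n z - RJ z = (r_ n z - r_ m0 z) + (r_ m0 z - RJ z).
    by rewrite addrA subrK.
  exact: sqmodD_le2.
have diff n z : sqmod (twisted_diff (r_ n) f z - twisted_diff RJ f z) <=
    N ^+ 2 * sqmod (r_ n z - RJ z).
  have -> : twisted_diff (r_ n) f z - twisted_diff RJ f z =
      (expc ('i%C * RJ z) - expc ('i%C * r_ n z)) * f z.2 by rewrite /twisted_diff; ring.
  rewrite sqmodM mulrC; apply: ler_pM; rewrite ?sqmod_ge0//.
    by rewrite /sqmod ler_sqr ?nnegrE ?nc_ge0.
  rewrite (expc_eir (rr n z)) (expc_eir (z := RJ z))//.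
  apply: le_trans (sqmod_eirB _ _) _; rewrite sqmodE ReB -[_ - Re (RJ z)]opprB sqrrN.
  by rewrite lerDl sqr_ge0.
have mr n : measurable_fun od (fun z => sqmod (twisted_diff (r_ n) f z)).
  by apply: mtw => //; [exact: O1re|exact: O1im].
have mR : measurable_fun od (fun z => sqmod (twisted_diff RJ f z)) by exact: mtw.
have le1 e n : 0 < e -> (jmp (twisted_diff (r_ n) f) <= (1 + e)%:E * jmp (twisted_diff RJ f) +
    ((1 + e^-1) * N ^+ 2)%:E * jmp (fun z => r_ n z - RJ z)%R)%E.
  move=> e0; have ei : 0 < e^-1 by rewrite invr_gt0.
  apply: integral_sqmod_le2 => //; [exact: mreB|by rewrite addr_ge0// ltW| |].
    by rewrite mulr_ge0 ?sqr_ge0// addr_ge0// ltW.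
  move=> z _; have {1}-> : twisted_diff (r_ n) f z = twisted_diff RJ f z +
    (twisted_diff (r_ n) f z - twisted_diff RJ f z) by rewrite addrC subrK.
  apply: le_trans (sqmodD_le _ _ e0) _; rewrite lerD2l -mulrA ler_wpM2l//.
  by rewrite addr_ge0// ltW.
have le2 e n : 0 < e -> (jmp (twisted_diff RJ f) <= (1 + e)%:E * jmp (twisted_diff (r_ n) f) +
    ((1 + e^-1) * N ^+ 2)%:E * jmp (fun z => r_ n z - RJ z)%R)%E.
  move=> e0; have ei : 0 < e^-1 by rewrite invr_gt0.
  apply: integral_sqmod_le2 => //; [exact: mreB|by rewrite addr_ge0// ltW| |].
    by rewrite mulr_ge0 ?sqr_ge0// addr_ge0// ltW.
  move=> z _; have {1}-> : twisted_diff RJ f z = twisted_diff (r_ n) f z +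
    - (twisted_diff (r_ n) f z - twisted_diff RJ f z) by rewrite opprB addrC subrK.
  apply: le_trans (sqmodD_le _ _ e0) _; rewrite sqmodN lerD2l -mulrA ler_wpM2l//.
  by rewrite addr_ge0// ltW.
have twfin n : jmp (twisted_diff (r_ n) f) \is a fin_num.
  rewrite ge0_fin_numE ?jump_sqnorm_ge0//.
  exact: (twisted_limit (rO n) (rr n) fC).2.
have RJfin := lin_fin_num (jump_sqnorm_ge0 _) (twfin 0%N) (dfin 0%N) (le2 _ 0%N ltr01).
split => //.
apply: (@cvg_of_weighted_triangle _ _ (fun n => N ^+ 2 * fine (jmp (fun z => r_ n z - RJ z)))).
- by move=> n; apply: fine_ge0; exact: jump_sqnorm_ge0.
- by apply: fine_ge0; exact: jump_sqnorm_ge0.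
- by rewrite -(mulr0 (N ^+ 2)); apply: cvgM; [exact: cvg_cst|exact: dcvg].
- by move=> e n e0; rewrite mulrA; exact: fine_le_lin (twfin n) RJfin (dfin n) (le1 _ _ e0).
- by move=> e n e0; rewrite mulrA; exact: fine_le_lin RJfin (twfin n) (dfin n) (le2 _ _ e0).
Qed.

Lemma magnetic_derivative_c_cvg (u_ : nat -> H) f : core_cst E f -> u_ @ \oo --> a ->
  (fun n => magnetic_derivative_c J (u_ n) f) @ \oo --> magnetic_derivative_c J a f.
Proof.
move=> fC ua; apply: cvgB; first exact: cvg_cst.
by apply: cvgZr; apply: (ract_cvg fC); exact: Hc_part_cvg.
Qed.

Lemma magnetic_energyE f : Ha a -> real_oneform a -> core_cst E f ->
  fine (magnetic_energy a f) =
  nrm (magnetic_derivative_c J a f) ^+ 2 + fine (jmp (twisted_diff RJ f)).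
Proof.
move=> aH ar fC.
suff -> : magnetic_energy a f =
    (nrm (magnetic_derivative_c J a f) ^+ 2 + fine (jmp (twisted_diff RJ f)))%:E by [].
apply: extend_along_eq.
  exact: (real_antisymmetric_seq aH ar).
move=> w_ wS wa; have [_ tc] := twisted_jump_cvg wS wa fC.
have -> : (fun n => magnetic_energy_fun mu P (w_ n) f) =
    fun n => (nrm (magnetic_derivative_c J (cls (w_ n)) f) ^+ 2 +
      fine (jmp (twisted_diff (w_ n) f)))%:E.
  apply/funext => n; have [[wO _] wr] := wS n.
  rewrite (magnetic_energy_funE wO wr fC).
  rewrite EFinD fineK// ge0_fin_numE ?jump_sqnorm_ge0//.
  exact: (twisted_limit wO wr fC).2.
apply: cvg_EFin; first exact: nearW.
apply: cvgD => //; have := cvg_nrm_sq (magnetic_derivative_c_cvg fC wa).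
by move/fine_cvgP => [].
Qed.

End energy_formula.

(** * Polarization of the energy formula *)

Lemma jump_sqnorm_integrable (F : X * X -> C) :
  measurable_fun od (fun z => Re (F z)) -> measurable_fun od (fun z => Im (F z)) ->
  jmp F \is a fin_num -> J.-integrable od (fun z => (sqmod (F z))%:E).
Proof.
move=> mr mi Ffin; apply/integrableP; split.
  by apply/measurable_EFinP; exact: sqmod_measurable.
have -> : (\int[J]_(z in od) `|(sqmod (F z))%:E|)%E = jmp F.
  by apply: eq_integral => z _; rewrite gee0_abs// lee_fin sqmod_ge0.
by rewrite -ge0_fin_numE// jump_sqnorm_ge0.
Qed.

(** Expansion of |F + c G|^2 with |c| = 1; the mixed terms are integrable because |F| |G| <= |F|^2 +
    |G|^2. *)
Lemma jump_sqnorm_polar (F G : X * X -> C) (c : C) :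
  measurable_fun od (fun z => Re (F z)) -> measurable_fun od (fun z => Im (F z)) ->
  measurable_fun od (fun z => Re (G z)) -> measurable_fun od (fun z => Im (G z)) ->
  jmp F \is a fin_num -> jmp G \is a fin_num -> c * c^* = 1 ->
  let I := (\int[J]_(z in od) Re (F z * (G z)^*)) +i* (\int[J]_(z in od) Im (F z * (G z)^*)) in
  (fine (jmp (fun z => F z + c * G z)))%:C =
  (fine (jmp F))%:C + c^* * I + c * I^* + (fine (jmp G))%:C.
Proof.
move=> Fr Fi Gr Gi Ffin Gfin cc I.
have mre : measurable_fun od (fun z => Re (F z * (G z)^*)).
  under eq_fun do rewrite Re_mulJ.
  by apply: measurable_funD; exact: measurable_funM.
have mim : measurable_fun od (fun z => Im (F z * (G z)^*)).
  under eq_fun do rewrite ImM ReJ ImJ mulrN addrC.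
  by apply: measurable_funB; exact: measurable_funM.
have iF := jump_sqnorm_integrable Fr Fi Ffin; have iG := jump_sqnorm_integrable Gr Gi Gfin.
have dom z : nc (F z * (G z)^*) <= sqmod (F z) + sqmod (G z).
  have -> : nc (F z * (G z)^*) = nc (F z) * nc (G z).
    by rewrite ncM; congr (_ * _); apply/eqP; rewrite -(@eqrXn2 _ 2) ?nc_ge0//; apply/eqP; exact: sqmodJ.
  have := sqr_ge0 (nc (F z) - nc (G z)); have := nc_ge0 (F z); have := nc_ge0 (G z).
  by rewrite /sqmod; nra.
have iFG : J.-integrable od (fun z => (sqmod (F z) + sqmod (G z))%:E).
  by have := integrableD mod_ iF iG; apply: eq_integrable.
have ire : J.-integrable od (EFin \o (fun z => Re (F z * (G z)^*))).
  apply: le_integrable iFG => //; first exact/measurable_EFinP.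
  move=> z _ /=; rewrite lee_fin [leRHS]ger0_norm ?addr_ge0 ?sqmod_ge0//.
  exact: le_trans (nc_Re _) (dom z).
have iim : J.-integrable od (EFin \o (fun z => Im (F z * (G z)^*))).
  apply: le_integrable iFG => //; first exact/measurable_EFinP.
  move=> z _ /=; rewrite lee_fin [leRHS]ger0_norm ?addr_ge0 ?sqmod_ge0//.
  exact: le_trans (nc_Im _) (dom z).
have c1 : sqmod c = 1 by rewrite sqmod_mulJ cc.
pose q z := 2 * Re c * Re (F z * (G z)^*) + 2 * Im c * Im (F z * (G z)^*).
have iq1 : J.-integrable od (EFin \o (fun z => 2 * Re c * Re (F z * (G z)^*))).
  by have := integrableZl mod_ (2 * Re c) ire; apply: eq_integrable.
have iq2 : J.-integrable od (EFin \o (fun z => 2 * Im c * Im (F z * (G z)^*))).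
  by have := integrableZl mod_ (2 * Im c) iim; apply: eq_integrable.
have iq : J.-integrable od (EFin \o q).
  by have := integrableD mod_ iq1 iq2; apply: eq_integrable.
have E1 : fine (jmp (fun z => F z + c * G z)) =
    \int[J]_(z in od) ((sqmod (F z) + sqmod (G z)) + q z).
  rewrite /jump_sqnorm /Rintegral; congr fine; apply: eq_integral => z _; congr _%:E.
  have -> : sqmod (G z) = sqmod c * sqmod (G z) by rewrite c1 mul1r.
  rewrite /q !sqmodE !(ReD, ImD, ReM, ImM, ReJ, ImJ); ring.
have -> : fine (jmp (fun z => F z + c * G z)) = fine (jmp F) + fine (jmp G) +
    (2 * Re c * \int[J]_(z in od) Re (F z * (G z)^*) +
     2 * Im c * \int[J]_(z in od) Im (F z * (G z)^*)).
  rewrite E1 RintegralD// RintegralD//; congr (_ + _).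
  by rewrite RintegralD// !RintegralZl.
by apply: eqC; rewrite !(ReD, ImD, ReM, ImM, ReJ, ImJ) /I/=; ring.
Qed.

Lemma unit_modulus (k : nat) : ('i%C ^+ k : C) * conjc ('i%C ^+ k) = 1.
Proof.
elim: k => [|k IHk]; first by rewrite expr0 mul1r rmorph1.
rewrite exprS rmorphM/= mulrACA [X in _ * X]IHk mulr1.
by apply: eqC; rewrite ?ReM ?ImM/=; ring.
Qed.

Lemma core_cst_lin (c : C) f g : core_cst E f -> core_cst E g ->
  core_cst E (fun x => f x + c * g x).
Proof.
move=> fC gC; apply: core_cstD => //.
apply: (core_cstM P_semigroup P_conservative P_associated) => //.
exact: core_cst_cst.
Qed.

(** The defining properties of the action give linearity in the vector. Linearity in the function
    holds on classes of 1-forms, where the action is multiplication by h(y), and extends by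
    density. *)
Lemma ract_lin_l (c : C) f g u : core_cst E f -> core_cst E g ->
  ract (fun x => f x + c * g x) u = ract f u + c *: ract g u.
Proof.
move=> fC gC; have fgC := core_cst_lin c fC gC.
have [w_ [wO wu]] := Omega1_seq u.
have rE := ract_ofclass.
have c1 := ract_cvg fgC wu.
have c2 : (fun n => ract (fun x => f x + c * g x) (cls (w_ n))) @ \oo --> ract f u + c *: ract g u.
  have -> : (fun n => ract (fun x => f x + c * g x) (cls (w_ n))) =
      fun n => ract f (cls (w_ n)) + c *: ract g (cls (w_ n)).
    apply/funext => n; rewrite !rE//.
    have wm (h : X -> C) : core_cst E h -> Omega1 E (fun z => w_ n z * h z.2).
      by move=> hC; under eq_fun do rewrite mulrC; apply: O1M => //; exact: tensor_snd.
    rewrite addrC -(ofclass_linear H); [|exact: wm..].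
    by congr cls; apply/funext => z; ring.
  by apply: cvgD; [exact: ract_cvg|apply: cvgZr; exact: ract_cvg].
exact: (cvg_unique _ c1 c2).
Qed.

Lemma magnetic_derivative_c_lin (a : H) (c : C) f g : core_cst E f -> core_cst E g ->
  magnetic_derivative_c J a (fun x => f x + c * g x) =
  magnetic_derivative_c J a f + c *: magnetic_derivative_c J a g.
Proof.
move=> fC gC; rewrite /magnetic_derivative_c ract_lin_l//.
have -> : partial H (fun x => f x + c * g x) = c *: partial H g + partial H f.
  rewrite /partial -(ofclass_linear H); last 2 first.
  - by apply: Omega1_elem => //; exact: core_cst_cst.
  - by apply: Omega1_elem => //; exact: core_cst_cst.
  by congr cls; apply/funext => z; rewrite /elem_form; ring.
rewrite Hc_part_lin [c *: _ + Hc_part J _]addrC scalerDr opprD addrACA scalerBr; congr (_ + (_ - _)).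
by rewrite !scalerA mulrC.
Qed.

Variables (a : H) (aj : X * X -> C).
Hypothesis a_Ha : Ha a.
Hypothesis a_real : real_oneform a.
Hypothesis aj_repr : jump_representative J (Hj_part J a) aj.
Let RJ := real_part_form aj.
Let mre : measurable_fun od (fun z => Re (aj z)). Proof. by case: aj_repr. Qed.
Let mim : measurable_fun od (fun z => Im (aj z)). Proof. by case: aj_repr. Qed.

Lemma magnetic_form_j_real f g : core_cst E f -> core_cst E g ->
  magnetic_form_j J aj f g = magnetic_form_j J RJ f g.
Proof.
move=> fC gC.
have [r_ [rS ra]] := real_antisymmetric_seq a_Ha a_real.
have ae := jump_representative_ae_real aj_repr rS ra.
have mR : measurable_fun od (fun z => Re (RJ z)) by exact: mre.
have mI : measurable_fun od (fun z => Im (RJ z)) by exact: measurable_cst.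
have mF (b : X * X -> C) : measurable_fun od (fun z => Re (b z)) ->
    measurable_fun od (fun z => Im (b z)) ->
    measurable_fun od (fun z => Re (twisted_diff b f z * (twisted_diff b g z)^*)) /\
    measurable_fun od (fun z => Im (twisted_diff b f z * (twisted_diff b g z)^*)).
  move=> br bi; have [fr fi] := twisted_measurable mod_ fC br bi.
  have [gr gi] := twisted_measurable mod_ gC br bi; split.
  - under eq_fun do rewrite Re_mulJ.
    by apply: measurable_funD; exact: measurable_funM.
  - under eq_fun do rewrite ImM ReJ ImJ mulrN addrC.
    by apply: measurable_funB; exact: measurable_funM.
have [m1 m2] := mF _ mre mim; have [m3 m4] := mF _ mR mI.
have FF : Filter (almost_everywhere J) by exact: ae_filter_ringOfSetsType.
rewrite /magnetic_form_j; congr (_ +i* _); rewrite /Rintegral; congr fine.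
- apply: ae_eq_integral => //; [exact/measurable_EFinP|exact/measurable_EFinP|].
  by apply: filterS ae => z h oz; rewrite /twisted_diff h.
- apply: ae_eq_integral => //; [exact/measurable_EFinP|exact/measurable_EFinP|].
  by apply: filterS ae => z h oz; rewrite /twisted_diff h.
Qed.

Lemma nrm_sq_polar (u v : H) (c : C) : c * c^* = 1 ->
  (nrm (u + c *: v) ^+ 2)%:C =
  (nrm u ^+ 2)%:C + c^* * ip H u v + c * ip H v u + (nrm v ^+ 2)%:C.
Proof.
move=> cc; rewrite -!(ip_nrm ipn) ipDl !ipDr !ipZl !ipZr mulrA cc mul1r.
by rewrite !addrA.
Qed.

Lemma magnetic_form_decomposition f g : core_cst E f -> core_cst E g ->
  magnetic_form a f g = magnetic_form_c J a f g + magnetic_form_j J aj f g.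
Proof.
move=> fC gC; rewrite magnetic_form_j_real//.
have [r_ [rS ra]] := real_antisymmetric_seq a_Ha a_real.
have twc := twisted_jump_cvg aj_repr rS ra.
have mR : measurable_fun od (fun z => Re (RJ z)) by exact: mre.
have mI : measurable_fun od (fun z => Im (RJ z)) by exact: measurable_cst.
have [Fr Fi] := twisted_measurable mod_ fC mR mI.
have [Gr Gi] := twisted_measurable mod_ gC mR mI.
have [Ff _] := twc _ fC; have [Gf _] := twc _ gC.
set A := magnetic_derivative_c J a f; set B := magnetic_derivative_c J a g.
(* This has the shape required by [polarization4]: summing over c = i^k extracts the coefficient of
   the conjugate of c, the sum of the two claimed forms. *)
have expand (c : C) : c * c^* = 1 ->
    (fine (magnetic_energy a (fun x => f x + c * g x)))%:C =
    ((nrm A ^+ 2)%:C + (fine (jmp (twisted_diff RJ f)))%:C) +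
    c^* * (ip H A B + magnetic_form_j J RJ f g) +
    c * (ip H B A + (magnetic_form_j J RJ f g)^*) +
    ((nrm B ^+ 2)%:C + (fine (jmp (twisted_diff RJ g)))%:C).
  move=> cc; have fgC := core_cst_lin c fC gC.
  rewrite (magnetic_energyE aj_repr a_Ha a_real fgC).
  rewrite magnetic_derivative_c_lin// rmorphD/= nrm_sq_polar//.
  have -> : twisted_diff (real_part_form aj) (fun x => f x + c * g x) =
      fun z => twisted_diff RJ f z + c * twisted_diff RJ g z.
    by apply/funext => z; rewrite /twisted_diff /RJ; ring.
  rewrite (jump_sqnorm_polar Fr Fi Gr Gi Ff Gf cc) -/(magnetic_form_j J RJ f g).
  by rewrite -/A -/B; ring.
rewrite /magnetic_form; under eq_bigr => k _ do rewrite expand ?unit_modulus//.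
exact: polarization4.
Qed.

End one_forms.

Theorem lemma4p3 (R : realType) (X : pmetricType R)
    (mu : {measure set borel X -> \bar R})
    (E : dirichlet_form mu)
    (P : R -> R.-spker borel X ~> borel X)
    (J : {measure set (borel X * borel X) -> \bar R})
    (H : one_form_space E P)
    (X_locally_compact : locally_compact [set: X])
    (X_separable : separable_space X)
    (mu_radon : radon_on mu (@compact X) [set: X])
    (mu_full : full_support mu)
    (E_regular : regular_form E)
    (P_semigroup : symmetric_markov_semigroup mu P)
    (P_conservative : conservative mu P)
    (P_associated : associated E P)
    (J_jump : is_jump_measure E J)
    (a : H) (a_Ha : Ha a) (a_real : real_oneform a)
    (aj : X * X -> R[i]) (aj_repr : jump_representative J (Hj_part J a) aj)
    (f g : X -> R[i]) (fC : core E f) (gC : core E g) :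
  magnetic_form a f g = magnetic_form_c J a f g + magnetic_form_j J aj f g.
Proof.
apply: (magnetic_form_decomposition X_separable P_semigroup P_conservative P_associated
  J_jump a_Ha a_real aj_repr); exact: core_core_cst.
Qed.
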